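(* For every fixed $t\in\mathbb{R}$, the function $z\mapsto\mathfrak{S}_t(z)$ belongs to $L^2(\mathbb{R})$ (unconditionally, i.e. without assuming the Riemann hypothesis).
   Context: Let $\xi(s)=\frac12 s(s-1)\pi^{-s/2}\Gamma(s/2)\zeta(s)$ be the Riemann xi-function, $F^\sharp(z):=\overline{F(\bar z)}$, $E_\xi(z):=\xi(1/2-iz)+\xi'(1/2-iz)$ ($\xi'$ = derivative in $s$), and $\Theta_\xi:=E_\xi^\sharp/E_\xi$ (a meromorphic function on $\mathbb{C}$). Let $\Lambda$ be the von Mangoldt function and $\Phi(z,s,a)=\sum_{n\ge0}z^n(n+a)^{-s}$ the Hurwitz–Lerch zeta-function. For $t\ge0$ define the meromorphic function of $z$ $$\begin{aligned}\mathfrak{P}_t(z):={}&\frac{4(e^{t/2}-1)}{1+2iz}+\frac{4(e^{-t/2}-1)}{1-2iz}+\frac{e^{-izt}-1}{iz}\frac{\zeta'}{\zeta}\Bigl(\frac12-iz\Bigr)+\sum_{n\le e^t}\frac{\Lambda(n)}{\sqrt n}\frac{e^{-iz(t-\log n)}-1}{iz}\\&-\frac1{2iz}\Bigl[\frac{\Gamma'}{\Gamma}\Bigl(\frac14-\frac{iz}2\Bigr)-\frac{\Gamma'}{\Gamma}\Bigl(\frac14\Bigr)\Bigr]-\frac{1}{2iz}e^{-t/2}\Bigl[\Phi(e^{-2t},1,\tfrac12(\tfrac12-iz))-\Phi(e^{-2t},1,\tfrac14)\Bigr],\end{aligned}$$ where for $t=0$ the last bracket is understood as the limit $t\to0^+$.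 For $t\ge0$ put $$\mathfrak{S}_t(z):=\frac{i(1+\Theta_\xi^\sharp(z))}{2}\,\mathfrak{P}_t(z),$$ a meromorphic function of $z$ (removable singularities are filled in). For $t<0$ put $\mathfrak{S}_t(z):=\mathfrak{S}_{-t}(z)$. *)

(* Defs.v *)
From HB Require Import structures.
From mathcomp Require Import all_boot all_order all_algebra.
From mathcomp Require Import complex.
From mathcomp Require Import all_classical all_reals all_analysis.
Set Implicit Arguments.
Unset Strict Implicit.
Unset Printing Implicit Defensive.
Import Order.TTheory GRing.Theory Num.Theory.
Import numFieldNormedType.Exports.
Local Open Scope complex_scope.
Local Open Scope ring_scope.
Local Open Scope classical_set_scope.

(* The complex numbers are R[i] over R : realType, normed by the modulus; the
   library attaches this topology to R[i]^o only. *)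
HB.instance Definition _ (R : rcfType) := NormedModule.copy R[i] R[i]^o.

(* Meromorphic functions are handled as total functions that are correct off a
   discrete set (x / 0 = 0 at the bad points). [fill f] fills in the removable
   singularities; where f is already continuous it agrees with f. *)
Definition fill (R : realType) (f : R[i] -> R[i]) (z : R[i]) : R[i] :=
  lim (f w @[w --> z^']).

Definition analytic_at (R : realType) (f : R[i] -> R[i]) (z : R[i]) : Prop :=
  exists a : nat -> R[i],
    \forall w \near z, series (fun n => a n * (w - z) ^+ n) @ \oo --> f w.

Definition sharp (R : realType) (F : R[i] -> R[i]) (z : R[i]) : R[i] :=
  (F z^*)^*.

Definition cexp (R : realType) (z : R[i]) : R[i] :=
  (expR (complex.Re z))%:C
  * (cos (complex.Im z) +i* sin (complex.Im z)).

(* x ^ s = exp (s log x), for x > 0 *)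
Definition cpow (R : realType) (x : R) (s : R[i]) : R[i] :=
  cexp (s * (ln x)%:C).

Definition logderiv (R : realType) (f : R[i] -> R[i]) (z : R[i]) : R[i] :=
  derive1 f z / f z.

(* Gauss's product, valid on the whole plane off the poles 0, -1, -2, ... *)
Definition Gamma (R : realType) (z : R[i]) : R[i] :=
  limn (fun n : nat =>
    cpow n%:R z * (n`!)%:R / \prod_(0 <= k < n.+1) (z + k%:R)).

(* The Riemann zeta-function: the analytic continuation to C \ {1} of the
   Dirichlet series. By the identity theorem these two clauses determine zeta
   off 1; its value at the pole 1 is irrelevant. *)
Definition is_riemann_zeta (R : realType) (zeta : R[i] -> R[i]) : Prop :=
  (forall s : R[i], 1 < complex.Re s ->
     series (fun n : nat => cpow n.+1%:R (- s)) @ \oo --> zeta s)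
  /\ (forall s : R[i], s != 1 -> analytic_at zeta s).

Definition xi (R : realType) (zeta : R[i] -> R[i]) : R[i] -> R[i] :=
  fill (fun s => 2^-1 * s * (s - 1) * cpow pi (- (s / 2)) * Gamma (s / 2)
                 * zeta s).

Definition E_xi (R : realType) (zeta : R[i] -> R[i]) (z : R[i]) : R[i] :=
  xi zeta (2^-1 - 'i%C * z) + derive1 (xi zeta) (2^-1 - 'i%C * z).

Definition Theta_xi (R : realType) (zeta : R[i] -> R[i]) (z : R[i]) : R[i] :=
  sharp (E_xi zeta) z / E_xi zeta z.

(* ln p if n is a power p ^ k (k >= 1) of a prime p, i.e. if p is the only
   prime divisor of n, and 0 otherwise *)
Definition vonMangoldt (R : realType) (n : nat) : R :=
  if primes n is [:: p] then ln p%:R else 0.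

(* Hurwitz-Lerch zeta-function, for natural exponents s: no choice of branch
   of (n + a) ^ s is then involved, and only s = 1 occurs. *)
Definition lerch (R : realType) (z : R[i]) (s : nat) (a : R[i]) : R[i] :=
  limn (series (fun n : nat => z ^+ n * (n%:R + a) ^- s)).

Definition lerch_bracket (R : realType) (t : R) (z : R[i]) : R[i] :=
  let b (u : R) := lerch (expR (- (2 * u)))%:C 1 (2^-1 * (2^-1 - 'i%C * z))
                   - lerch (expR (- (2 * u)))%:C 1 4^-1 in
  if t == 0 then lim (b u @[u --> 0^'+]) else b t.

Definition frakP (R : realType) (zeta : R[i] -> R[i]) (t : R) (z : R[i])
    : R[i] :=
  4 * ((expR (t / 2))%:C - 1) / (1 + 2 * 'i%C * z)
  + 4 * ((expR (- (t / 2)))%:C - 1) / (1 - 2 * 'i%C * z)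
  + (cexp (- ('i%C * z * t%:C)) - 1) / ('i%C * z) * logderiv zeta (2^-1 - 'i%C * z)
  + \sum_(1 <= n < (Num.truncn (expR t)).+1)
      (vonMangoldt R n / Num.sqrt n%:R)%:C
      * ((cexp (- ('i%C * z * (t - ln n%:R)%:C)) - 1) / ('i%C * z))
  - (2 * 'i%C * z)^-1
    * (logderiv (@Gamma R) (4^-1 - 'i%C * z / 2) - logderiv (@Gamma R) 4^-1)
  - (2 * 'i%C * z)^-1 * (expR (- (t / 2)))%:C * lerch_bracket t z.

Definition frakS (R : realType) (zeta : R[i] -> R[i]) (t : R) : R[i] -> R[i] :=
  fill (fun z => 'i%C * (1 + sharp (Theta_xi zeta) z) / 2 * frakP zeta `|t| z).

Definition L2 (R : realType) (f : R -> R[i]) : Prop :=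
  [/\ measurable_fun setT (fun x => complex.Re (f x)),
      measurable_fun setT (fun x => complex.Im (f x))
    & (\int[@lebesgue_measure R]_x ((complex.Re `|f x|) ^+ 2)%:E
       < +oo)%E].

(* Main.v *)
(* On the critical line xi = p is real and xi' = i q is imaginary, so that
   1 + Theta^sharp = 2 p / (p - i q), whose zeros cancel the poles of
   zeta'/zeta = i q / p - A'/A, where xi = A zeta. The remaining terms are
   elementary or differences of the digamma and Lerch functions, and the product
   is O((1 + |x|)^(-3/4)) off the countable closed set made of 0 and the zeros of
   zeta, unconditionally. That xi is real there is Riemann's second proof of the
   functional equation: pi^(-z) Gamma(z) zeta(2 z) is the Mellin transform of a
   theta series, the theta identity is Polya's limit of a finite identity between
   binomial coefficients and cosines, and the identity theorem for power series,
   applied along horizontal segments, carries the formula from Re s > 1 to the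
   critical line. *)

Require Import Defs.
From HB Require Import structures.
From mathcomp Require Import all_boot all_order all_algebra.
From mathcomp Require Import complex.
From mathcomp Require Import all_classical all_reals all_analysis.
From mathcomp Require Import measurable_realfun.
From mathcomp Require Import ring lra zify.
Set Implicit Arguments.
Unset Strict Implicit.
Unset Printing Implicit Defensive.
Import Order.TTheory GRing.Theory Num.Theory.
Import numFieldNormedType.Exports.

Local Open Scope complex_scope.
Local Open Scope ring_scope.
Local Open Scope classical_set_scope.

Local Notation Re := (@complex.Re _).
Local Notation Im := (@complex.Im _).

(** * Complex limits and derivatives *)

(** The bound is unconditional because p and q are the coordinates of p - i q: the ratios p / (p - i
    q) and q / (p - i q) have modulus at most 1 whatever the size of xi, so that only A'/A, a
    digamma value, is left to estimate. Splitting k + 1 + |x| into powers 1/4 and 3/4 bounds it by a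
    multiple of (1 + |x|)^(1/4), cruder than the true logarithm; against the decay 1/|x| of the
    difference quotient this leaves the exponent -3/4, below the -1/2 that square integrability asks
    for. The obstacle is the reality of xi, since zeta is given only by its Dirichlet series on Re s
    > 1 and by local power series. The tools are built from real calculus: complex derivatives are
    controlled by the mean value theorem on segments, analyticity is obtained by expanding e^(zu)
    under a Mellin integral, and Gamma is reached from Gauss's product through beta integrals. The
    continuation moves at constant nonzero imaginary part, away from the pole at 1 and inside Re s >
    0; the identity theorem then becomes a least upper bound argument on [0, 1]. *)

Section ComplexModulus.
Context {R : realType}.
Implicit Types (z w : R[i]) (x e : R).

(** The norm of [R[i]] takes its values in [R[i]]; a real-valued modulus makes the order of [R], and
    with it [lra] and [nra], available. *)
Definition cabs z : R := Re `|z|.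

Lemma cabsE z : `|z| = (cabs z)%:C.
Proof. by rewrite /cabs normc_def. Qed.

Lemma cabs_sqrt z : cabs z = Num.sqrt (Re z ^+ 2 + Im z ^+ 2).
Proof. by rewrite /cabs normc_def. Qed.

Lemma cabs_sqr z : cabs z ^+ 2 = Re z ^+ 2 + Im z ^+ 2.
Proof. by rewrite cabs_sqrt sqr_sqrtr// addr_ge0// sqr_ge0. Qed.

Lemma cabs_ge0 z : 0 <= cabs z. Proof. by rewrite cabs_sqrt sqrtr_ge0. Qed.

Lemma cabsM z w : cabs (z * w) = cabs z * cabs w.
Proof. by apply: (@complexI R); rewrite rmorphM/= -!cabsE normrM. Qed.

Lemma cabsN z : cabs (- z) = cabs z. Proof. by rewrite /cabs normrN. Qed.

Lemma cabsC z w : cabs (z - w) = cabs (w - z).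
Proof. by rewrite -cabsN opprB. Qed.

Lemma cabsV z : cabs z^-1 = (cabs z)^-1.
Proof. by apply: (@complexI R); rewrite fmorphV/= -!cabsE normfV. Qed.

Lemma cabs_div z w : cabs (z / w) = cabs z / cabs w.
Proof. by rewrite cabsM cabsV. Qed.

Lemma cabs_real x : cabs x%:C = `|x|.
Proof. by rewrite cabs_sqrt/= expr0n addr0 sqrtr_sqr. Qed.

Lemma cabs_nat n : cabs n%:R = n%:R.
Proof. by rewrite -(rmorph_nat (real_complex R)) cabs_real normr_nat. Qed.

Lemma cabs0 : cabs 0 = 0. Proof. by rewrite (cabs_nat 0). Qed.
Lemma cabs1 : cabs 1 = 1. Proof. by rewrite (cabs_nat 1). Qed.

Lemma cabsi : cabs 'i%C = 1.
Proof. by rewrite cabs_sqrt/= expr0n add0r expr1n sqrtr1. Qed.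

Lemma cabsX z n : cabs (z ^+ n) = cabs z ^+ n.
Proof. by elim: n => [|n IH]; rewrite ?expr0 ?cabs1// !exprS cabsM IH. Qed.

Lemma cabs_eq0 z : (cabs z == 0) = (z == 0).
Proof. by rewrite -(inj_eq (@complexI R)) -cabsE/= normr_eq0. Qed.

Lemma cabs_gt0 z : (0 < cabs z) = (z != 0).
Proof. by rewrite lt_def cabs_eq0 cabs_ge0 andbT. Qed.

Lemma ler_cabsD z w : cabs (z + w) <= cabs z + cabs w.
Proof. by rewrite -lecR rmorphD/= -!cabsE ler_normD. Qed.

Lemma ler_cabsB z w : cabs (z - w) <= cabs z + cabs w.
Proof. by rewrite -(cabsN w) ler_cabsD. Qed.

Lemma ler_cabs_dist z w : cabs z - cabs w <= cabs (z - w).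
Proof. by rewrite lerBlDr -{1}(subrK w z) ler_cabsD. Qed.

Lemma ler_cabs_sum I (r : seq I) (P : pred I) (F : I -> R[i]) :
  cabs (\sum_(i <- r | P i) F i) <= \sum_(i <- r | P i) cabs (F i).
Proof.
elim/big_ind2 : _ => [|x y z w h1 h2|//]; first by rewrite cabs0.
by rewrite (le_trans (ler_cabsD _ _))// lerD.
Qed.

Lemma cabs_prod I (r : seq I) (P : pred I) (F : I -> R[i]) :
  cabs (\prod_(i <- r | P i) F i) = \prod_(i <- r | P i) cabs (F i).
Proof. by elim/big_rec2 : _ => [|i y x _ <-]; rewrite ?cabs1 ?cabsM. Qed.

Lemma ler_cabs_Re z : `|Re z| <= cabs z.
Proof. by rewrite -lecR -cabsE normc_ge_Re. Qed.

Lemma ler_cabs_Im z : `|Im z| <= cabs z.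
Proof.
by rewrite cabs_sqrt -sqrtr_sqr ler_sqrt ?lerDr ?sqr_ge0// addr_ge0// sqr_ge0.
Qed.

Lemma cabs_conj z : cabs z^* = cabs z.
Proof. by rewrite !cabs_sqrt; case: z => a b/=; rewrite sqrrN. Qed.

Lemma ler_cabs_ReIm z : cabs z <= `|Re z| + `|Im z|.
Proof.
case: z => a b /=; rewrite {1}(_ : a +i* b = a%:C + b%:C * 'i%C); last by simpc.
by rewrite (le_trans (ler_cabsD _ _))// cabsM cabsi mulr1 !cabs_real.
Qed.

Lemma cReD z w : Re (z + w) = Re z + Re w.
Proof. by case: z w => [? ?] []. Qed.
Lemma cImD z w : Im (z + w) = Im z + Im w.
Proof. by case: z w => [? ?] []. Qed.
Lemma cReN z : Re (- z) = - Re z.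
Proof. by case: z. Qed.
Lemma cImN z : Im (- z) = - Im z.
Proof. by case: z. Qed.
Lemma cReM z w : Re (z * w) =
  Re z * Re w - Im z * Im w.
Proof. by case: z w => [? ?] []. Qed.
Lemma cImM z w : Im (z * w) =
  Re z * Im w + Im z * Re w.
Proof. by case: z w => [? ?] []. Qed.
Lemma cRe_sum I (r : seq I) (P : pred I) (F : I -> R[i]) :
  Re (\sum_(i <- r | P i) F i) = \sum_(i <- r | P i) Re (F i).
Proof. by elim/big_rec2 : _ => // i y x _ <-; rewrite cReD. Qed.
Lemma cIm_sum I (r : seq I) (P : pred I) (F : I -> R[i]) :
  Im (\sum_(i <- r | P i) F i) = \sum_(i <- r | P i) Im (F i).
Proof. by elim/big_rec2 : _ => // i y x _ <-; rewrite cImD. Qed.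
Lemma cReMr x z : Re (x%:C * z) = x * Re z.
Proof. by rewrite cReM/= mul0r subr0. Qed.
Lemma cImMr x z : Im (x%:C * z) = x * Im z.
Proof. by rewrite cImM/= mul0r addr0. Qed.
Lemma cRe_conj z : Re z^* = Re z. Proof. by case: z. Qed.
Lemma cIm_conj z : Im z^* = - Im z. Proof. by case: z. Qed.
Lemma complex_ext z w : Re z = Re w ->
  Im z = Im w -> z = w.
Proof. by case: z w => [? ?] [? ?]/= -> ->. Qed.

End ComplexModulus.

Section ComplexLimits.
Context {R : realType}.

Lemma cabs_cvgP (T : Type) (F : set_system T) {FF : Filter F} (f : T -> R[i])
    (l : R[i]) :
  f @ F --> l <-> forall e, 0 < e -> \forall x \near F, cabs (l - f x) < e.
Proof.
split=> [/cvgrPdist_lt fl e e0|fl].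
  have /fl : 0 < e%:C by rewrite ltcR.
  by apply: filterS => x; rewrite cabsE ltcR.
apply/cvgrPdist_lt => -[e e']; rewrite ltcE/= => /andP[/eqP -> e0].
have := fl _ e0; apply: filterS => x.
by rewrite cabsE -[e +i* 0]/(e%:C) ltcR.
Qed.

Lemma nbhs_cabsP (z : R[i]) (P : set R[i]) :
  nbhs z P <-> exists2 d, 0 < d & forall w, cabs (w - z) < d -> P w.
Proof.
split=> [/nbhs_normP[[d d']]|[d d0 H]].
  rewrite /= ltcE/= => /andP[/eqP -> d0] H; exists d => // w wd; apply: H => /=.
  by rewrite cabsE -[d +i* 0]/(d%:C) ltcR cabsC.
apply/nbhs_normP; exists d%:C; first by rewrite /= ltcR.
by move=> w /=; rewrite cabsE ltcR cabsC; exact: H.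
Qed.

Lemma cvg_cabs_le (T : Type) (F : set_system T) {FF : Filter F} (f : T -> R[i])
    (l : R[i]) (g : T -> R) :
  (\forall x \near F, cabs (l - f x) <= g x) -> g @ F --> 0 -> f @ F --> l.
Proof.
move=> lg /cvgrPdist_lt g0; apply/cabs_cvgP => e /g0 ge.
near=> x; apply: le_lt_trans (_ : g x < e); first by near: x.
rewrite (le_lt_trans (ler_norm _))// -normrN -[_ (g x)]add0r.
by near: x; exact: ge.
Unshelve. all: by end_near. Qed.

Lemma cvg_Re (T : Type) (F : set_system T) {FF : Filter F} (f : T -> R[i])
    (l : R[i]) : f @ F --> l -> (fun x => Re (f x)) @ F --> Re l.
Proof.
move=> /cabs_cvgP fl; apply/cvgrPdist_lt => e /fl; apply: filterS => x.
by apply: le_lt_trans; rewrite -cReN -cReD ler_cabs_Re.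
Qed.

Lemma cvg_Im (T : Type) (F : set_system T) {FF : Filter F} (f : T -> R[i])
    (l : R[i]) : f @ F --> l -> (fun x => Im (f x)) @ F --> Im l.
Proof.
move=> /cabs_cvgP fl; apply/cvgrPdist_lt => e /fl; apply: filterS => x.
by apply: le_lt_trans; rewrite -cImN -cImD ler_cabs_Im.
Qed.

Lemma cvg_cabs (T : Type) (F : set_system T) {FF : Filter F} (f : T -> R[i])
    (l : R[i]) : f @ F --> l -> (fun x => cabs (f x)) @ F --> cabs l.
Proof.
move=> /cabs_cvgP fl; apply/cvgrPdist_lt => e /fl; apply: filterS => x.
apply: le_lt_trans; rewrite ler_norml ler_cabs_dist andbT.
by rewrite lerNl opprB cabsC ler_cabs_dist.
Qed.

Lemma cvg_ReIm (T : Type) (F : set_system T) {FF : Filter F} (f : T -> R[i])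
    (l : R[i]) : (fun x => Re (f x)) @ F --> Re l ->
  (fun x => Im (f x)) @ F --> Im l -> f @ F --> l.
Proof.
move=> /cvgrPdist_lt fr /cvgrPdist_lt fi; apply/cabs_cvgP => e e0.
near=> x; rewrite (le_lt_trans (ler_cabs_ReIm _))// [ltRHS]splitr ltrD//.
  by rewrite cReD cReN; near: x; apply: fr; rewrite divr_gt0.
by rewrite cImD cImN; near: x; apply: fi; rewrite divr_gt0.
Unshelve. all: by end_near. Qed.

Lemma cvg_real_complex (T : Type) (F : set_system T) {FF : Filter F}
  (f : T -> R) (l : R) : f @ F --> l -> (fun x => (f x)%:C) @ F --> l%:C.
Proof. by move=> fl; apply: cvg_ReIm => //=; exact: cvg_cst. Qed.

Lemma cvg_conj (T : Type) (F : set_system T) {FF : Filter F} (f : T -> R[i])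
    (l : R[i]) : f @ F --> l -> (fun x => (f x)^*) @ F --> l^*.
Proof.
move=> /cabs_cvgP fl; apply/cabs_cvgP => e /fl; apply: filterS => x.
by rewrite -rmorphB/= cabs_conj.
Qed.

End ComplexLimits.

(** * The complex exponential *)

Section ComplexExp.
Context {R : realType}.
Implicit Types (z w : R[i]) (x : R).

Lemma cexpD z w : cexp (z + w) = cexp z * cexp w.
Proof.
case: z w => [a b] [c d]; rewrite /cexp /= expRD cosD sinD; simpc.
by congr (_ +i* _); ring.
Qed.

Lemma cexp_real x : cexp x%:C = (expR x)%:C.
Proof. by rewrite /cexp/= cos0 sin0; simpc. Qed.

Lemma cexp0 : cexp 0 = 1 :> R[i]. Proof. by rewrite cexp_real expR0. Qed.

Lemma cexpN z : cexp (- z) = (cexp z)^-1.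
Proof.
have h : cexp z * cexp (- z) = 1 by rewrite -cexpD subrr cexp0.
have z0 : cexp z != 0 by apply: contra_eq_neq h => ->; rewrite mul0r eq_sym oner_neq0.
by rewrite -[LHS](mulKf z0) h mulr1.
Qed.

Lemma cabs_cexp z : cabs (cexp z) = expR (Re z).
Proof.
rewrite /cexp cabsM cabs_real ger0_norm ?expR_ge0//.
by rewrite cabs_sqrt/= cos2Dsin2 sqrtr1 mulr1.
Qed.

Lemma cexp_neq0 z : cexp z != 0.
Proof. by rewrite -cabs_gt0 cabs_cexp expR_gt0. Qed.

Lemma cexp_conj z : cexp z^* = (cexp z)^*.
Proof. by case: z => a b; rewrite /cexp /= sinN cosN; simpc. Qed.

Lemma cexpM_natl n z : cexp (n%:R * z) = cexp z ^+ n.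
Proof.
elim: n => [|n IH]; first by rewrite mul0r cexp0 expr0.
by rewrite -natr1 mulrDl mul1r cexpD IH exprSr.
Qed.

Lemma Re_cexp z : Re (cexp z) = expR (Re z) * cos (Im z).
Proof. by rewrite cReMr. Qed.

Lemma Im_cexp z : Im (cexp z) = expR (Re z) * sin (Im z).
Proof. by rewrite cImMr. Qed.

End ComplexExp.

Section ComplexLimitAlgebra.
Context {R : realType} {T : Type} {F : set_system T} {FF : Filter F}.
Implicit Types (f g : T -> R[i]) (a b : R[i]).

Lemma ccvg_cst a : (fun _ : T => a) @ F --> a.
Proof. exact: (@cvg_cst R[i]^o). Qed.

Lemma ccvgD f g a b : f @ F --> a -> g @ F --> b ->
  (fun x => f x + g x) @ F --> a + b.
Proof. exact: (@cvgD R[i] R[i]^o T F FF f g a b). Qed.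

Lemma ccvgN f a : f @ F --> a -> (fun x => - f x) @ F --> - a.
Proof. exact: (@cvgN R[i] R[i]^o T F FF f a). Qed.

Lemma ccvgB f g a b : f @ F --> a -> g @ F --> b ->
  (fun x => f x - g x) @ F --> a - b.
Proof. exact: (@cvgB R[i] R[i]^o T F FF f g a b). Qed.

Lemma ccvgM f g a b : f @ F --> a -> g @ F --> b ->
  (fun x => f x * g x) @ F --> a * b.
Proof. exact: (@cvgM R[i] T F FF f g a b). Qed.

Lemma ccvgV f a : a != 0 -> f @ F --> a -> (fun x => (f x)^-1) @ F --> a^-1.
Proof. by move=> a0; exact: (@cvgV R[i] T F FF f a a0). Qed.

Lemma ccvg_sum I (r : seq I) (P : pred I) (f : I -> T -> R[i]) (a : I -> R[i]) :
  (forall i, P i -> f i @ F --> a i) ->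
  (fun x => \sum_(i <- r | P i) f i x) @ F --> \sum_(i <- r | P i) a i.
Proof.
move=> fa; elim: r => [|i r IH].
  rewrite big_nil (_ : (fun=> _) = fun=> 0); first exact: ccvg_cst.
  by apply/funext => x; rewrite big_nil.
rewrite big_cons (_ : (fun=> _) = fun x => if P i then
    f i x + \sum_(j <- r | P j) f j x else \sum_(j <- r | P j) f j x); last first.
  by apply/funext => x; rewrite big_cons.
case: ifP => [Pi|_]; last exact: IH.
exact: (ccvgD (fa _ Pi) IH).
Qed.

Lemma ccvgX f a n : f @ F --> a -> (fun x => f x ^+ n) @ F --> a ^+ n.
Proof.
move=> fa; elim: n => [|n IH]; first by rewrite expr0; exact: ccvg_cst.
rewrite exprS (_ : (fun x => _) = fun x => f x * f x ^+ n); last first.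
  by apply/funext => x; rewrite exprS.
exact: (ccvgM fa IH).
Qed.

End ComplexLimitAlgebra.
Arguments ccvg_cst {R T F FF} a.

Lemma ccvg_unique {R : realType} {T : Type} {F : set_system T}
    {FF : ProperFilter F} (f : T -> R[i]) (a b : R[i]) :
  f @ F --> a -> f @ F --> b -> a = b.
Proof. exact: (@cvg_unique R[i]^o). Qed.

Lemma ccvg_lim {R : realType} {T : Type} {F : set_system T}
    {FF : ProperFilter F} (f : T -> R[i]) (a : R[i]) :
  f @ F --> a -> lim (f @ F) = a.
Proof. exact: (@cvg_lim R[i]^o). Qed.

(** * Complex derivatives as first-order estimates *)

Section DeriveEpsDelta.
Context {K : numFieldType}.

(** Multiplying the error of the difference quotient by |h| removes the division; both sides vanish
    at h = 0, so the punctured neighbourhood may be replaced by a full one. *)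
Lemma is_derive_epsP (f : K^o -> K^o) (x d : K) :
  is_derive (x : K^o) (1 : K^o) f d <->
  forall e : K, 0 < e -> \forall h \near (0 : K^o),
    `|f (x + h) - f x - d * h| <= e * `|h|.
Proof.
have key (e h : K) : h != 0 ->
  (`|f (x + h) - f x - d * h| <= e * `|h|) =
  (`|d - h^-1 *: (f (h *: (1 : K^o) + x) - f x)| <= e).
  move=> h0; rewrite -[RHS](ler_pM2r (_ : 0 < `|h|)) ?normr_gt0// -normrM.
  rewrite mulrBl -[in RHS]normrN opprB /GRing.scale/= mulr1 [h + x]addrC.
  by rewrite mulrAC mulVf// mul1r.
split=> [[df dE] e e0|H].
  have dcvg : h^-1 *: (f (h *: (1 : K^o) + x) - f x) @[h --> (0 : K^o)^']
      --> (d : K^o) by rewrite -dE; exact: df.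
  have /cvgrPdist_le/(_ e e0) := dcvg.
  rewrite near_withinE; apply: filterS => h.
  have [->|h0] := eqVneq h 0.
    by rewrite addr0 subrr mulr0 subrr normr0 mulr0.
  by move=> /(_ isT); rewrite key.
have : h^-1 *: (f (h *: (1 : K^o) + x) - f x) @[h --> (0 : K^o)^'] --> (d : K^o).
  apply/cvgrPdist_le => e e0; have := H e e0; rewrite near_withinE.
  by apply: filterS => h + h0; rewrite key.
by move=> H'; split; [apply: cvgP H'|apply: cvg_lim H'].
Qed.

End DeriveEpsDelta.

(* The library differentiates functions between normed modules, and C is one over
   itself only under the alias [R[i]^o]. *)
Notation cder f z d :=
  (is_derive (z : (_[i])^o) (1 : (_[i])^o) (f : (_[i])^o -> (_[i])^o) d).

Section ComplexDerivative.
Context {R : realType}.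
Implicit Types (z w : R[i]) (f g : R[i] -> R[i]).

Lemma cderP f z d : cder f z d <->
  forall e : R, 0 < e -> exists2 r : R, 0 < r & forall h, cabs h < r ->
    cabs (f (z + h) - f z - d * h) <= e * cabs h.
Proof.
rewrite is_derive_epsP; split=> [H e e0|H].
  have /H : 0 < e%:C by rewrite ltcR.
  move=> /nbhs_cabsP[r r0 rH]; exists r => // h hr.
  by have := rH h; rewrite subr0 => /(_ hr); rewrite !cabsE -rmorphM lecR.
move=> [e e']; rewrite ltcE/= => /andP[/eqP -> e0].
have [r r0 rH] := H e e0; apply/nbhs_cabsP; exists r => // h.
by rewrite subr0 => /rH; rewrite !cabsE -[e +i* 0]/(e%:C) -rmorphM lecR.
Qed.

Lemma rderP (f : R -> R) (x d : R) : is_derive x 1 f d <->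
  forall e : R, 0 < e -> exists2 r : R, 0 < r & forall h, `|h| < r ->
    `|f (x + h) - f x - d * h| <= e * `|h|.
Proof.
rewrite (is_derive_epsP (f : R^o -> R^o)); split=> [H e /H|H e /H[r r0 rH]].
  move=> /nbhs_normP[r r0 rH]; exists r => // h hr.
  by apply: rH; rewrite /= sub0r normrN.
by apply/nbhs_normP; exists r => // h /=; rewrite sub0r normrN; exact: rH.
Qed.

Lemma derive1_cder f z d : cder f z d -> derive1 f z = d.
Proof. by move=> H; rewrite derive1E; exact: derive_val. Qed.

Lemma cder_continuous f z d : cder f z d -> f w @[w --> z] --> f z.
Proof.
by move=> [+ _] => /derivable1_diffP /differentiable_continuous.
Qed.

Lemma cder_near f g z d : (\forall w \near z, f w = g w) -> cder g z d ->
  cder f z d.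
Proof.
move=> fg [dg <-].
have fg' : {near (z : R[i]^o), (g : R[i]^o -> R[i]^o) =1 (f : R[i]^o -> R[i]^o)}.
  by apply: filterS fg => w ->.
split; first exact: near_eq_derivable dg.
by apply/esym; apply: near_eq_derive.
Qed.

(** The passage from complex to real calculus: the mean value theorem and the fundamental theorem of
    calculus are applied to these two real functions. *)
Lemma cder_path f z w (t : R) (d : R[i]) : cder f (z + t%:C * w) d ->
  is_derive t 1 (fun u => Re (f (z + u%:C * w))) (Re (d * w)) /\
  is_derive t 1 (fun u => Im (f (z + u%:C * w))) (Im (d * w)).
Proof.
move=> /cderP H.
have key (e : R) : 0 < e -> exists2 r : R, 0 < r & forall h : R, `|h| < r ->
    cabs (f (z + (t + h)%:C * w) - f (z + t%:C * w) - d * w * h%:C) <= e * `|h|.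
  move=> e0; have c0 : 0 < cabs w + 1 by rewrite ltr_wpDl// cabs_ge0.
  have [r r0 rH] := H (e / (cabs w + 1)) (divr_gt0 e0 c0).
  exists (r / (cabs w + 1)); first exact: divr_gt0.
  move=> h hr; have := rH (h%:C * w); rewrite cabsM cabs_real.
  have hw : `|h| * cabs w <= `|h| * (cabs w + 1) by rewrite ler_wpM2l// lerDl.
  move=> /(_ (le_lt_trans hw _)); rewrite -ltr_pdivlMr// => /(_ hr).
  rewrite -(addrA z) -mulrDl -rmorphD/= (mulrC h%:C w) (mulrA d) => /le_trans; apply.
  rewrite mulrAC ler_pdivrMr// -mulrA ler_wpM2l ?(ltW e0)//.
split; apply/rderP => e /key[r r0 rH]; exists r => // h /rH; apply: le_trans.
  apply: le_trans (ler_cabs_Re _).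
  by rewrite !cReD !cReN (mulrC (d * w)) cReMr (mulrC h).
apply: le_trans (ler_cabs_Im _).
by rewrite !cImD !cImN (mulrC (d * w)) cImMr (mulrC h).
Qed.

(* The mean value theorem is applied to the real and to the imaginary part,
   whence the factor 2. *)
Lemma cder_mean_value f g z (r e : R) (L w1 w2 : R[i]) :
  (forall w, cabs (w - z) < r -> cder f w (g w)) ->
  (forall w, cabs (w - z) < r -> cabs (g w - L) <= e) ->
  cabs (w1 - z) < r -> cabs (w2 - z) < r ->
  cabs (f w2 - f w1 - L * (w2 - w1)) <= 2 * e * cabs (w2 - w1).
Proof.
move=> fg gL w1r w2r; set w := w2 - w1.
have inr (t : R) : 0 <= t <= 1 -> cabs (w1 + t%:C * w - z) < r.
  move=> /andP[t0 t1].
  have -> : w1 + t%:C * w - z = (1 - t)%:C * (w1 - z) + t%:C * (w2 - z).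
    by rewrite /w rmorphB rmorph1; ring.
  rewrite (le_lt_trans (ler_cabsD _ _))// !cabsM !cabs_real !ger0_norm ?subr_ge0//.
  have -> : r = (1 - t) * r + t * r by rewrite -mulrDl subrK mul1r.
  have [->|t0'] := eqVneq t 0; first by rewrite !mul0r subr0 !addr0 !mul1r.
  rewrite ler_ltD// ?ler_wpM2l ?subr_ge0// ?(ltW w1r)// ltr_pM2l//.
  by rewrite lt_def t0'.
have der (t : R) : 0 <= t <= 1 -> cder f (w1 + t%:C * w) (g (w1 + t%:C * w)).
  by move=> /inr /fg.
(* The linear part [L * w] is subtracted before the mean value theorem is applied, so that the
   derivative is the small quantity [(g - L) * w]. *)
have dRe (t : R) : 0 <= t <= 1 -> is_derive t 1
    (fun u => Re (f (w1 + u%:C * w)) - Re (L * w) * u)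
    (Re ((g (w1 + t%:C * w) - L) * w)).
  move=> /der/cder_path[H _]; rewrite mulrBl cReD cReN.
  by apply: is_derive_eq; rewrite /GRing.scale/= mulr1.
have dIm (t : R) : 0 <= t <= 1 -> is_derive t 1
    (fun u => Im (f (w1 + u%:C * w)) - Im (L * w) * u)
    (Im ((g (w1 + t%:C * w) - L) * w)).
  move=> /der/cder_path[_ H]; rewrite mulrBl cImD cImN.
  by apply: is_derive_eq; rewrite /GRing.scale/= mulr1.
have mvt (F dF : R -> R) : (forall t : R, 0 <= t <= 1 -> is_derive t 1 F (dF t)) ->
    exists2 c : R, 0 <= c <= 1 & F 1 - F 0 = dF c.
  move=> FD; have [||c c01] := @MVT_segment R F dF 0 1 ler01.
  - by move=> x; rewrite in_itv/= => /andP[/ltW x0 /ltW x1]; apply: FD; rewrite x0.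
  - apply: derivable_within_continuous => x; rewrite in_itv/= => /FD[]//.
  - by rewrite subr0 mulr1 => ->; exists c.
have bnd (c : R) : 0 <= c <= 1 -> cabs ((g (w1 + c%:C * w) - L) * w) <= e * cabs w.
  by move=> /inr /gL; rewrite cabsM => h; rewrite ler_wpM2r// cabs_ge0.
have w2E : w1 + 1%:C * w = w2 by rewrite /w rmorph1 mul1r addrC subrK.
have w1E : w1 + 0%:C * w = w1 by rewrite rmorph0 mul0r addr0.
rewrite (le_trans (ler_cabs_ReIm _))// -mulrA mulr_natl mulr2n lerD//.
  have [c c01] := mvt _ _ dRe; rewrite w1E w2E mulr1 mulr0 subr0 => E.
  by rewrite !cReD !cReN addrAC E (le_trans (ler_cabs_Re _))// bnd.
have [c c01] := mvt _ _ dIm; rewrite w1E w2E mulr1 mulr0 subr0 => E.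
by rewrite !cImD !cImN addrAC E (le_trans (ler_cabs_Im _))// bnd.
Qed.

End ComplexDerivative.

Section ComplexExpDerivative.
Context {R : realType}.
Implicit Types z w h : R[i].

(** With h = a + i b, the first-order errors of [expR], [cos] and [sin] at 0 and the cross term (e^a
    - 1) b account for the whole error. *)
Lemma cexp_expansion (e : R) : 0 < e -> exists2 r : R, 0 < r &
  forall h, cabs h < r -> cabs (cexp h - 1 - h) <= e * cabs h.
Proof.
move=> e0.
pose M : R := expR 1; have M1 : 1 <= M by rewrite -[leLHS]expR0 ler_expR.
(* Four error terms will each be at most [M * d * cabs h], where [M] bounds [expR a] for |a| <=
   1. *)
pose d := e / (4 * M).
have M0 : 0 < M by rewrite expR_gt0.
have d0 : 0 < d by rewrite divr_gt0// mulr_gt0.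
have [r1 r10 H1] := (rderP _ _ _).1 (is_derive_expR (0 : R)) _ d0.
have [r2 r20 H2] := (rderP _ _ _).1 (is_derive_cos (0 : R)) _ d0.
have [r3 r30 H3] := (rderP _ _ _).1 (is_derive_sin (0 : R)) _ d0.
(* The last radius serves the cross term: it makes [(1 + d) * |a|] at most [d]. *)
pose r := Num.min (Num.min r1 r2) (Num.min r3 (Num.min 1 (d / (1 + d)))).
exists r; first by rewrite !lt_min r10 r20 r30 ltr01 divr_gt0// addr_gt0.
move=> h; rewrite !lt_min => /andP[/andP[hr1 hr2] /andP[hr3 /andP[h1 hd]]].
set a := Re h; set b := Im h.
have ah : `|a| <= cabs h by exact: ler_cabs_Re.
have bh : `|b| <= cabs h by exact: ler_cabs_Im.
have := H1 a (le_lt_trans ah hr1); rewrite add0r expR0 mul1r => Ea.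
have := H2 b (le_lt_trans bh hr2).
rewrite add0r cos0 sin0 oppr0 mul0r subr0 => Cb.
have := H3 b (le_lt_trans bh hr3).
rewrite add0r cos0 sin0 mul1r subr0 => Sb.
have Ma : `|expR a| <= M.
  rewrite ger0_norm ?expR_ge0// ler_expR.
  by rewrite (le_trans (ler_norm _))// (le_trans ah)// ltW.
have E1 : `|expR a - 1| <= (1 + d) * `|a|.
  rewrite -[expR a - 1](subrK a) (le_trans (ler_normD _ _))// mulrDl mul1r.
  by rewrite addrC lerD2l.
have dM : d <= M * d by rewrite ler_peMl// ltW.
have h0 := cabs_ge0 h.
rewrite (le_trans (ler_cabs_ReIm _))// !cReD !cImD !cReN !cImN Re_cexp Im_cexp.
rewrite -/a -/b /= oppr0 addr0.
have -> : expR a * cos b - 1 - a = (expR a - 1 - a) + expR a * (cos b - 1).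
  by ring.
have -> : expR a * sin b - b = expR a * (sin b - b) + (expR a - 1) * b by ring.
have -> : e * cabs h = (M * d) * cabs h + (M * d) * cabs h +
    ((M * d) * cabs h + (M * d) * cabs h).
  by rewrite /d; field; rewrite gt_eqF.
have t (x y : R) : `|x| <= M -> `|y| <= d * `|b| -> `|x * y| <= M * d * cabs h.
  move=> hx hy; rewrite normrM -mulrA ler_pM// (le_trans hy)//.
  by rewrite ler_wpM2l// ltW.
apply: lerD; rewrite (le_trans (ler_normD _ _))// lerD//.
- by rewrite (le_trans Ea)// ler_pM// ltW.
- exact: t.
- exact: t.
rewrite normrM (le_trans (_ : _ <= ((1 + d) * `|a|) * cabs h))//.
  by rewrite ler_pM.
rewrite ler_wpM2r// (le_trans _ dM)// mulrC -ler_pdivlMr ?addr_gt0//.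
by rewrite (le_trans ah)// ltW.
Qed.

Lemma cder_cexp z : cder (@cexp R) z (cexp z).
Proof.
apply/cderP => e e0; have c0 : 0 < cabs (cexp z) by rewrite cabs_gt0 cexp_neq0.
have [r r0 H] := cexp_expansion (divr_gt0 e0 c0).
exists r => // h /H; rewrite -(ler_pM2l c0) -cabsM mulrA mulrCA mulfV ?gt_eqF//.
by rewrite mulr1 cexpD !mulrBr mulr1.
Qed.

Lemma cexp_continuous z : cexp w @[w --> z] --> cexp z.
Proof. exact: cder_continuous (cder_cexp z). Qed.

Lemma cexp_dist_le (r : R) z w : cabs z < r -> cabs w < r ->
  cabs (cexp w - cexp z) <= 2 * expR r * cabs (w - z).
Proof.
move=> zr wr; rewrite -[cexp w - _]subr0 -(mul0r (w - z)).
apply: (@cder_mean_value R (@cexp R) (@cexp R) 0 r).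
- by move=> u _; exact: cder_cexp.
- move=> u; rewrite !subr0 cabs_cexp ler_expR => /ltW; apply: le_trans.
  by rewrite (le_trans (ler_norm _))// ler_cabs_Re.
- by rewrite subr0.
- by rewrite subr0.
Qed.

End ComplexExpDerivative.

(** * Power series and the identity theorem *)

Section ComplexSeries.
Context {R : realType}.
Implicit Types (u : nat -> R[i]) (v : R^nat).

Lemma cabs_lim_le (T : Type) (F : set_system T) {FF : ProperFilter F}
    (f : T -> R[i]) (l : R[i]) (M : R) :
  f @ F --> l -> (\forall x \near F, cabs (f x) <= M) -> cabs l <= M.
Proof. by move=> /cvg_cabs fl; exact: cvgr_to_le fl. Qed.

Lemma abs_series_cvg u v : (forall n, cabs (u n) <= v n) ->
  cvgn (series v) -> cvgn (series u).
Proof.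
move=> uv cv.
have c0 (w : R^nat) : (forall n, `|w n| <= v n) -> cvgn (series w).
  move=> wv; apply: (@normed_cvg R R).
  apply: (series_le_cvg _ _ wv cv) => n; first exact: normr_ge0.
  exact: le_trans (normr_ge0 _) (wv n).
have /cvg_ex[a ha] := c0 (fun n => Re (u n))
  (fun n => le_trans (ler_cabs_Re _) (uv n)).
have /cvg_ex[b hb] := c0 (fun n => Im (u n))
  (fun n => le_trans (ler_cabs_Im _) (uv n)).
apply/cvg_ex; exists (a +i* b); apply: cvg_ReIm => /=.
  rewrite (_ : (fun x => _) = series (fun n => Re (u n)))//.
  by apply/funext => n; rewrite /series/= cRe_sum.
rewrite (_ : (fun x => _) = series (fun n => Im (u n)))//.
by apply/funext => n; rewrite /series/= cIm_sum.
Qed.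

Lemma series_tail_le u v l N : (forall n, cabs (u n) <= v n) ->
  cvgn (series v) -> series u @ \oo --> l ->
  cabs (l - series u N) <= limn (series v) - series v N.
Proof.
move=> uv cv ul.
have H : (fun M => series u M - series u N) @ \oo --> l - series u N.
  exact: (ccvgB ul (ccvg_cst _)).
apply: (cabs_lim_le H).
near=> M; have NM : (N <= M)%N by near: M; exact: nbhs_infty_ge.
rewrite sub_series_geq// (le_trans (ler_cabs_sum _ _ _))//.
rewrite (le_trans (ler_sum _ (fun i _ => uv i)))// -sub_series_geq//.
rewrite lerD2r; apply: nondecreasing_cvgn_le => //.
by apply: nondecreasing_series => n _ _; exact: le_trans (cabs_ge0 _) (uv n).
Unshelve. all: by end_near. Qed.

(** Dominated convergence for series: all tails are bounded by the tail of [series v], and the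
    finite sum that remains converges termwise. The filter is arbitrary because the limit is taken
    along sequences, at a complex point, and from the right at 0. *)
Lemma tannery (T : Type) (F : set_system T) {FF : ProperFilter F}
    (u : T -> nat -> R[i]) (U : T -> R[i]) (l : nat -> R[i]) v :
  (\forall x \near F, (forall n, cabs (u x n) <= v n) /\
                      series (u x) @ \oo --> U x) ->
  cvgn (series v) -> (forall n, u x n @[x --> F] --> l n) ->
  cvgn (series l) /\ U @ F --> limn (series l).
Proof.
move=> uU cv ul.
have lv n : cabs (l n) <= v n.
  by apply: cabs_lim_le (ul n) _; apply: filterS uU => x [].
have cl := abs_series_cvg lv cv; split=> //.
apply/cabs_cvgP => e e0.
have e3 : 0 < e / 3 by rewrite divr_gt0.
have /cvgrPdist_lt/(_ _ e3) := cv.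
move=> [N _ /(_ _ (leqnn N))/= tN].
have sl : series (u x) N @[x --> F] --> series l N.
  by rewrite /series/=; apply: ccvg_sum => i _; exact: ul.
have /cabs_cvgP/(_ _ e3) sl' := sl.
near=> x.
have [uv uxU] : (forall n, cabs (u x n) <= v n) /\ series (u x) @ \oo --> U x.
  by near: x.
have h1 := series_tail_le N lv cv cl.
have h2 := series_tail_le N uv cv uxU.
have h3 : cabs (series l N - series (u x) N) < e / 3 by near: x.
rewrite (_ : _ - _ = (limn (series l) - series l N)
  + (series l N - series (u x) N) - (U x - series (u x) N)); last by ring.
rewrite (le_lt_trans (ler_cabsB _ _))//.
rewrite (le_lt_trans (lerD (ler_cabsD _ _) h2))//.
have := le_lt_trans (ler_norm _) tN; lra.
Unshelve. all: by end_near. Qed.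

End ComplexSeries.

Section PowerSeries.
Context {R : realType}.
Implicit Types (a : nat -> R[i]) (w z l : R[i]).

Notation psum a w := (series (fun n => a n * w ^+ n)).

Lemma psum_coef_bound a w : cvgn (psum a w) ->
  exists2 C : R, 0 < C & forall n, cabs (a n) * cabs w ^+ n <= C.
Proof.
move=> cw; have /cvg_series_cvg_0 := cw.
move=> /cvg_cabs; rewrite cabs0 => c0.
have /cvg_seq_bounded : cvgn (fun n => cabs (a n * w ^+ n)).
  by apply/cvg_ex; exists 0.
move=> [M [_ /(_ (`|M| + 1))]]; rewrite (le_lt_trans (ler_norm _)) ?ltrDl// => /(_ isT) B.
exists (`|M| + 1); first by rewrite ltr_wpDl.
move=> n; have := B n I; rewrite /= cabsM cabsX.
by apply: le_trans; rewrite ler_norm.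
Qed.

(** For [q <= 1/2] one has q^n <= 2 q^n - 2 q^(n+1), and the right-hand sides telescope. *)
Lemma geometric_sum_le (q : R) N k : 0 <= q <= 2^-1 ->
  \sum_(N <= n < N + k) q ^+ n <= 2 * q ^+ N - 2 * q ^+ (N + k).
Proof.
move=> /andP[q0 q2]; elim: k => [|k IH].
  by rewrite addn0 big_geq// subrr.
rewrite addnS big_nat_recr ?leq_addr//= exprS.
have := exprn_ge0 (N + k) q0; set x := q ^+ (N + k) in IH *; nra.
Qed.

Lemma psum_tail a w l (rho C : R) N : 0 < rho ->
  (forall n, cabs (a n) * rho ^+ n <= C) -> cabs w <= rho / 2 ->
  psum a w @ \oo --> l ->
  cabs (l - psum a w N) <= 2 * C * (cabs w / rho) ^+ N.
Proof.
move=> rho0 aC wrho wl.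
have H : (fun M => psum a w M - psum a w N) @ \oo --> l - psum a w N.
  exact: (ccvgB wl (ccvg_cst _)).
apply: (cabs_lim_le H); near=> M.
have NM : (N <= M)%N by near: M; exact: nbhs_infty_ge.
have q0 : 0 <= cabs w / rho by rewrite divr_ge0 ?cabs_ge0// ltW.
have q2 : cabs w / rho <= 2^-1 by rewrite ler_pdivrMr// mulrC.
have C0 : 0 <= C by rewrite (le_trans _ (aC 0%N))// mulr_ge0 ?cabs_ge0// expr0.
rewrite sub_series_geq// (le_trans (ler_cabs_sum _ _ _))//.
rewrite (le_trans (_ : _ <= \sum_(N <= i < M) C * (cabs w / rho) ^+ i))//.
  apply: ler_sum => n _; rewrite cabsM cabsX expr_div_n mulrA.
  rewrite ler_pdivlMr ?exprn_gt0// mulrAC ler_wpM2r ?exprn_ge0 ?cabs_ge0//.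
rewrite -mulr_sumr (mulrC 2) -mulrA ler_wpM2l// -(subnKC NM).
rewrite (le_trans (geometric_sum_le _ _ _)) ?q0//.
by rewrite gerBl mulr_ge0// exprn_ge0.
Unshelve. all: by end_near. Qed.

(** Strong induction: once the lower coefficients vanish, the series is a_n w^n + O(|w|^(n+1)), so a
    zero [w] close to 0 forces |a_n| <= K |w|. *)
Lemma psum_coef_eq0 a (rho C : R) : 0 < rho ->
  (forall n, cabs (a n) * rho ^+ n <= C) ->
  (forall e : R, 0 < e -> exists w, [/\ w != 0, cabs w < e &
     psum a w @ \oo --> (0 : R[i])]) ->
  forall n, a n = 0.
Proof.
move=> rho0 aC H; apply: ltn_ind => n IH.
have C0 : 0 <= C by rewrite (le_trans _ (aC 0%N))// mulr_ge0 ?cabs_ge0// expr0.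
apply/eqP; rewrite -cabs_eq0 eq_le cabs_ge0 andbT.
apply/ler_addgt0Pl => e e0; rewrite addr0.
pose K := 2 * C / rho ^+ n.+1 + 1.
have K0 : 0 < K by rewrite ltr_wpDl// divr_ge0 ?mulr_ge0// exprn_ge0// ltW.
have [|w [w0 ew wl]] := H (Num.min (e / K) (rho / 2)).
  by rewrite lt_min !divr_gt0.
move: ew; rewrite lt_min => /andP[we wr].
have := psum_tail n.+1 rho0 aC (ltW wr) wl.
rewrite /series/= big_nat_recr//= big_nat big1 ?add0r; last first.
  by move=> i /andP[_ /IH ->]; rewrite mul0r.
rewrite cabsN cabsM cabsX expr_div_n (exprSr (cabs w)).
have w0' : 0 < cabs w ^+ n by rewrite exprn_gt0// cabs_gt0.
rewrite [leRHS](_ : _ = (2 * C / rho ^+ n.+1 * cabs w) * cabs w ^+ n); last by ring.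
rewrite ler_pM2r// => /le_trans; apply.
rewrite (le_trans (_ : _ <= K * cabs w)) ?ler_wpM2r ?cabs_ge0 ?lerDl//.
by rewrite mulrC -ler_pdivlMr// ltW.
Qed.

(** Restricting to a segment replaces the connectedness of a plane domain by the completeness of
    [R]. *)
Definition real_analytic_at (f : R -> R[i]) (t : R) : Prop :=
  exists a, \forall h \near (0 : R), psum a h%:C @ \oo --> f (t + h).

Lemma psum_vanish a : (forall n, a n = 0) -> forall w l, psum a w @ \oo --> l -> l = 0.
Proof.
move=> a0 w l /ccvg_unique; apply.
rewrite (_ : psum a w = fun=> 0); first exact: ccvg_cst.
by apply/funext => N; rewrite /series/= big1// => i _; rewrite a0 mul0r.
Qed.

Lemma real_analytic_zero f (t : R) : real_analytic_at f t ->
  (forall e : R, 0 < e -> exists h, [/\ h != 0, `|h| < e & f (t + h) = 0]) ->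
  exists2 e : R, 0 < e & forall h, `|h| < e -> f (t + h) = 0.
Proof.
move=> [a /nbhs_normP[d d0 fa]] H.
have {}fa h : `|h| < d -> psum a h%:C @ \oo --> f (t + h).
  by move=> hd; apply: fa; rewrite /= sub0r normrN.
have d2 : 0 < d / 2 by rewrite divr_gt0.
have ad2 : cvgn (psum a (d / 2)%:C).
  by apply/cvg_ex; eexists; apply: fa; rewrite gtr0_norm// ltr_pdivrMr// mulr_natr mulr2n ltrDl.
have [C C0] := psum_coef_bound ad2; rewrite cabs_real gtr0_norm// => aC.
exists d; [exact: d0|] => h hd; have := fa _ hd; apply: psum_vanish.
apply: (psum_coef_eq0 d2 aC) => e e0.
have [h' [h'0 h'e fh']] := H (Num.min e d) ltac:(by rewrite lt_min e0).
move: h'e; rewrite lt_min => /andP[he hd'].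
exists h'%:C; split; [|by rewrite cabs_real|].
  by apply: contra_neq h'0 => /complexI.
by rewrite -[X in _ --> X]fh'; exact: fa.
Qed.

(** Convergence at the single point z + d/2 bounds the terms there, which yields coefficient bounds
    of Cauchy type. *)
Lemma analytic_bounds f z : analytic_at f z -> exists a, exists C : R, exists2 rho : R,
  0 < rho & (forall n, cabs (a n) * rho ^+ n <= C) /\
  forall w, cabs (w - z) < rho -> psum a (w - z) @ \oo --> f w.
Proof.
move=> [a /nbhs_cabsP[d d0 fa]]; have d2 : 0 < d / 2 by rewrite divr_gt0.
have ltd : d / 2 < d by rewrite ltr_pdivrMr// mulr_natr mulr2n ltrDl.
have ad2 : cvgn (psum a (d / 2)%:C).
  apply/cvg_ex; exists (f (z + (d / 2)%:C)).
  have := fa (z + (d / 2)%:C); rewrite addrAC subrr add0r cabs_real gtr0_norm//.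
  exact.
have [C C0] := psum_coef_bound ad2; rewrite cabs_real gtr0_norm// => aC.
exists a, C, (d / 2); [exact: d2|split; [exact: aC|]] => w wd; apply: fa.
exact: lt_trans ltd.
Qed.

Lemma analytic_zero f z : analytic_at f z ->
  (forall e : R, 0 < e -> exists w, [/\ w != z, cabs (w - z) < e & f w = 0]) ->
  exists2 e : R, 0 < e & forall w, cabs (w - z) < e -> f w = 0.
Proof.
move=> /analytic_bounds[a [C [rho rho0 [aC fa]]]] H.
exists rho; [exact: rho0|] => w wd; have := fa _ wd; apply: psum_vanish.
apply: (psum_coef_eq0 rho0 aC) => e e0.
have [w' [w'0 w'e fw']] := H (Num.min e rho) ltac:(by rewrite lt_min e0).
move: w'e; rewrite lt_min => /andP[we wd'].
exists (w' - z); split; [by rewrite subr_eq0|by []|].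
by rewrite -[X in _ --> X]fw'; exact: fa.
Qed.

Lemma analytic_real_analytic f z d (t : R) : analytic_at f (z + t%:C * d) ->
  real_analytic_at (fun u => f (z + u%:C * d)) t.
Proof.
move=> /analytic_bounds[a [C [rho rho0 [_ fa]]]].
exists (fun n => a n * d ^+ n); apply/nbhs_normP.
exists (rho / (cabs d + 1)); first by rewrite /= divr_gt0// ltr_wpDl// cabs_ge0.
move=> h /=; rewrite sub0r normrN => hd.
have E : z + (t + h)%:C * d - (z + t%:C * d) = h%:C * d.
  by rewrite rmorphD/= mulrDl; ring.
have := fa (z + (t + h)%:C * d); rewrite E cabsM cabs_real.
have h1 : `|h| * cabs d < rho.
  rewrite (le_lt_trans (_ : _ <= `|h| * (cabs d + 1))) ?ler_wpM2l ?lerDl//.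
  by rewrite -ltr_pdivlMr// ltr_wpDl// cabs_ge0.
move=> /(_ h1); rewrite (_ : (fun n => _ * _ ^+ n) =
  (fun n => a n * d ^+ n * h%:C ^+ n))//.
by apply/funext => n; rewrite exprMn; ring.
Qed.

(** Let T be the supremum of the t such that f vanishes on [0, t[. Zeros accumulate at T from the
    left, so f vanishes around T; this contradicts the choice of T unless the neighbourhood reaches
    1. *)
Lemma real_analytic_identity f (d : R) : 0 < d ->
  (forall t, 0 <= t <= 1 -> real_analytic_at f t) ->
  (forall t, 0 <= t < d -> f t = 0) -> f 1 = 0.
Proof.
move=> d0 fa f0.
pose S := [set t : R | 0 <= t <= 1 /\ forall u, 0 <= u < t -> f u = 0].
have S0 : S 0.
  by split; [rewrite lexx ler01|move=> u /andP[u0 /(le_lt_trans u0)]; rewrite ltxx].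
have supS : has_sup S by split; [exists 0|exists 1 => t [/andP[]]].
pose T := sup S.
have T1 : T <= 1 by apply: ge_sup; [exists 0|move=> t [/andP[]]].
have dT : Num.min d 1 <= T.
  apply: ub_le_sup; first exact: supS.2.
  split; first by rewrite ge_min lexx orbT le_min ler01 ltW.
  by move=> u /andP[u0]; rewrite lt_min => /andP[ud _]; apply: f0; rewrite u0.
have T0 : 0 < T by rewrite (lt_le_trans _ dT)// lt_min d0 ltr01.
have fT u : 0 <= u < T -> f u = 0.
  move=> /andP[u0 uT]; have [s [_ sf] us] := sup_gt (ex_intro _ _ S0) uT.
  by apply: sf; rewrite u0.
have zT (e : R) : 0 < e -> exists h : R, [/\ h != 0, `|h| < e & f (T + h) = 0].
  move=> e0; exists (- (Num.min e T / 2)).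
  have m0 : 0 < Num.min e T by rewrite lt_min e0.
  have m2 : Num.min e T / 2 < Num.min e T.
    by rewrite ltr_pdivrMr// mulr_natr mulr2n ltrDl.
  split; first by rewrite oppr_eq0 gt_eqF// divr_gt0.
    by rewrite normrN gtr0_norm ?divr_gt0// (lt_le_trans m2)// ge_min lexx.
  apply: fT; rewrite subr_ge0 gtrBl divr_gt0// andbT (le_trans (ltW m2))//.
  by rewrite ge_min lexx orbT.
have [|e e0 fe] := real_analytic_zero _ zT; first by apply: fa; rewrite (ltW T0).
have [T1'|] := ltP (T + e / 2) 1; last first.
  move=> h; rewrite -(subrK T 1) addrC; apply: fe.
  rewrite ger0_norm ?subr_ge0// ltrBlDl (le_lt_trans h)// ltrD2l.
  by rewrite ltr_pdivrMr// mulr_natr mulr2n ltrDl.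
have /(ub_le_sup supS.2) : S (T + e / 2).
  split; first by rewrite (ltW T1') addr_ge0// ?divr_ge0// ltW.
  move=> u /andP[u0 uT]; have [uT'|Tu] := ltP u T; first by apply: fT; rewrite u0.
  rewrite -(subrK T u) addrC; apply: fe.
  rewrite ger0_norm ?subr_ge0// ltrBlDl (lt_trans uT)// ltrD2l.
  by rewrite ltr_pdivrMr// mulr_natr mulr2n ltrDl.
by rewrite -/T gerDl leNgt divr_gt0.
Qed.

End PowerSeries.

(** * Differentiation of limits and of power series *)

Section ComplexDerivativeRules.
Context {R : realType}.
Implicit Types (z w : R[i]) (f g : R[i] -> R[i]).

Lemma cder_eq f z d d' : cder f z d -> d = d' -> cder f z d'.
Proof. by move=> + <-. Qed.

Lemma cder_cst (c : R[i]) z : cder (fun _ => c) z 0.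
Proof. exact: (is_derive_cst (c : R[i]^o) (z : R[i]^o)). Qed.

Lemma cder_id z : cder (fun w => w) z 1.
Proof. exact: (is_derive_id (z : R[i]^o)). Qed.

Lemma cderD f g z df dg : cder f z df -> cder g z dg ->
  cder (fun w => f w + g w) z (df + dg).
Proof. by move=> ? ?; exact: is_deriveD. Qed.

Lemma cderM f g z df dg : cder f z df -> cder g z dg ->
  cder (fun w => f w * g w) z (f z * dg + g z * df).
Proof. by move=> ? ?; exact: is_deriveM. Qed.

Lemma cderZ (c : R[i]) f z df : cder f z df -> cder (fun w => c * f w) z (c * df).
Proof. by move=> fdf; apply: cder_eq (cderM (cder_cst c z) fdf) _; rewrite mulr0 addr0. Qed.

Lemma cderV f z df : f z != 0 -> cder f z df ->
  cder (fun w => (f w)^-1) z (- df / f z ^+ 2).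
Proof.
move=> f0 [Df dfE]; split; first exact: (derivableV f0 Df).
by rewrite (deriveV f0 Df) dfE /GRing.scale/= mulNr mulrC -mulNr.
Qed.

Lemma cderX f z df n : cder f z df ->
  cder (fun w => f w ^+ n) z (n%:R * f z ^+ n.-1 * df).
Proof.
move=> fdf; elim: n => [|n IH].
  rewrite mul0r mul0r (_ : (fun w => _) = fun=> 1); first exact: cder_cst.
  by apply/funext => w; rewrite expr0.
rewrite (_ : (fun w => _) = fun w => f w * f w ^+ n); last first.
  by apply/funext => w; rewrite exprS.
apply: cder_eq (cderM fdf IH) _; rewrite -natr1 /=.
case: n {IH} => [|n]; rewrite ?expr0 ?exprS/=; ring.
Qed.

Lemma cder_sum (I : Type) (r : seq I) (F dF : I -> R[i] -> R[i]) z :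
  (forall i, cder (F i) z (dF i z)) ->
  cder (fun w => \sum_(i <- r) F i w) z (\sum_(i <- r) dF i z).
Proof.
move=> FdF; elim: r => [|i r IH].
  rewrite big_nil (_ : (fun w => _) = fun=> 0); first exact: cder_cst.
  by apply/funext => w; rewrite big_nil.
rewrite big_cons (_ : (fun w => _) = fun w => F i w + \sum_(j <- r) F j w).
  exact: cderD.
by apply/funext => w; rewrite big_cons.
Qed.

Lemma cder_affine f (a b z d : R[i]) : cder f (a + b * z) d ->
  cder (fun w => f (a + b * w)) z (d * b).
Proof.
move=> /cderP H; apply/cderP => e e0.
have c0 : 0 < cabs b + 1 by rewrite ltr_wpDl// cabs_ge0.
have [r r0 rH] := H (e / (cabs b + 1)) (divr_gt0 e0 c0).
exists (r / (cabs b + 1)); first exact: divr_gt0.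
move=> h hr.
have hb : cabs (b * h) <= (cabs b + 1) * cabs h.
  by rewrite cabsM ler_wpM2r ?cabs_ge0// lerDl.
have /rH : cabs (b * h) < r.
  by rewrite (le_lt_trans hb)// mulrC -ltr_pdivlMr.
rewrite mulrDr addrA mulrA => /le_trans; apply.
rewrite (le_trans (ler_wpM2l _ hb)) ?divr_ge0 ?(ltW e0) ?(ltW c0)//.
by rewrite mulrA divfK// gt_eqF.
Qed.

(** Derivatives with a common Lipschitz constant make pointwise convergence sufficient: on the disc
    of radius 2|h| the mean value estimate has an error 4 K |h|^2, independent of n. It serves for
    power series and for Gauss's products. *)
Lemma cder_limit (f_ g_ : nat -> R[i] -> R[i]) f g z (r K : R) : 0 <= K ->
  (forall n w, cabs (w - z) < r -> cder (f_ n) w (g_ n w)) ->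
  (forall n w w', cabs (w - z) < r -> cabs (w' - z) < r ->
     cabs (g_ n w - g_ n w') <= K * cabs (w - w')) ->
  (forall w, cabs (w - z) < r -> f_ n w @[n --> \oo] --> f w) ->
  (forall w, cabs (w - z) < r -> g_ n w @[n --> \oo] --> g w) ->
  (forall w, cabs (w - z) < r -> cder f w (g w)) /\
  (forall w w', cabs (w - z) < r -> cabs (w' - z) < r ->
     cabs (g w - g w') <= K * cabs (w - w')).
Proof.
move=> K0 df Lg fl gl; split; last first.
  move=> w w' wr w'r.
  have H : (fun n => g_ n w - g_ n w') @ \oo --> g w - g w'.
    exact: (ccvgB (gl _ wr) (gl _ w'r)).
  by apply: (cabs_lim_le H); apply: nearW => n; exact: Lg.
move=> w wr; apply/cderP => e e0.
have d0 : 0 < r - cabs (w - z) by rewrite subr_gt0.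
have K1 : 0 < 4 * K + 1 by rewrite ltr_wpDl// mulr_ge0.
(* The first bound keeps the disc of radius 2|h| about [w] inside the domain; the second makes 4 K
   |h|^2 at most e |h|, the [+ 1] covering K = 0. *)
exists (Num.min ((r - cabs (w - z)) / 2) (e / (4 * K + 1))).
  by rewrite lt_min !divr_gt0.
move=> h; rewrite lt_min => /andP[h1 h2].
have [->|h0] := eqVneq h 0.
  by rewrite addr0 subrr mulr0 subrr cabs0 mulr0.
have hp : 0 < cabs h by rewrite cabs_gt0.
have inr u : cabs (u - w) < 2 * cabs h -> cabs (u - z) < r.
  move=> uw; rewrite -(subrK w u) -addrA (le_lt_trans (ler_cabsD _ _))//.
  rewrite -ltrBrDr (lt_trans uw)// -ltr_pdivlMl//.
  by rewrite mulrC.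
have whr : cabs (w + h - w) < 2 * cabs h.
  by rewrite addrAC subrr add0r ltr_pMl// ltr1n.
have wwr : cabs (w - w) < 2 * cabs h by rewrite subrr cabs0 mulr_gt0.
have H : (fun n => f_ n (w + h) - f_ n w - g_ n w * h) @ \oo -->
    f (w + h) - f w - g w * h.
  apply: ccvgB; first exact: (ccvgB (fl _ (inr _ whr)) (fl _ wr)).
  exact: (ccvgM (gl _ wr) (ccvg_cst h)).
apply: (cabs_lim_le H); apply: nearW => n.
have := @cder_mean_value R (f_ n) (g_ n) w (2 * cabs h) (K * (2 * cabs h))
  (g_ n w) w (w + h) _ _ wwr whr.
rewrite (_ : w + h - w = h) => [/(_ (fun u uw => df n u (inr _ uw)))|]; last by rewrite addrAC subrr add0r.
have Lu u : cabs (u - w) < 2 * cabs h -> cabs (g_ n u - g_ n w) <= K * (2 * cabs h).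
  move=> uw; rewrite (le_trans (Lg _ _ _ (inr _ uw) wr))//.
  by rewrite ler_wpM2l// ltW.
move=> /(_ Lu) /le_trans; apply; rewrite ler_wpM2r ?(ltW hp)//.
rewrite (_ : 2 * (K * (2 * cabs h)) = (4 * K) * cabs h); last by ring.
rewrite (le_trans (_ : _ <= (4 * K + 1) * cabs h)) ?ler_wpM2r ?(ltW hp) ?lerDl//.
by rewrite mulrC -ler_pdivlMr// ltW.
Qed.

Lemma cabs_subX_le (u v : R[i]) (r : R) n : cabs u <= r -> cabs v <= r ->
  cabs (u ^+ n - v ^+ n) <= n%:R * r ^+ n.-1 * cabs (u - v).
Proof.
move=> ur vr; have r0 : 0 <= r by rewrite (le_trans (cabs_ge0 u)).
elim: n => [|n IH]; first by rewrite !expr0 subrr cabs0 !mul0r.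
rewrite !exprS (_ : _ - _ = u * (u ^+ n - v ^+ n) + (u - v) * v ^+ n); last by ring.
rewrite (le_trans (ler_cabsD _ _))// !cabsM cabsX /=.
rewrite (le_trans (_ : _ <= r * (n%:R * r ^+ n.-1 * cabs (u - v)) +
   cabs (u - v) * r ^+ n))//.
  apply: lerD; first by rewrite ler_pM ?cabs_ge0.
  by rewrite ler_wpM2l ?cabs_ge0// lerXn2r// nnegrE cabs_ge0.
rewrite le_eqVlt; apply/orP; left; apply/eqP; rewrite -natr1.
by case: n {IH} => [|n]; rewrite ?expr0 ?exprS/=; ring.
Qed.

Lemma sqr_le_exp2 k : (k ^ 2 <= 4 * 2 ^ k)%N.
Proof.
elim: k => // k IH; have := ltn_expl k (isT : (1 < 2)%N).
by rewrite (expnS 2) -[k.+1]addn1 sqrnD muln1 exp1n; lia.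
Qed.

(** Termwise differentiation. The Lipschitz bound on the derivative feeds [cder_limit] and is kept
    in the conclusion because it later gives the continuity of zeta'. *)
Lemma analytic_cder f z : analytic_at f z -> exists g, exists2 r : R, 0 < r &
  exists2 K : R, 0 <= K &
  (forall w, cabs (w - z) < r -> cder f w (g w)) /\
  (forall w w', cabs (w - z) < r -> cabs (w' - z) < r ->
     cabs (g w - g w') <= K * cabs (w - w')).
Proof.
move=> /analytic_bounds[a [C [rho rho0 [aC fa]]]].
have C0 : 0 <= C by rewrite (le_trans _ (aC 0%N))// mulr_ge0 ?cabs_ge0// expr0.
(* A quarter of the radius leaves 4^k in the denominator: one factor 2^k absorbs the k^2 of two
   differentiations, the other leaves a geometric series. *)
pose r := rho / 4; have r0 : 0 < r by rewrite divr_gt0.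
have aC' k : cabs (a k) * r ^+ k <= C / 4 ^+ k.
  by rewrite /r expr_div_n mulrA ler_pM2r ?invr_gt0 ?exprn_gt0.
pose f_ n w := series (fun k => a k * (w - z) ^+ k) n.
pose t k w := a k * (k%:R * (w - z) ^+ k.-1 * 1).
pose g_ n w := series (fun k => t k w) n.
have four2 k : (4 ^+ k : R) = 2 ^+ k * 2 ^+ k.
  by rewrite -exprMn -natrM.
have geo (c : R) : cvgn (series (fun k => c * 2^-1 ^+ k)).
  apply: is_cvg_geometric_series; rewrite ger0_norm// invf_lt1//.
  by rewrite ltr1n.
have kb' k : (k%:R ^+ 2 / 4 ^+ k : R) <= 4 * 2^-1 ^+ k.
  rewrite four2 invfM mulrA exprVn ler_pM2r ?invr_gt0 ?exprn_gt0//.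
  rewrite ler_pdivrMr ?exprn_gt0// -!natrX -natrM ler_nat.
  exact: sqr_le_exp2.
have kb k : (k%:R / 4 ^+ k : R) <= 4 * 2^-1 ^+ k.
  rewrite (le_trans _ (kb' k))// ler_wpM2r ?invr_ge0 ?exprn_ge0//.
  by rewrite -natrX ler_nat; case: k => // k; exact: leq_pmulr.
have tb k w : cabs (w - z) < r -> cabs (t k w) <= (4 * C / r) * 2^-1 ^+ k.
  move=> /ltW wr; case: k => [|k].
    rewrite /t mul0r mul0r mulr0 cabs0 expr0 mulr1 divr_ge0 ?mulr_ge0//.
    exact: ltW.
  rewrite /t mulr1 !cabsM cabs_nat cabsX/=.
  have h1 : cabs (a k.+1) * (k.+1%:R * cabs (w - z) ^+ k) <=
      (cabs (a k.+1) * r ^+ k.+1) * k.+1%:R / r.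
    rewrite ler_pdivlMr// exprS.
    rewrite (_ : _ * r = (cabs (a k.+1) * k.+1%:R * r) * cabs (w - z) ^+ k); last by ring.
    rewrite [leRHS](_ : _ = (cabs (a k.+1) * k.+1%:R * r) * r ^+ k); last by ring.
    apply: ler_wpM2l; first by rewrite !mulr_ge0 ?cabs_ge0// ltW.
    by rewrite lerXn2r// nnegrE ?cabs_ge0// ltW.
  rewrite (le_trans h1)// [leRHS]mulrAC ler_pM2r ?invr_gt0//.
  rewrite (le_trans (ler_wpM2r _ (aC' _)))// -mulrA (mulrC 4) -mulrA ler_wpM2l//.
  by rewrite mulrC; exact: kb.
have G0 k : 0 <= 4 * C / r ^+ 2 * 2^-1 ^+ k.
  apply: mulr_ge0; last by rewrite exprn_ge0.
  by apply: divr_ge0; [exact: mulr_ge0|exact: sqr_ge0].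
have Lb k w w' : cabs (w - z) < r -> cabs (w' - z) < r ->
    cabs (t k w - t k w') <= (4 * C / r ^+ 2) * 2^-1 ^+ k * cabs (w - w').
  move=> /ltW wr /ltW w'r; rewrite (_ : t k w - t k w' =
    a k * k%:R * ((w - z) ^+ k.-1 - (w' - z) ^+ k.-1)); last by rewrite /t; ring.
  rewrite !cabsM cabs_nat.
  have := cabs_subX_le k.-1 wr w'r; rewrite opprB addrA subrK => h1.
  rewrite (le_trans (ler_wpM2l _ h1)) ?mulr_ge0 ?cabs_ge0// mulrA.
  rewrite ler_wpM2r ?cabs_ge0//.
  case: k {h1} => [|[|k]].
  - by rewrite mulr0 mul0r.
  - by rewrite /= mul0r mulr0.
  rewrite /=.
  rewrite [leLHS](_ : _ = (cabs (a k.+2) * r ^+ k.+2) * (k.+2%:R * k.+1%:R) / r ^+ 2);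
    last by rewrite !exprS expr0; field; rewrite gt_eqF.
  rewrite [leRHS]mulrAC ler_pM2r ?invr_gt0 ?exprn_gt0//.
  rewrite (le_trans (ler_wpM2r _ (aC' _))) ?mulr_ge0// -mulrA (mulrC 4) -mulrA.
  rewrite ler_wpM2l// (le_trans _ (kb' _))// mulrC ler_wpM2r ?invr_ge0 ?exprn_ge0//.
  by rewrite expr2 ler_wpM2l// ler_nat.
pose G w := limn (series (fun k => t k w)).
pose K := limn (series (fun k => (4 * C / r ^+ 2) * 2^-1 ^+ k)).
have K0 : 0 <= K.
  by apply: limr_ge; [exact: geo|apply: nearW => n; rewrite sumr_ge0].
exists G, r; [exact: r0|exists K; [exact: K0|]].
apply: (@cder_limit f_ g_ f G z r K K0).
- move=> n w wr; apply: cder_sum => k; apply: cderZ; apply: cderX.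
  by apply: cder_eq (cderD (cder_id w) (cder_cst (- z) w)) _; rewrite addr0.
- move=> n w w' wr w'r; rewrite /g_ /series/= -sumrB.
  rewrite (le_trans (ler_cabs_sum _ _ _))//.
  rewrite (le_trans (ler_sum _ (fun k _ => Lb k _ _ wr w'r)))// -mulr_suml.
  rewrite ler_wpM2r ?cabs_ge0//.
  apply: (nondecreasing_cvgn_le _ (geo _) n).
  by apply: nondecreasing_series => k _ _; exact: G0.
- move=> w wr; apply: fa; rewrite (lt_trans wr)// /r ltr_pdivrMr//.
  by rewrite ltr_pMr// ltr1n.
- by move=> w wr; exact: (abs_series_cvg (fun k => tb k w wr) (geo _)).
Qed.

End ComplexDerivativeRules.

(** * Integrals over the line *)

Section RealIntegral.
Context {R : realType}.
Notation mu := (@lebesgue_measure R).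
Implicit Types f g : R -> R.

Definition rintegrable f := mu.-integrable [set: R] (EFin \o f).
Definition rint f : R := (\int[mu]_x f x)%R.

Lemma rintegrable_measurable f : rintegrable f -> measurable_fun [set: R] f.
Proof. by move=> /integrableP[/measurable_EFinP]. Qed.

Lemma rintegrable_le f g : measurable_fun [set: R] f ->
  (forall x, `|f x| <= g x) -> rintegrable g -> rintegrable f.
Proof.
move=> mf fg; apply: le_integrable => //; first exact/measurable_EFinP.
by move=> x _; rewrite /= lee_fin (le_trans (fg x))// ler_norm.
Qed.

Lemma rintegrableD f g : rintegrable f -> rintegrable g ->
  rintegrable (fun x => f x + g x).
Proof.
move=> If Ig; have := integrableD measurableT If Ig.
by apply: eq_integrable.
Qed.

Lemma rintegrableZ (k : R) f : rintegrable f -> rintegrable (fun x => k * f x).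
Proof.
by move=> If; have := integrableZl measurableT k If; apply: eq_integrable.
Qed.

Lemma rintD f g : rintegrable f -> rintegrable g ->
  rint (fun x => f x + g x) = rint f + rint g.
Proof. by move=> If Ig; exact: RintegralD. Qed.

Lemma rintZ (k : R) f : rintegrable f -> rint (fun x => k * f x) = k * rint f.
Proof. by move=> If; exact: RintegralZl. Qed.

Lemma rint_dominated (f_ : nat -> R -> R) f g :
  (forall n, measurable_fun [set: R] (f_ n)) ->
  (forall n x, `|f_ n x| <= g x) -> rintegrable g ->
  (forall x, f_ n x @[n --> \oo] --> f x) ->
  rintegrable f /\ rint (f_ n) @[n --> \oo] --> rint f.
Proof.
move=> mf_ fg Ig ff.
have mf : measurable_fun [set: R] f by apply: measurable_fun_cvg (fun x _ => ff x).
have [] := @dominated_convergence _ _ _ mu setT measurableT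
  (fun n => EFin \o f_ n) (EFin \o f) (EFin \o g).
- by move=> n; apply/measurable_EFinP; exact: mf_.
- by apply/measurable_EFinP; exact: mf.
- by apply: aeW => x _; apply: cvg_EFin; [exact: nearW|exact: ff].
- exact: Ig.
- by apply: aeW => x n _; rewrite /= lee_fin.
move=> If _ cf; split => //; apply: fine_cvg.
by rewrite /rint /Rintegral fineK//; exact: integrable_fin_num.
Qed.

(** Change of variables for a measure-preserving map; it is applied to translations and to the
    reflection. *)
Lemma rint_pushforward (phi : R -> R) : measurable_fun [set: R] phi ->
  (forall A : set R, measurable A -> pushforward mu (phi : _ -> measurableTypeR R) A = mu A) ->
  forall f, measurable_fun [set: R] f -> rintegrable (f \o phi) ->
  rint (f \o phi) = rint f /\ rintegrable f.
Proof.
move=> mphi Hphi f mf If.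
have mf' : measurable_fun [set: measurableTypeR R] (EFin \o f).
  by apply/measurable_EFinP; exact: mf.
have mphi' : measurable_fun [set: measurableTypeR R]
  (phi : measurableTypeR R -> measurableTypeR R) by exact: mphi.
split.
  rewrite /rint /Rintegral; congr fine.
  have := @integral_pushforward _ _ (measurableTypeR R) (measurableTypeR R) R phi mphi' mu setT (EFin \o f) mf' If measurableT.
  rewrite preimage_setT => <-.
  by apply: eq_measure_integral => A mA _; exact: Hphi.
have /integrableP[_ H] := @integrable_pushforward _ _ (measurableTypeR R) (measurableTypeR R) R phi mphi' mu setT (EFin \o f) mf' If measurableT.
apply/integrableP; split => //; apply: le_lt_trans H.
rewrite le_eqVlt; apply/orP; left; apply/eqP.
by apply: eq_measure_integral => A mA _; exact/esym/Hphi.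
Qed.

Lemma rint_shift (c : R) f : rintegrable f ->
  rint (fun x => f (x + c)) = rint f /\ rintegrable (fun x => f (x + c)).
Proof.
have mD (d : R) : measurable_fun [set: R] (fun x : R => x + d).
  by apply: measurable_funD => //; exact: measurable_cst.
have shiftE (d : R) (A : set R) : measurable A ->
    pushforward mu ((fun x => x + d) : _ -> measurableTypeR R) A = mu A.
  (* The translated measure agrees with Lebesgue measure on the intervals ]a, b], which determine
     it. *)
  move=> mA; apply/esym/lebesgue_measure_unique  => //=.
    exact: (mD d).
  move=> _ _ [[a b]] _ <-.
  rewrite /pushforward (_ : _ @^-1` _ = `]a - d, b - d]%classic); last first.
    by apply/seteqP; split => x /=; rewrite !in_itv/= ltrBlDr lerBrDr.
  rewrite !lebesgue_measure_itv/= !lte_fin ltrD2r.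
  by case: ifP => // _; rewrite -!EFinB; congr EFin; ring.
move=> If; have mf := rintegrable_measurable If.
(* The inverse translation is used, because the integrability at hand must be that of the composite,
   here [f] itself. *)
have := @rint_pushforward (fun x => x - c) (mD (- c)) (shiftE (- c))
  (fun x => f (x + c)) (measurableT_comp mf (mD c)).
have -> : (fun x => f (x + c)) \o (fun x => x - c) = f.
  by apply/funext => x /=; rewrite subrK.
by move=> /(_ If)[<-].
Qed.

Lemma rint_opp f : rintegrable f ->
  rint (fun x => f (- x)) = rint f /\ rintegrable (fun x => f (- x)).
Proof.
move=> If; have mf := rintegrable_measurable If.
have mN : measurable_fun [set: R] (fun x : R => - x) by exact: measurable_funN.
have := @rint_pushforward (fun x => - x) mN (@lebesgue_measureN R)
  (fun x => f (- x)) (measurableT_comp mf mN).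
have -> : (fun x => f (- x)) \o (fun x => - x) = f.
  by apply/funext => x /=; rewrite opprK.
by move=> /(_ If)[<-].
Qed.

(** Up to the factor c^-1, the density of the exponential law plus its mirror image is an integrable
    upper bound. *)
Lemma rintegrable_expR_norm (c : R) : 0 < c ->
  rintegrable (fun x => expR (- c * `|x|)).
Proof.
move=> c0; have Ip : rintegrable (exponential_pdf c).
  exact: integrable_exponential_pdf.
have [_ Im] := rint_opp Ip.
apply: rintegrable_le (rintegrableZ c^-1 (rintegrableD Ip Im)).
  apply: continuous_measurable_fun => x; apply: continuous_comp.
    apply: cvgM; first exact: cvg_cst.
    exact: norm_continuous.
  exact: continuous_expR.
have ci : 0 <= c^-1 by rewrite invr_ge0 ltW.
move=> x; rewrite ger0_norm ?expR_ge0// mulrDr.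
have [x0|x0] := leP 0 x.
  rewrite [in leRHS]exponential_pdfE//= mulKf ?gt_eqF// ger0_norm// lerDl.
  by rewrite mulr_ge0// exponential_pdf_ge0// ltW.
rewrite [X in _ + _ * X]exponential_pdfE/=; last by rewrite oppr_ge0 ltW.
rewrite mulKf ?gt_eqF// ltr0_norm// lerDr.
by rewrite mulr_ge0// exponential_pdf_ge0// ltW.
Qed.

End RealIntegral.

(** * Integrals of complex-valued functions *)

Section ComplexIntegral.
Context {R : realType}.
Implicit Types f g : R -> R[i].

Definition cmeasurable f := measurable_fun [set: R] (fun x => Re (f x)) /\
  measurable_fun [set: R] (fun x => Im (f x)).
Definition cintegrable f := rintegrable (fun x => Re (f x)) /\
  rintegrable (fun x => Im (f x)).
Definition cint f : R[i] := rint (fun x => Re (f x)) +i*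
  rint (fun x => Im (f x)).

Lemma cintegrable_le f (g : R -> R) : cmeasurable f ->
  (forall x, cabs (f x) <= g x) -> rintegrable g -> cintegrable f.
Proof.
move=> [mr mi] fg Ig; split; apply: rintegrable_le Ig => // x.
  exact: le_trans (ler_cabs_Re _) (fg x).
exact: le_trans (ler_cabs_Im _) (fg x).
Qed.

Lemma cintegrable_measurable f : cintegrable f -> cmeasurable f.
Proof. by move=> [/rintegrable_measurable ? /rintegrable_measurable]. Qed.

Lemma cintegrableD f g : cintegrable f -> cintegrable g ->
  cintegrable (fun x => f x + g x).
Proof.
move=> [fr fi] [gr gi]; split.
  by have := rintegrableD fr gr; congr rintegrable; apply/funext => x; rewrite cReD.
by have := rintegrableD fi gi; congr rintegrable; apply/funext => x; rewrite cImD.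
Qed.

Lemma cintD f g : cintegrable f -> cintegrable g ->
  cint (fun x => f x + g x) = cint f + cint g.
Proof.
move=> [fr fi] [gr gi]; apply: complex_ext; rewrite ?cReD ?cImD /=.
  by rewrite -rintD//; congr rint; apply/funext => x; rewrite cReD.
by rewrite -rintD//; congr rint; apply/funext => x; rewrite cImD.
Qed.

Lemma cintegrableZ (k : R[i]) f : cintegrable f -> cintegrable (fun x => k * f x).
Proof.
move=> [fr fi]; split.
  have := rintegrableD (rintegrableZ (Re k) fr) (rintegrableZ (- Im k) fi).
  by congr rintegrable; apply/funext => x; rewrite cReM mulNr.
have := rintegrableD (rintegrableZ (Re k) fi) (rintegrableZ (Im k) fr).
by congr rintegrable; apply/funext => x; rewrite cImM.
Qed.

Lemma cintZ (k : R[i]) f : cintegrable f -> cint (fun x => k * f x) = k * cint f.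
Proof.
move=> [fr fi]; apply: complex_ext; rewrite ?cReM ?cImM /=.
  rewrite -mulNr -!rintZ// -rintD; [|exact: rintegrableZ..].
  by congr rint; apply/funext => x; rewrite cReM mulNr.
rewrite -!rintZ// -rintD; [|exact: rintegrableZ..].
by congr rint; apply/funext => x; rewrite cImM.
Qed.

Lemma cint0 : cintegrable (fun _ => 0) /\ cint (fun _ => 0) = 0.
Proof.
have I0 : cintegrable (fun _ => 0 : R[i]).
  by split; rewrite /rintegrable; have := @integrable0 _ _ R (@lebesgue_measure R) setT.
split => //; rewrite -[RHS](mul0r (cint (fun=> 0 : R[i]))) -cintZ//.
by congr cint; apply/funext => x; rewrite mul0r.
Qed.

Lemma cint_sum I (r : seq I) (F : I -> R -> R[i]) :
  (forall i, cintegrable (F i)) ->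
  cintegrable (fun x => \sum_(i <- r) F i x) /\
  cint (fun x => \sum_(i <- r) F i x) = \sum_(i <- r) cint (F i).
Proof.
move=> IF; elim: r => [|i r [IH1 IH2]].
  rewrite big_nil (_ : (fun x => _) = fun _ => 0); first exact: cint0.
  by apply/funext => x; rewrite big_nil.
rewrite big_cons (_ : (fun x => _) = fun x => F i x + \sum_(j <- r) F j x); last first.
  by apply/funext => x; rewrite big_cons.
by split; [exact: cintegrableD|rewrite cintD// IH2].
Qed.

Lemma cint_dominated (f_ : nat -> R -> R[i]) f (g : R -> R) :
  (forall n, cmeasurable (f_ n)) ->
  (forall n x, cabs (f_ n x) <= g x) -> rintegrable g ->
  (forall x, f_ n x @[n --> \oo] --> f x) ->
  cintegrable f /\ cint (f_ n) @[n --> \oo] --> cint f.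
Proof.
move=> mf fg Ig ff.
have [|||Ir cr] := @rint_dominated R (fun n x => Re (f_ n x))
  (fun x => Re (f x)) g _ _ Ig.
- by move=> n; exact: (mf n).1.
- by move=> n x; exact: le_trans (ler_cabs_Re _) (fg n x).
- by move=> x; exact: cvg_Re (ff x).
have [|||Ii ci] := @rint_dominated R (fun n x => Im (f_ n x))
  (fun x => Im (f x)) g _ _ Ig.
- by move=> n; exact: (mf n).2.
- by move=> n x; exact: le_trans (ler_cabs_Im _) (fg n x).
- by move=> x; exact: cvg_Im (ff x).
by split; [split|exact: cvg_ReIm].
Qed.

Lemma cint_shift (c : R) f : cintegrable f ->
  cint (fun x => f (x + c)) = cint f /\ cintegrable (fun x => f (x + c)).
Proof.
move=> [/(rint_shift c)[er ir] /(rint_shift c)[ei ii]].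
by split; [rewrite /cint er ei|split].
Qed.

Lemma cint_opp f : cintegrable f ->
  cint (fun x => f (- x)) = cint f /\ cintegrable (fun x => f (- x)).
Proof.
move=> [/rint_opp[er ir] /rint_opp[ei ii]].
by split; [rewrite /cint er ei|split].
Qed.

Lemma cint_conj f : cintegrable f -> cint (fun x => (f x)^*) = (cint f)^*.
Proof.
move=> [fr fi]; apply: complex_ext; rewrite ?cRe_conj ?cIm_conj/=.
  by congr rint; apply/funext => x; rewrite cRe_conj.
rewrite -mulN1r -rintZ//; congr rint; apply/funext => x.
by rewrite cIm_conj mulN1r.
Qed.

Lemma cmeasurable_continuous f : (forall x, f y @[y --> x] --> f x) -> cmeasurable f.
Proof.
move=> cf; split; apply: continuous_measurable_fun => x.
  exact: cvg_Re (cf x).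
exact: cvg_Im (cf x).
Qed.

Lemma cmeasurable_if (b : R -> bool) f g : measurable_fun [set: R] b ->
  cmeasurable f -> cmeasurable g -> cmeasurable (fun x => if b x then f x else g x).
Proof.
move=> mb [fr fi] [gr gi]; split.
  rewrite (_ : (fun x => _) = fun x => if b x then Re (f x) else Re (g x)).
    exact: measurable_fun_ifT.
  by apply/funext => x; case: ifP.
rewrite (_ : (fun x => _) = fun x => if b x then Im (f x) else Im (g x)).
  exact: measurable_fun_ifT.
by apply/funext => x; case: ifP.
Qed.

Lemma cmeasurable_cst (c : R[i]) : cmeasurable (fun _ => c).
Proof. by split; exact: measurable_cst. Qed.

Lemma cmeasurableM f g : cmeasurable f -> cmeasurable g ->
  cmeasurable (fun x => f x * g x).
Proof.
move=> [fr fi] [gr gi]; split.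
  rewrite (_ : (fun x => _) = fun x => Re (f x) * Re (g x) -
    Im (f x) * Im (g x)); last by apply/funext => x; rewrite cReM.
  by apply: measurable_funB; exact: measurable_funM.
rewrite (_ : (fun x => _) = fun x => Re (f x) * Im (g x) +
  Im (f x) * Re (g x)); last by apply/funext => x; rewrite cImM.
by apply: measurable_funD; exact: measurable_funM.
Qed.

Lemma cmeasurable_real (h : R -> R) : measurable_fun [set: R] h ->
  cmeasurable (fun x => (h x)%:C).
Proof. by move=> mh; split => //; exact: measurable_cst. Qed.

Lemma ccvg_cexp (T : Type) (F : set_system T) {FF : Filter F} (f : T -> R[i])
    (a : R[i]) : f @ F --> a -> (fun x => cexp (f x)) @ F --> cexp a.
Proof. by move=> fa; apply: (cvg_comp f (@cexp R) fa); exact: cexp_continuous. Qed.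

Lemma cexp_line_continuous (z : R[i]) (x : R) :
  cexp (z * y%:C) @[y --> x] --> cexp (z * x%:C).
Proof.
have h : z * y%:C @[y --> x] --> z * x%:C.
  apply: ccvgM; first exact: ccvg_cst.
  by apply: cvg_real_complex; exact: cvg_id.
exact: ccvg_cexp.
Qed.

Lemma cmeasurable_cexp (z : R[i]) : cmeasurable (fun x => cexp (z * x%:C)).
Proof. by apply: cmeasurable_continuous => x; exact: cexp_line_continuous. Qed.

Lemma cint_cexp_itv (z : R[i]) (a b : R) : z != 0 -> a < b ->
  cint (fun v => if (a <= v) && (v <= b) then cexp (z * v%:C) else 0) =
  (cexp (z * b%:C) - cexp (z * a%:C)) / z.
Proof.
move=> z0 ab.
(* [p] stands for the real or the imaginary part, so that the fundamental theorem of calculus is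
   invoked once; the primitive is e^(zu) / z. *)
have key (p : R[i] -> R) (F : R -> R) : p 0 = 0 ->
    (forall x : R, cexp (z * y%:C) @[y --> x] --> cexp (z * x%:C) ->
       p (cexp (z * y%:C)) @[y --> x] --> p (cexp (z * x%:C))) ->
    (forall t : R, is_derive t 1 F (p (cexp (z * t%:C)))) ->
    rint (fun v => p (if (a <= v) && (v <= b) then cexp (z * v%:C) else 0)) = F b - F a.
  move=> p0 pc dF.
  have := @continuous_FTC2 R (fun v => p (cexp (z * v%:C))) F a b ab.
  rewrite integral_mkcond => H.
  rewrite /rint /Rintegral -[RHS]/(fine (F b - F a)%:E) EFinB -H.
  - congr fine; apply: eq_integral => v _; rewrite /patch/= mem_setE in_itv/=.
    by case: ifP => //; rewrite p0.
  - by apply: continuous_subspaceT => x; apply: pc; exact: cexp_line_continuous.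
  - have cF (t : R) : {for t, continuous F}.
      by apply/differentiable_continuous/derivable1_diffP; case: (dF t).
    split; first by move=> t _; case: (dF t).
    + by apply: cvg_at_right_filter; exact: cF.
    + by apply: cvg_at_left_filter; exact: cF.
  - by move=> t _; rewrite derive1E; exact: derive_val.
have dE (w : R[i]) : cder (fun u => cexp (z * u) / z) w (cexp (z * w)).
  have := cderZ z^-1 (cder_affine (a := 0) (b := z) (cder_cexp (0 + z * w))).
  rewrite add0r mulrC mulfK// => h; apply: cder_near h.
  by near=> u; rewrite add0r mulrC.
have dP (t : R) := cder_path (z := 0) (w := 1) (t := t) (dE (0 + t%:C * 1)).
have E (t : R) : 0 + t%:C * 1 = t%:C by rewrite add0r mulr1.
have dRe (t : R) : is_derive t 1 (fun u : R =>
    Re (cexp (z * (0 + u%:C * 1)) / z)) (Re (cexp (z * t%:C))).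
  by have [h _] := dP t; rewrite mulr1 E in h.
have dIm (t : R) : is_derive t 1 (fun u : R =>
    Im (cexp (z * (0 + u%:C * 1)) / z)) (Im (cexp (z * t%:C))).
  by have [_ h] := dP t; rewrite mulr1 E in h.
apply: complex_ext => /=.
  rewrite (key (@complex.Re R) _ erefl (fun x => @cvg_Re R _ _ _ _ _) dRe).
  by rewrite !E mulrBl cReD cReN.
rewrite (key (@complex.Im R) _ erefl (fun x => @cvg_Im R _ _ _ _ _) dIm).
by rewrite !E mulrBl cImD cImN.
Unshelve. all: by end_near. Qed.

(** Limit of the integrals over [-(n+1), 0]. It starts the induction for the beta integral and
    yields the two polar terms of Riemann's formula. *)
Lemma cint_cexp_half (z : R[i]) : 0 < Re z ->
  cintegrable (fun v => if v <= 0 then cexp (z * v%:C) else 0) /\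
  cint (fun v => if v <= 0 then cexp (z * v%:C) else 0) = z^-1.
Proof.
move=> z0; have zn0 : z != 0 by apply: contraTneq z0 => ->; rewrite /= ltxx.
have mle (a b : R -> R) : measurable_fun [set: R] a -> measurable_fun [set: R] b ->
  measurable_fun [set: R] (fun x => a x <= b x) by exact: measurable_fun_ler.
have bnd (v : R) : v <= 0 -> cabs (cexp (z * v%:C)) <= expR (- Re z * `|v|).
  move=> v0; rewrite cabs_cexp ler_expR mulrC cReMr ler0_norm//.
  by rewrite mulrNN mulrC.
have [|||I C] := @cint_dominated
  (fun n v => if (- n.+1%:R <= v) && (v <= 0) then cexp (z * v%:C) else 0)
  (fun v => if v <= 0 then cexp (z * v%:C) else 0) _ _ _ (rintegrable_expR_norm z0).
- move=> n; apply: cmeasurable_if; [|exact: cmeasurable_cexp|exact: cmeasurable_cst].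
  by apply: measurable_and; apply: mle => //; exact: measurable_cst.
- move=> n x; case: ifP => [/andP[_ x0]|_]; first exact: bnd.
  by rewrite cabs0 expR_ge0.
- move=> x; case: ifPn => x0; last first.
    rewrite (_ : (fun n => _) = fun _ => 0); first exact: ccvg_cst.
    by apply/funext => n; rewrite andbF.
  apply/cabs_cvgP => e e0; near=> n; rewrite andbT ifT ?subrr ?cabs0// lerNl.
  rewrite (le_trans (_ : _ <= n%:R))// ?ler_nat//.
  by near: n; exact: nbhs_infty_ger.
split=> //; apply: (ccvg_unique C).
rewrite (_ : (fun n => _) = fun n : nat => (1 - cexp (z * (- n.+1%:R)%:C)) / z); last first.
  apply/funext => n; rewrite cint_cexp_itv// ?oppr_lt0//.
  by rewrite mulr0 cexp0.
rewrite -[in X in _ --> X](mul1r z^-1) -[in X in _ --> X](subr0 1).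
apply: ccvgM; last exact: ccvg_cst.
apply: ccvgB; first exact: ccvg_cst.
apply: (@cvg_cabs_le _ _ _ _ _ _ (fun n : nat => (n.+1%:R * Re z)^-1)).
  apply: nearW => n; rewrite sub0r cabsN cabs_cexp mulrC cReMr mulNr expRN.
  rewrite lef_pV2 ?posrE ?expR_gt0 ?mulr_gt0//.
  by rewrite (le_trans _ (expR_ge1Dx _))// lerDr.
rewrite (_ : (fun n => _) = fun n : nat => (Re z)^-1 * n.+1%:R^-1); last first.
  by apply/funext => n; rewrite invfM mulrC.
rewrite -[X in _ --> X](mulr0 (Re z)^-1); apply: cvgM; first exact: cvg_cst.
exact: cvg_harmonic.
Unshelve. all: by end_near. Qed.

End ComplexIntegral.

(** * The Gamma and digamma functions *)

Section ExponentialLimit.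
Context {R : realType}.
Implicit Types x y : R.

Lemma expRN_bounds y : 0 <= y -> 1 - y <= expR (- y) <= 1 - y + y ^+ 2.
Proof.
move=> y0; rewrite expR_ge1Dx /= expRN.
have h : (1 + y)^-1 <= 1 - y + y ^+ 2.
  rewrite -[leLHS]mul1r ler_pdivrMr ?ltr_wpDr//.
  have := exprn_ge0 3 y0; nra.
by rewrite (le_trans _ h)// lef_pV2 ?posrE ?expR_gt0 ?ltr_wpDr// expR_ge1Dx.
Qed.

(** For a, b in [0, 1] the difference a^N - b^N is at most N |a - b|; here a = e^(-x/N) and b = 1 -
    x/N differ by at most (x/N)^2. *)
Lemma exp_pow_dist x n : 0 <= x -> x <= n.+1%:R ->
  `|expR (- x) - (1 - x / n.+1%:R) ^+ n.+1| <= x ^+ 2 / n.+1%:R.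
Proof.
move=> x0 xn; set N := n.+1; have N0 : (0 : R) < N%:R by rewrite ltr0n.
have y0 : 0 <= x / N%:R by rewrite divr_ge0// ltW.
have y1 : x / N%:R <= 1 by rewrite ler_pdivrMr// mul1r.
have /andP[b1 b2] := expRN_bounds y0.
have -> : expR (- x) = expR (- (x / N%:R)) ^+ N.
  by rewrite -expRM_natl mulrN; congr (expR (- _)); rewrite mulrC divfK// gt_eqF.
rewrite -cabs_real rmorphB !rmorphXn/=.
have := @cabs_subX_le R (expR (- (x / N%:R)))%:C (1 - x / N%:R)%:C 1 N.
rewrite !cabs_real !ger0_norm ?expR_ge0 ?subr_ge0// -rmorphB cabs_real.
rewrite expr1n mulr1 ger0_norm ?subr_ge0//.
rewrite -[1]expR0 ler_expR oppr_le0 expR0 => /(_ y0).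
rewrite gerBl => /(_ y0) /le_trans; apply.
rewrite (le_trans (_ : _ <= N%:R * (x / N%:R) ^+ 2))//.
  by rewrite ler_wpM2l ?(ltW N0)// lerBlDl.
by rewrite expr_div_n !expr2 invfM mulrCA (mulrA N%:R) mulfV ?gt_eqF// mul1r.
Qed.

Lemma exp_pow_cvg x : 0 <= x ->
  (1 - x / n.+1%:R) ^+ n.+1 @[n --> \oo] --> expR (- x).
Proof.
move=> x0; apply/cvgrPdist_le => e e0; near=> n.
have xn : x <= n.+1%:R.
  by rewrite (le_trans (_ : _ <= n%:R)) ?ler_nat//; near: n; exact: nbhs_infty_ger.
rewrite (le_trans (exp_pow_dist x0 xn))// ler_pdivrMr// mulrC -ler_pdivrMr//.
rewrite (le_trans (_ : _ <= n%:R)) ?ler_nat//; near: n; exact: nbhs_infty_ger.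
Unshelve. all: by end_near. Qed.

Lemma expRN_le_pow x k : 0 < x -> expR (- x) <= k.+1`!%:R / x ^+ k.+1.
Proof.
move=> x0; rewrite expRN -[leRHS]invrK lef_pV2 ?posrE ?expR_gt0//; last first.
  by rewrite invr_gt0 divr_gt0// ?exprn_gt0// ltr0n fact_gt0.
by rewrite invf_div; apply: le_trans (expR_ge1Dxn k (ltW x0)); rewrite lerDr.
Qed.

(** This is Euler's integrand x^(s-1) e^(-x) dx at x = e^v. With k + 1 >= 2 s, the bound e^(-x) <=
    (k+1)! x^(-k-1) overcomes e^(sv) for v >= 0; for v < 0 the factor e^(sv) itself decays. *)
Lemma gamma_kernel_le (s : R) : 0 < s -> exists C : R, forall v,
  expR (s * v) * expR (- expR v) <= C * expR (- s * `|v|).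
Proof.
move=> s0; pose k := Num.truncn (2 * s).
have kb : 2 * s <= k.+1%:R by rewrite ltW// truncnS_gt.
have f1 : (1 : R) <= k.+1`!%:R by rewrite ler1n fact_gt0.
exists k.+1`!%:R => v; have [v0|v0] := leP 0 v; last first.
  rewrite ltr0_norm// mulrNN mulrC ler_wpM2r ?expR_ge0// (le_trans _ f1)//.
rewrite ger0_norm// (le_trans (ler_wpM2l (expR_ge0 _) (expRN_le_pow k (expR_gt0 v))))//.
rewrite mulrCA ler_wpM2l// -expRM_natl -expRN -expRD ler_expR.
by have := ler_wpM2r v0 kb; nra.
Qed.

End ExponentialLimit.

(** * From Gauss's product to Euler's integral *)

Section GammaIntegral.
Context {R : realType}.
Implicit Types z : R[i].

Definition gauss_Gamma (n : nat) z : R[i] :=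
  cpow n%:R z * (n`!)%:R / \prod_(0 <= k < n.+1) (z + k%:R).

Lemma GammaE z : Gamma z = limn (fun n => gauss_Gamma n z). Proof. by []. Qed.

Lemma addn_neq0 z k : 0 < Re z -> z + k%:R != 0.
Proof.
move=> z0; apply: contraTneq z0 => /(congr1 (@complex.Re R)).
rewrite cReD -(rmorph_nat (real_complex R)) /= => /eqP.
by rewrite addr_eq0 => /eqP ->; rewrite -leNgt oppr_le0.
Qed.

(** Euler's beta integral B(z, n+1) in the variable x = e^v. Expanding one factor 1 - e^v expresses
    the case n+1 at z by the case n at z and at z + 1, which drives the induction. *)
Lemma beta_integral n z : 0 < Re z ->
  let f := fun v : R => if v <= 0 then cexp (z * v%:C) * ((1 - expR v) ^+ n)%:C else 0 in
  cintegrable f /\ cint f = (n`!)%:R / \prod_(0 <= k < n.+1) (z + k%:R).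
Proof.
elim: n z => [|n IH] z z0 /=.
  have -> : (fun v : R => if v <= 0 then cexp (z * v%:C) * ((1 - expR v) ^+ 0)%:C else 0)
    = (fun v : R => if v <= 0 then cexp (z * v%:C) else 0).
    by apply/funext => v; rewrite expr0 mulr1.
  have [I ->] := cint_cexp_half z0.
  by rewrite big_nat1 addr0 fact0 mul1r.
have z1 : 0 < Re (z + 1) by rewrite cReD /= ltr_wpDr.
have [I0 E0] := IH z z0; have [I1 E1] := IH _ z1.
have fE : (fun v : R => if v <= 0 then cexp (z * v%:C) * ((1 - expR v) ^+ n.+1)%:C else 0) =
  (fun v : R => (if v <= 0 then cexp (z * v%:C) * ((1 - expR v) ^+ n)%:C else 0) +
     (- 1) * (if v <= 0 then cexp ((z + 1) * v%:C) * ((1 - expR v) ^+ n)%:C else 0)).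
  apply/funext => v; case: ifP => _; last by rewrite mulr0 addr0.
  rewrite mulrDl mul1r cexpD cexp_real exprS rmorphM rmorphB rmorph1 /=; ring.
rewrite fE; split; first by apply: cintegrableD => //; exact: cintegrableZ.
rewrite cintD//; last exact: cintegrableZ.
rewrite cintZ// E0 E1 mulN1r.
have nz k : z + k%:R != 0 by exact: addn_neq0.
have -> : \prod_(0 <= k < n.+1) (z + 1 + k%:R) = \prod_(1 <= k < n.+2) (z + k%:R).
  by rewrite big_add1; apply: eq_bigr => k _; rewrite -natr1; ring.
have P0 : \prod_(1 <= k < n.+1) (z + k%:R) != 0.
  by rewrite prodf_seq_neq0; apply/allP => k _; exact: nz.
rewrite [X in _ / X]big_nat_recl//= [X in _ = _ / X]big_nat_recl//=.
rewrite -(big_add1 _ _ 0 n.+1 xpredT (fun k => z + k%:R)).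
rewrite -[X in _ = _ / (_ * X)](big_add1 _ _ 0 n.+2 xpredT (fun k => z + k%:R)).
rewrite [X in _ = _ / (_ * X)]big_nat_recr//= [X in _ - _ / X]big_nat_recr//=.
have nz0 := nz 0%N; rewrite mulr0n addr0 in nz0 *.
have nz1 := nz n.+1.
rewrite factS natrM -natr1; field.
by rewrite nz0 P0 natr1 nz1.
Qed.

(** The beta integrand translated by ln n: with x = e^v, the factor (1 - x)^n on [0, 1] becomes (1 -
    x/n)^n on [0, n], which tends to e^(-x). *)
Definition gauss_kernel (n : nat) z (v : R) : R[i] :=
  if v <= ln n%:R then cexp (z * v%:C) * ((1 - expR v / n%:R) ^+ n)%:C else 0.

Lemma gauss_Gamma_integral n z : 0 < Re z ->
  cintegrable (gauss_kernel n.+1 z) /\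
  cint (gauss_kernel n.+1 z) = gauss_Gamma n.+1 z.
Proof.
move=> z0; set N := n.+1; have N0 : (0 : R) < N%:R by rewrite ltr0n.
have [I E] := beta_integral N z0.
have [Es Is] := cint_shift (- ln N%:R) I.
have kE : gauss_kernel N z = (fun v : R => cexp (z * (ln N%:R)%:C) *
   (if v + - ln N%:R <= 0 then cexp (z * (v + - ln N%:R)%:C) *
      ((1 - expR (v + - ln N%:R)) ^+ N)%:C else 0)).
  apply/funext => v; rewrite /gauss_kernel subr_le0; case: ifP => _; last by rewrite mulr0.
  rewrite mulrA -cexpD -mulrDr -rmorphD/= (addrC (ln _)) subrK.
  by rewrite expRB lnK ?posrE.
rewrite kE; split; first exact: cintegrableZ.
by rewrite (cintZ _ Is) Es E; exact: mulrA.
Qed.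

Lemma gauss_kernel_le n z (v : R) :
  cabs (gauss_kernel n.+1 z v) <= expR (Re z * v) * expR (- expR v).
Proof.
rewrite /gauss_kernel; case: ifP => vn; last first.
  by rewrite cabs0 mulr_ge0// expR_ge0.
have ev : expR v / n.+1%:R <= 1.
  by rewrite ler_pdivrMr// mul1r -[leRHS](@lnK R) ?posrE ?ltr0n// ler_expR.
rewrite cabsM cabs_cexp (mulrC z) cReMr (mulrC v) ler_wpM2l ?expR_ge0//.
rewrite cabs_real ger0_norm ?exprn_ge0 ?subr_ge0//.
rewrite -[leRHS](_ : expR (- (expR v / n.+1%:R)) ^+ n.+1 = _); last first.
  by rewrite -expRM_natl mulrN mulrC divfK// gt_eqF.
by rewrite lerXn2r ?nnegrE ?subr_ge0 ?expR_ge0// expR_ge1Dx.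
Qed.

Definition Gamma_kernel z (v : R) : R[i] := cexp (z * v%:C) * (expR (- expR v))%:C.

Lemma gauss_kernel_cvg z (v : R) :
  gauss_kernel n.+1 z v @[n --> \oo] --> Gamma_kernel z v.
Proof.
have h : cexp (z * v%:C) * ((1 - expR v / n.+1%:R) ^+ n.+1)%:C @[n --> \oo] -->
    Gamma_kernel z v.
  apply: ccvgM; first exact: ccvg_cst.
  by apply: cvg_real_complex; apply: exp_pow_cvg; exact: expR_ge0.
apply/cabs_cvgP => e e0; move/cabs_cvgP : h => /(_ _ e0) h.
near=> n; rewrite /gauss_kernel ifT; first by near: n.
rewrite -[leLHS]expRK ler_ln ?posrE ?expR_gt0//.
rewrite (le_trans (_ : _ <= n%:R)) ?ler_nat//.
by near: n; exact: nbhs_infty_ger.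
Unshelve. all: by end_near. Qed.

Lemma gauss_Gamma_cvg z : 0 < Re z ->
  cintegrable (Gamma_kernel z) /\
  gauss_Gamma n.+1 z @[n --> \oo] --> cint (Gamma_kernel z).
Proof.
move=> z0; have [C HC] := gamma_kernel_le z0.
have [|||I c] := @cint_dominated R (fun n => gauss_kernel n.+1 z) (Gamma_kernel z)
  _ _ _ (rintegrableZ C (rintegrable_expR_norm z0)).
- by move=> n; apply: cintegrable_measurable; exact: (gauss_Gamma_integral n z0).1.
- by move=> n v; rewrite (le_trans (gauss_kernel_le n z v)).
- by move=> v; exact: gauss_kernel_cvg.
split=> //; rewrite (_ : (fun n => _) = (fun n => cint (gauss_kernel n.+1 z)))//.
by apply/funext => n; rewrite (gauss_Gamma_integral n z0).2.
Qed.

(** The shift to [n.+1] does not change the limit and keeps the logarithm of 0 out of the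
    estimates. *)
Lemma Gamma_cvg z : 0 < Re z -> gauss_Gamma n.+1 z @[n --> \oo] --> Gamma z.
Proof.
move=> z0; have [_ c] := gauss_Gamma_cvg z0.
suff -> : Gamma z = cint (Gamma_kernel z) by [].
rewrite GammaE; apply: ccvg_lim.
by move: c; rewrite -(cvg_shiftS (fun n => gauss_Gamma n z)).
Qed.

Lemma Gamma_integral z : 0 < Re z -> cintegrable (Gamma_kernel z) /\
  Gamma z = cint (Gamma_kernel z).
Proof.
move=> z0; have [I c] := gauss_Gamma_cvg z0.
by split=> //; apply: ccvg_unique (Gamma_cvg z0) c.
Qed.

Lemma rint_le (f g : R -> R) : rintegrable f -> rintegrable g ->
  (forall x, f x <= g x) -> rint f <= rint g.
Proof. by move=> If Ig fg; apply: le_Rintegral. Qed.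

Lemma Re_Gamma_gt0 (s : R) : 0 < s -> 0 < Re (Gamma s%:C).
Proof.
move=> s0; have [[I _] ->] := @Gamma_integral s%:C s0.
(* On [0, 1] the integrand is at least c e^v, since e^(-e^v) >= e^(-e) and e^(sv) >= 1 >= e^(v-1);
   the integral of e^v there is e - 1 > 0. *)
pose c : R := expR (- expR 1) * expR (- 1).
have one0 : (1 : R[i]) != 0 by exact: oner_neq0.
pose g (v : R) : R[i] := if (0 <= v) && (v <= 1) then cexp (1 * v%:C) else 0.
have Ig : rintegrable (fun v => Re (g v)).
  apply: (@rintegrable_le _ _ (fun v => expR 2 * expR (- 1 * `|v|))).
  - suff [] : cmeasurable g by [].
    apply: cmeasurable_if; [|exact: cmeasurable_cexp|exact: cmeasurable_cst].
    by apply: measurable_and; apply: measurable_fun_ler => //; exact: measurable_cst.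
  - move=> v; rewrite /g; case: ifP => [/andP[v0 v1]|_]; last first.
      by rewrite normr0 mulr_ge0// expR_ge0.
    rewrite mul1r cexp_real /= ger0_norm ?expR_ge0// ger0_norm// -expRD ler_expR.
    lra.
  - by apply: rintegrableZ; exact: rintegrable_expR_norm.
have : c * rint (fun v => Re (g v)) <= Re (cint (Gamma_kernel s%:C)).
  rewrite -rintZ//; apply: rint_le => //; first exact: rintegrableZ.
  move=> v; have -> : Gamma_kernel s%:C v = (expR (s * v) * expR (- expR v))%:C.
    by rewrite /Gamma_kernel -[s%:C * v%:C]rmorphM cexp_real -rmorphM.
  rewrite /g [leRHS]/=.
  case: ifP => [/andP[v0 v1]|_]; last by rewrite mulr0 mulr_ge0// expR_ge0.
  rewrite mul1r cexp_real/= /c -mulrA -expRD mulrC ler_pM ?expR_ge0//.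
    by rewrite ler_expR; nra.
  by rewrite ler_expR lerN2 ler_expR.
apply: lt_le_trans; rewrite mulr_gt0//; first by rewrite mulr_gt0// expR_gt0.
have -> : rint (fun v => Re (g v)) = Re (cint g) by [].
by rewrite (cint_cexp_itv one0 (@ltr01 R)) !mul1r !cexp_real divr1 -rmorphB/= subr_gt0 ltr_expR.
Qed.

End GammaIntegral.

Lemma ccvg_id {R : realType} (z : R[i]) : (fun w : R[i] => w) @ z --> z.
Proof. exact: cvg_id. Qed.
Arguments ccvg_id {R} z.

(** * The convergent series of (k+1)^(-5/4) *)

Section QuarterRootSeries.
Context {R : realType}.
Implicit Types x y : R.

Definition qroot x : R := Num.sqrt (Num.sqrt x).

Lemma qroot_ge0 x : 0 <= qroot x. Proof. exact: sqrtr_ge0. Qed.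

Lemma qroot_gt0 x : 0 < x -> 0 < qroot x.
Proof. by move=> x0; rewrite !sqrtr_gt0. Qed.

Lemma qrootX4 x : 0 <= x -> qroot x ^+ 4 = x.
Proof.
by move=> x0; rewrite (exprM _ 2 2) sqr_sqrtr ?sqrtr_ge0// sqr_sqrtr.
Qed.

Lemma ler_qroot x y : x <= y -> qroot x <= qroot y.
Proof. by move=> xy; rewrite ler_wsqrtr// ler_wsqrtr. Qed.

Lemma qroot1 : qroot 1 = 1. Proof. by rewrite /qroot !sqrtr1. Qed.

Lemma qroot_le x : 1 <= x -> qroot x <= x.
Proof.
move=> x1; have q1 : 1 <= qroot x by rewrite -qroot1 ler_qroot.
rewrite -[leRHS]qrootX4; last by rewrite (le_trans _ x1).
by rewrite ler_eXnr.
Qed.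

(** The exponent -5/4 is what a product of factors of order k + 1 and k + 1 + |x| leaves to k once
    (1 + |x|)^(3/4) has been given to x. *)
Definition qterm (k : nat) : R := (k.+1%:R * qroot k.+1%:R)^-1.

Lemma qterm_ge0 k : 0 <= qterm k.
Proof. by rewrite invr_ge0 mulr_ge0// qroot_ge0. Qed.

(** A discrete primitive: 4 u^(-1/4) has derivative - u^(-5/4). With r^4 = k+1 and s^4 = k+2, 1/r -
    1/s equals 1 / (r s (s + r) (s^2 + r^2)), whose denominator is at most 4 s^5. *)
Lemma qterm_telescope (k : nat) :
  qterm k.+1 <= 4 * (qroot k.+1%:R)^-1 - 4 * (qroot k.+2%:R)^-1.
Proof.
have := @qrootX4 k.+1%:R (ler0n _ _); have := @qrootX4 k.+2%:R (ler0n _ _).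
have := @qroot_gt0 k.+1%:R (ltr0Sn _ _); have := @qroot_gt0 k.+2%:R (ltr0Sn _ _).
have : qroot k.+1%:R <= qroot k.+2%:R by rewrite ler_qroot// ler_nat.
rewrite /qterm.
set r := qroot k.+1%:R; set s := qroot k.+2%:R.
move=> rs s0 r0 s4 r4.
have s41 : s ^+ 4 - r ^+ 4 = 1 by rewrite s4 r4 -[k.+2%:R]natr1; ring.
rewrite -s4 -mulrBr.
have -> : r^-1 - s^-1 = (s ^+ 4 - r ^+ 4) / (r * s * ((s + r) * (s ^+ 2 + r ^+ 2))).
  by field; rewrite ?gt_eqF ?addr_gt0 ?exprn_gt0.
rewrite s41 mul1r.
have -> : (s ^+ 4 * s)^-1 = 4 * (s * s * ((s + s) * (s ^+ 2 + s ^+ 2)))^-1.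
  have -> : s * s * ((s + s) * (s ^+ 2 + s ^+ 2)) = 4 * (s ^+ 4 * s) by ring.
  by rewrite (invfM 4) mulrA mulfV ?mul1r// pnatr_eq0.
rewrite ler_pM2l// lef_pV2 ?posrE ?mulr_gt0 ?addr_gt0 ?exprn_gt0//.
have r0' := ltW r0; have s0' := ltW s0.
have sr2 : r ^+ 2 <= s ^+ 2 by rewrite lerXn2r.
apply: ler_pM; [by rewrite mulr_ge0|by rewrite mulr_ge0 ?addr_ge0 ?sqr_ge0|
  by rewrite ler_wpM2r|].
by apply: ler_pM; rewrite ?addr_ge0 ?sqr_ge0 ?lerD2l.
Qed.

Lemma cvg_series_qterm : cvgn (series qterm).
Proof.
apply: nondecreasing_is_cvgn.
  by apply: nondecreasing_series => k _ _; exact: qterm_ge0.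
(* The first term is 1 and the others telescope to at most 4. *)
exists 5 => _ [n _ <-].
have H m : series qterm m.+1 <= 5 - 4 * (qroot m.+1%:R)^-1.
  elim: m => [|m IH].
    by rewrite /series/= big_nat1 /qterm mul1r qroot1 invr1; lra.
  rewrite /series/= big_nat_recr//= -/(series qterm m.+1).
  have := qterm_telescope m; move: IH; rewrite /series/=; lra.
case: n => [|n]; first by rewrite /series/= big_geq.
by rewrite (le_trans (H n))// gerBl mulr_ge0// invr_ge0 qroot_ge0.
Qed.

Lemma cvg_series_qtermZ (c : R) : cvgn (series (fun k => c * qterm k)).
Proof.
have /cvg_ex[l hl] := @cvg_series_qterm; apply/cvg_ex; exists (c * l).
rewrite (_ : series _ = fun n => c * series qterm n).
  by apply: cvgM; [exact: cvg_cst|exact: hl].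
by apply/funext => n; rewrite /series/= mulr_sumr.
Qed.

End QuarterRootSeries.
Arguments cvg_series_qtermZ {R} c.

(** * The digamma function and differences of Lerch functions *)

Section Digamma.
Context {R : realType}.
Implicit Types (a b z w : R[i]).

Lemma cabs_addn_ge (m : R) a k : 0 < m -> m <= Re a ->
  Num.min m 1 * k.+1%:R <= cabs (a + k%:R).
Proof.
move=> m0 ma; rewrite (le_trans _ (ler_cabs_Re _))//.
rewrite (le_trans _ (ler_norm _))// cReD -(rmorph_nat (real_complex R)) /=.
rewrite -natr1 mulrDr mulr1 addrC lerD// ?ge_min ?ma//.
by rewrite ler_piMl// ge_min lexx orbT.
Qed.

(** One series for both purposes: up to a factor a - b or b - a, its sum is a difference of digamma
    values when q = 1 and a difference of Lerch values when q < 1. Taking differences makes the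
    convergence absolute up to q = 1. *)
Definition dgterm (q : R) a b (k : nat) : R[i] :=
  (q ^+ k)%:C / ((a + k%:R) * (b + k%:R)).

Lemma dgterm_le (q m : R) a b k : 0 <= q <= 1 -> 0 < m ->
  m <= Re a -> m <= Re b ->
  cabs (dgterm q a b k) <= (Num.min m 1) ^- 2 * qterm k.
Proof.
move=> /andP[q0 q1] m0 ma mb; set c := Num.min m 1.
have c0 : 0 < c by rewrite lt_min m0 ltr01.
have k0 : (0 : R) < k.+1%:R by rewrite ltr0n.
rewrite cabs_div cabsM cabs_real ger0_norm ?exprn_ge0// /qterm -invfM.
rewrite (le_trans (_ : _ <= 1 / (cabs (a + k%:R) * cabs (b + k%:R))))//.
  by rewrite ler_wpM2r ?exprn_ile1// invr_ge0 mulr_ge0// cabs_ge0.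
have ha := cabs_addn_ge k m0 ma; have hb := cabs_addn_ge k m0 mb.
have ck : 0 < c * k.+1%:R by rewrite mulr_gt0.
rewrite mul1r lef_pV2 ?posrE ?mulr_gt0 ?exprn_gt0 ?qroot_gt0//; last 2 first.
- exact: lt_le_trans ha.
- exact: lt_le_trans hb.
apply: (@le_trans _ _ ((c * k.+1%:R) * (c * k.+1%:R))); last by rewrite ler_pM// ltW.
rewrite [leRHS]mulrACA -expr2 ler_wpM2l ?sqr_ge0// ler_wpM2l ?(ltW k0)//.
by rewrite qroot_le// ler1n.
Qed.

Definition dgsum (q : R) a b : R[i] := limn (series (dgterm q a b)).

Lemma dgsum_cvg (q : R) a b : 0 <= q <= 1 -> 0 < Re a -> 0 < Re b ->
  series (dgterm q a b) @ \oo --> dgsum q a b.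
Proof.
move=> q01 a0 b0; pose m := Num.min (Re a) (Re b).
have m0 : 0 < m by rewrite lt_min a0.
have bd k : cabs (dgterm q a b k) <= (Num.min m 1) ^- 2 * qterm k.
  by apply: dgterm_le => //; rewrite ge_min lexx ?orbT.
exact: (abs_series_cvg bd (cvg_series_qtermZ _)).
Qed.

Lemma near_Re_gt a (m : R) : m < Re a -> \forall w \near a, m < Re w.
Proof.
move=> ma; apply/nbhs_cabsP; exists (Re a - m); first by rewrite subr_gt0.
move=> w; rewrite cabsC => /(le_lt_trans (ler_cabs_Re _)).
by move=> /(le_lt_trans (ler_norm _)); rewrite cReD cReN ltrD2l ltrN2.
Qed.

Lemma dgsum_continuous (q : R) a b : 0 <= q <= 1 -> 0 < Re a ->
  0 < Re b -> dgsum q w b @[w --> a] --> dgsum q a b.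
Proof.
move=> q01 a0 b0; pose m := Num.min (Re a / 2) (Re b).
have m0 : 0 < m by rewrite lt_min divr_gt0.
have mb : m <= Re b by rewrite ge_min lexx orbT.
have m2 : Re a / 2 < Re a.
  by rewrite ltr_pdivrMr// mulr_natr mulr2n ltrDl.
have [||] := @tannery R R[i] (nbhs a) _ (fun w => dgterm q w b) (fun w => dgsum q w b)
  (dgterm q a b) (fun k => (Num.min m 1) ^- 2 * qterm k) _ (cvg_series_qtermZ _).
- apply: filterS (near_Re_gt m2) => w wm; split=> [n|].
    by apply: dgterm_le => //; rewrite ge_min (ltW wm).
  by apply: dgsum_cvg => //; apply: lt_trans wm; rewrite divr_gt0.
- move=> n; apply: ccvgM; first exact: ccvg_cst.
  apply: ccvgV; first by rewrite mulf_neq0// addn_neq0.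
  apply: ccvgM; last exact: ccvg_cst.
  by apply: ccvgD; [exact: cvg_id|exact: ccvg_cst].
by [].
Qed.

(** The logarithmic derivative of [gauss_Gamma n]. *)
Definition psi_seq n z : R[i] := (ln n%:R)%:C - \sum_(0 <= k < n.+1) (z + k%:R)^-1.

Lemma psi_seqB n z w : 0 < Re z -> 0 < Re w ->
  psi_seq n z - psi_seq n w = (z - w) * series (dgterm 1 z w) n.+1.
Proof.
move=> z0 w0; rewrite /psi_seq.
rewrite (_ : forall l x y : R[i], l - x - (l - y) = y - x); last by move=> *; ring.
rewrite -sumrB /series/= mulr_sumr.
apply: eq_bigr => k _; rewrite /dgterm expr1n rmorph1.
by field; rewrite !addn_neq0.
Qed.

(** Its limit is minus Euler's constant, the value of digamma at 1; other points are compared with 1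
    through [psi_seqB]. *)
Definition euler_seq (n : nat) : R := ln n.+1%:R - \sum_(0 <= k < n.+1) k.+1%:R^-1.

Lemma ln_ratio_le n : ln n.+2%:R - ln n.+1%:R <= n.+1%:R^-1 :> R.
Proof.
rewrite -ln_div ?posrE ?ltr0n// (_ : _ / _ = 1 + n.+1%:R^-1); last first.
  by rewrite -[n.+2]addn1 natrD mulrDl mulfV ?pnatr_eq0// mul1r.
by rewrite le_ln1Dx// (lt_trans (ltrN10 R))// invr_gt0 ltr0n.
Qed.

Lemma ln_ratio_ge n : n.+2%:R^-1 <= ln n.+2%:R - ln n.+1%:R :> R.
Proof.
rewrite -opprB lerNr -ln_div ?posrE ?ltr0n// (_ : _ / _ = 1 - n.+2%:R^-1); last first.
  by apply: (@mulIf _ n.+2%:R); rewrite ?pnatr_eq0// divfK ?pnatr_eq0// mulrBl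
    mulVf ?pnatr_eq0// mul1r -[n.+2]addn1 natrD addrK.
by rewrite le_ln1Dx// ltrN2 invf_lt1 ?ltr0n// ltr1n.
Qed.

Lemma cvg_euler_seq : cvgn euler_seq.
Proof.
apply: nondecreasing_is_cvgn.
  apply/nondecreasing_seqP => n; rewrite /euler_seq [in leRHS]big_nat_recr//=.
  move: (ln_ratio_ge n); set s := \sum_(0 <= k < _) _; set a := ln n.+1%:R.
  by set b := ln n.+2%:R; set c := n.+2%:R^-1; lra.
exists 0 => _ [n _ <-]; rewrite /euler_seq subr_le0.
have H m : ln m.+1%:R <= \sum_(0 <= k < m) k.+1%:R^-1 :> R.
  elim: m => [|m IH]; first by rewrite big_geq// ln1.
  rewrite big_nat_recr//=; move: IH (ln_ratio_le m).
  set s := \sum_(0 <= k < _) _; set a := ln m.+1%:R.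
  by set b := ln m.+2%:R; set c := m.+1%:R^-1; lra.
by rewrite (le_trans (H n))// big_nat_recr//= lerDl.
Qed.

Definition psi z : R[i] := limn (fun n => psi_seq n.+1 z).

Lemma Re1_gt0 : 0 < Re (1 : R[i]). Proof. exact: ltr01. Qed.

Lemma psi_seq1_cvg : cvgn (fun n => psi_seq n.+1 (1 : R[i])).
Proof.
have /cvg_ex[l hl] := cvg_euler_seq.
apply/cvg_ex; exists l%:C.
rewrite (_ : (fun n => _) = fun n => (euler_seq n - n.+2%:R^-1)%:C).
  apply: cvg_real_complex; rewrite -[X in _ --> X]subr0.
  apply: cvgB; first exact: hl.
  have := @cvg_harmonic R; rewrite -(cvg_shiftS (@harmonic R)); exact.
apply/funext => n; rewrite /psi_seq /euler_seq -addrA -opprD.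
have -> : \sum_(0 <= k < n.+1) k.+1%:R^-1 + n.+2%:R^-1 =
  \sum_(0 <= k < n.+2) k.+1%:R^-1 :> R by rewrite [RHS]big_nat_recr.
rewrite rmorphB rmorph_sum/=; congr (_ - _); apply: eq_bigr => k _.
by rewrite fmorphV rmorph_nat -natr1 addrC.
Qed.

Lemma psi_seq_cvg z : 0 < Re z ->
  psi_seq n.+1 z @[n --> \oo] --> psi 1 + (z - 1) * dgsum 1 z 1.
Proof.
move=> z0; rewrite (_ : (fun n => _) = fun n => psi_seq n.+1 1 +
    (z - 1) * series (dgterm 1 z 1) n.+2); last first.
  by apply/funext => n; rewrite -psi_seqB// ?Re1_gt0// addrC subrK.
apply: ccvgD; first exact: psi_seq1_cvg.
apply: ccvgM; first exact: ccvg_cst.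
have : 0 <= (1 : R) <= 1 by rewrite lexx ler01.
move=> /dgsum_cvg/(_ z0 Re1_gt0).
by rewrite (cvg_shiftS (fun n => series (dgterm 1 z 1) n.+1))
  (cvg_shiftS (series (dgterm 1 z 1))).
Qed.

Lemma psiE z : 0 < Re z -> psi z = psi 1 + (z - 1) * dgsum 1 z 1.
Proof. by move=> z0; apply: ccvg_lim; exact: psi_seq_cvg. Qed.

Lemma psi_cvg z : 0 < Re z -> psi_seq n.+1 z @[n --> \oo] --> psi z.
Proof. by move=> z0; rewrite psiE//; exact: psi_seq_cvg. Qed.

Lemma psiB z w : 0 < Re z -> 0 < Re w ->
  psi z - psi w = (z - w) * dgsum 1 z w.
Proof.
move=> z0 w0.
have h1 : (fun n => psi_seq n.+1 z - psi_seq n.+1 w) @ \oo --> psi z - psi w.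
  exact: (ccvgB (psi_cvg z0) (psi_cvg w0)).
apply: (ccvg_unique h1).
rewrite (_ : (fun n => _) = fun n => (z - w) * series (dgterm 1 z w) n.+2); last first.
  by apply/funext => n; rewrite psi_seqB.
apply: ccvgM; first exact: ccvg_cst.
have : 0 <= (1 : R) <= 1 by rewrite lexx ler01.
move=> /dgsum_cvg/(_ z0 w0).
by rewrite (cvg_shiftS (fun n => series (dgterm 1 z w) n.+1))
  (cvg_shiftS (series (dgterm 1 z w))).
Qed.

Lemma psi_continuous z : 0 < Re z -> psi w @[w --> z] --> psi z.
Proof.
move=> z0.
have q01 : 0 <= (1 : R) <= 1 by rewrite lexx ler01.
have h1 : (fun w : R[i] => w - 1) @ z --> z - 1.
  by exact: (ccvgB (ccvg_id z) (ccvg_cst 1)).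
have h2 : (fun w : R[i] => psi 1 + (w - 1) * dgsum 1 w 1) @ z -->
    psi 1 + (z - 1) * dgsum 1 z 1.
  exact: (ccvgD (ccvg_cst (psi 1)) (ccvgM h1 (dgsum_continuous q01 z0 Re1_gt0))).
move: h2; rewrite -(psiE z0) => h; apply/(cabs_cvgP (F := nbhs z)) => e e0; move/cabs_cvgP : h => /(_ _ e0).
move: (near_Re_gt z0); apply: filterS2 => w w0.
by rewrite -psiE.
Qed.

(** For q < 1 the two Lerch series converge separately by comparison with a geometric series, so
    they may be subtracted termwise. *)
Lemma lerchE (q : R) z w : 0 <= q < 1 -> 0 < Re z -> 0 < Re w ->
  lerch q%:C 1 z - lerch q%:C 1 w = (w - z) * dgsum q z w.
Proof.
move=> /andP[q0 q1].
have cl v : 0 < Re v -> series (fun n => q%:C ^+ n * (n%:R + v) ^- 1) @ \oo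
    --> lerch q%:C 1 v.
  move=> v0; pose c := Num.min (Re v) 1.
  have c0 : 0 < c by rewrite lt_min v0 ltr01.
  have b n : cabs (q%:C ^+ n * (n%:R + v) ^- 1) <= c^-1 * q ^+ n.
    rewrite expr1 cabs_div cabsX cabs_real ger0_norm// mulrC.
    rewrite ler_wpM2r ?exprn_ge0// lef_pV2 ?posrE ?cabs_gt0//; last first.
      by rewrite addrC addn_neq0.
    rewrite addrC (le_trans _ (cabs_addn_ge n v0 (lexx _)))// ler_peMr ?(ltW c0)//.
    by rewrite ler1n.
  apply: (abs_series_cvg b); apply: is_cvg_geometric_series.
  by rewrite ger0_norm.
move=> z0 w0.
have h : (fun n => series (fun n => q%:C ^+ n * (n%:R + z) ^- 1) n -
   series (fun n => q%:C ^+ n * (n%:R + w) ^- 1) n) @ \oo -->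
   lerch q%:C 1 z - lerch q%:C 1 w by exact: (ccvgB (cl _ z0) (cl _ w0)).
apply: (ccvg_unique h).
rewrite (_ : (fun n => _) = fun n => (w - z) * series (dgterm q z w) n).
  apply: ccvgM; first exact: ccvg_cst.
  by apply: dgsum_cvg => //; rewrite q0 ltW.
apply/funext => n; rewrite /series/= mulr_sumr -sumrB; apply: eq_bigr => k _.
rewrite /dgterm rmorphXn !expr1 ![k%:R + _]addrC.
by field; rewrite !addn_neq0.
Qed.

(** Since q^k <= 1, one dominating series serves for every u > 0. This evaluates the bracket of the
    statement at t = 0. *)
Lemma dgsum_cvg_right z w : 0 < Re z -> 0 < Re w ->
  dgsum (expR (- (2 * u))) z w @[u --> 0^'+] --> dgsum 1 z w.
Proof.
move=> z0 w0; pose m := Num.min (Re z) (Re w).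
have m0 : 0 < m by rewrite lt_min z0.
have [||_ h] := @tannery R R (0 : R)^'+ _ (fun u => dgterm (expR (- (2 * u))) z w)
  (fun u => dgsum (expR (- (2 * u))) z w)
  (dgterm 1 z w) (fun k => (Num.min m 1) ^- 2 * qterm k) _ (cvg_series_qtermZ _).
- near=> u; have u0 : 0 < u by near: u; exact: nbhs_right_gt.
  have q01 : 0 <= expR (- (2 * u)) <= 1.
    by rewrite expR_ge0/= -[leRHS]expR0 ler_expR oppr_le0 mulr_ge0// ltW.
  split=> [n|]; last exact: dgsum_cvg.
  by apply: dgterm_le => //; rewrite ge_min lexx ?orbT.
- move=> n; apply: ccvgM; last exact: ccvg_cst.
  apply: cvg_real_complex.
  have hc : {for (0 : R), continuous (fun u : R => expR (- (2 * u)) ^+ n)}.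
    apply: (@continuous_comp _ _ _ (fun u : R => expR (- (2 * u))) (fun x => x ^+ n)).
      apply: (@continuous_comp _ _ _ (fun u : R => - (2 * u)) expR).
        by apply: cvgN; apply: cvgM; [exact: cvg_cst|exact: cvg_id].
      exact: continuous_expR.
    exact: exprn_continuous.
  have := hc; rewrite /prop_for/= /continuous_at mulr0 oppr0 expR0.
  exact: cvg_at_right_filter.
exact: h.
Unshelve. all: by end_near. Qed.

End Digamma.

(** * The derivative and the nonvanishing of Gamma *)

Section GammaDerivative.
Context {R : realType}.
Implicit Types (z w : R[i]).

Lemma cder_prod_addn m z : 0 < Re z ->
  cder (fun w : R[i] => \prod_(0 <= k < m) (w + k%:R)) z
   ((\prod_(0 <= k < m) (z + k%:R)) * \sum_(0 <= k < m) (z + k%:R)^-1).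
Proof.
move=> z0; elim: m => [|m IH].
  rewrite !big_geq// mulr0 (_ : (fun w => _) = fun _ : R[i] => 1); first exact: cder_cst.
  by apply/funext => w; rewrite big_geq.
rewrite (_ : (fun w => _) = fun w : R[i] => (\prod_(0 <= k < m) (w + k%:R)) * (w + m%:R)).
  have h2 : cder (fun w : R[i] => w + m%:R) z (1 + 0) := cderD (cder_id z) (cder_cst m%:R z).
  apply: cder_eq (cderM IH h2) _.
  rewrite [in RHS]big_nat_recr//= [in RHS]big_nat_recr//= addr0 mulr1.
  have nz := addn_neq0 m z0.
  set P := \prod_(_ <= _ < _) _; set S := \sum_(_ <= _ < _) _.
  by field.
by apply/funext => w; rewrite big_nat_recr.
Qed.

Lemma prod_addn_neq0 m z : 0 < Re z -> \prod_(0 <= k < m) (z + k%:R) != 0.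
Proof. by move=> z0; rewrite prodf_seq_neq0; apply/allP => k _; exact: addn_neq0. Qed.

Lemma cder_cpow (x : R) z : cder (cpow x) z (cpow x z * (ln x)%:C).
Proof.
have := cder_affine (a := 0) (b := (ln x)%:C) (z := z) (cder_cexp _).
rewrite add0r [_ * z]mulrC => h; apply: cder_near h.
by near=> w; rewrite /cpow add0r mulrC.
Unshelve. all: by end_near. Qed.

Lemma cder_gauss_Gamma n z : 0 < Re z ->
  cder (gauss_Gamma n) z (gauss_Gamma n z * psi_seq n z).
Proof.
move=> z0; have P0 := prod_addn_neq0 n.+1 z0.
apply: cder_eq.
  apply: (cderM (cderM (cder_cpow n%:R z) (cder_cst (n`!)%:R z))).
  exact: (cderV P0 (cder_prod_addn n.+1 z0)).
rewrite /gauss_Gamma /psi_seq mulr0 add0r.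
set P := \prod_(_ <= _ < _) _ in P0 *; set S := \sum_(_ <= _ < _) _.
by field.
Qed.

Lemma cder_psi_seq n z : 0 < Re z ->
  cder (psi_seq n) z (\sum_(0 <= k < n.+1) (z + k%:R) ^- 2).
Proof.
move=> z0; rewrite /psi_seq.
have hs : cder (fun w : R[i] => \sum_(0 <= k < n.+1) (w + k%:R)^-1) z
    (\sum_(0 <= k < n.+1) - (z + k%:R) ^- 2).
  apply: (@cder_sum R nat _ (fun k (w : R[i]) => (w + k%:R)^-1)
    (fun k (w : R[i]) => - (w + k%:R) ^- 2)) => k.
  have h2 : cder (fun w : R[i] => w + k%:R) z (1 + 0) := cderD (cder_id z) (cder_cst k%:R z).
  have h3 := cderV (f := fun w : R[i] => w + k%:R) (addn_neq0 k z0) h2.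
  by rewrite addr0 mulN1r in h3.
have := cderD (cder_cst (ln n%:R)%:C z) (cderZ (-1) hs).
rewrite add0r sumrN mulN1r opprK; apply: cder_near.
by near=> w; rewrite mulN1r.
Unshelve. all: by end_near.
Qed.

Lemma cint_norm_le (f : R -> R[i]) (g : R -> R) : (forall x, cabs (f x) <= g x) ->
  cintegrable f -> rintegrable g -> cabs (cint f) <= 2 * rint g.
Proof.
move=> fg [fr fi] Ig; rewrite (le_trans (ler_cabs_ReIm _))// mulr_natl mulr2n /=.
have key (h : R -> R) : rintegrable h -> (forall x, `|h x| <= g x) -> `|rint h| <= rint g.
  move=> Ih hg; rewrite ler_norml; apply/andP; split.
    rewrite -mulN1r -rintZ//; apply: rint_le => //; first exact: rintegrableZ.
    by move=> x; rewrite mulN1r lerNl (le_trans _ (hg x))// -normrN ler_norm.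
  by apply: rint_le => // x; rewrite (le_trans _ (hg x))// ler_norm.
apply: lerD; apply: key => // x.
  exact: le_trans (ler_cabs_Re _) (fg x).
exact: le_trans (ler_cabs_Im _) (fg x).
Qed.

(** The bound is uniform in n on a vertical strip: according to the sign of v, the integrand at [w]
    is dominated by the one at the right or at the left edge. *)
Lemma gauss_Gamma_bound (m M : R) : 0 < m -> exists2 B : R, 0 <= B &
  forall n w, m <= Re w <= M -> cabs (gauss_Gamma n.+1 w) <= B.
Proof.
move=> m0; pose M' := Num.max m M.
have M0 : 0 < M' by rewrite lt_max m0.
have [C1 H1] := gamma_kernel_le m0; have [C2 H2] := gamma_kernel_le M0.
pose g (v : R) := C1 * expR (- m * `|v|) + C2 * expR (- M' * `|v|).
have Ig : rintegrable g.
  by apply: rintegrableD; apply: rintegrableZ; exact: rintegrable_expR_norm.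
have g0 v : 0 <= g v.
  by rewrite (le_trans _ (lerD (H1 v) (H2 v)))// addr_ge0// mulr_ge0// expR_ge0.
exists (2 * rint g).
  by rewrite mulr_ge0// /rint; apply: Rintegral_ge0.
move=> n w /andP[mw wM]; have w0 : 0 < Re w by exact: lt_le_trans mw.
have [I <-] := gauss_Gamma_integral n w0.
apply: cint_norm_le => // v; rewrite (le_trans (gauss_kernel_le n w v))//.
rewrite (le_trans _ (lerD (H1 v) (H2 v)))// -mulrDl ler_wpM2r ?expR_ge0//.
have [v0|v0] := leP 0 v.
  rewrite (le_trans (_ : _ <= expR (M' * v))) ?lerDr ?expR_ge0// ler_expR.
  by rewrite ler_wpM2r// (le_trans wM)// le_max lexx orbT.
rewrite (le_trans (_ : _ <= expR (m * v))) ?lerDl ?expR_ge0// ler_expR.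
by rewrite ler_wnM2r// ltW.
Qed.

Lemma series_le_lim (v : R^nat) n : (forall k, 0 <= v k) -> cvgn (series v) ->
  series v n <= limn (series v).
Proof.
by move=> v0 cv; apply: nondecreasing_cvgn_le => //; exact: nondecreasing_series.
Qed.

Lemma psi_seq_bound (m M : R) : 0 < m -> exists2 B : R, 0 <= B &
  forall n w, m <= Re w -> cabs w <= M -> cabs (psi_seq n.+1 w) <= B.
Proof.
move=> m0; pose m' := Num.min m 1.
have m'0 : 0 < m' by rewrite lt_min m0 ltr01.
have [A HA] : exists A : R, forall n, cabs (psi_seq n.+1 (1 : R[i])) <= A.
  have /cvg_ex[l /cvg_cabs hl] := @psi_seq1_cvg R.
  have /cvg_seq_bounded : cvgn (fun n => cabs (psi_seq n.+1 (1 : R[i]))).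
    by apply/cvg_ex; exists (cabs l).
  move=> [A [_ /(_ (`|A| + 1))]]; rewrite (le_lt_trans (ler_norm _)) ?ltrDl// => /(_ isT) B.
  exists (`|A| + 1) => n; have := B n I; rewrite /=.
  by apply: le_trans; rewrite ler_norm.
pose S := limn (series (fun k => (Num.min m' 1) ^- 2 * qterm k)).
have q0 k : 0 <= (Num.min m' 1) ^- 2 * qterm k :> R.
  by rewrite mulr_ge0 ?qterm_ge0// invr_ge0 sqr_ge0.
have S0 : 0 <= S.
  by apply: limr_ge; [exact: cvg_series_qtermZ|apply: nearW => n; rewrite sumr_ge0].
exists (`|A| + (`|M| + 1) * S); first by rewrite addr_ge0// mulr_ge0// addr_ge0.
move=> n w mw wM; have w0 : 0 < Re w by exact: lt_le_trans mw.
rewrite -(subrK (psi_seq n.+1 1) (psi_seq n.+1 w)) psi_seqB ?Re1_gt0// addrC.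
rewrite (le_trans (ler_cabsD _ _))// lerD//.
  by rewrite (le_trans (HA n))// ler_norm.
rewrite cabsM ler_pM ?cabs_ge0//.
  by rewrite (le_trans (ler_cabsB _ _))// cabs1 lerD2r (le_trans wM)// ler_norm.
have Sle := series_le_lim n.+2 q0 (cvg_series_qtermZ _).
rewrite (le_trans _ Sle)// (le_trans (ler_cabs_sum _ _ _))// ler_sum// => k _.
have q01 : 0 <= (1 : R) <= 1 by rewrite lexx ler01.
apply: dgterm_le => //; first by rewrite (le_trans _ mw)// ge_min lexx.
by rewrite ge_min lexx orbT.
Qed.

Lemma dpsi_seq_bound (m : R) : 0 < m -> exists2 B : R, 0 <= B &
  forall n w, m <= Re w ->
    cabs (\sum_(0 <= k < n.+1) (w + k%:R) ^- 2) <= B.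
Proof.
move=> m0; pose S := limn (series (fun k => (Num.min m 1) ^- 2 * qterm k)).
have q0 k : 0 <= (Num.min m 1) ^- 2 * qterm k :> R.
  by rewrite mulr_ge0 ?qterm_ge0// invr_ge0 sqr_ge0.
exists S.
  by apply: limr_ge; [exact: cvg_series_qtermZ|apply: nearW => n; rewrite sumr_ge0].
move=> n w mw; have Sle := series_le_lim n.+1 q0 (cvg_series_qtermZ _).
rewrite (le_trans _ Sle)// (le_trans (ler_cabs_sum _ _ _))// ler_sum// => k _.
have q01 : 0 <= (1 : R) <= 1 by rewrite lexx ler01.
have := dgterm_le k q01 m0 mw mw.
by rewrite /dgterm expr1n rmorph1 mul1r -expr2.
Qed.

(** Gauss's products are differentiated under the limit by [cder_limit]; the three uniform bounds
    above control their second derivatives on the disc of radius Re z / 2. *)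
Lemma cder_Gamma z : 0 < Re z -> cder (@Gamma R) z (Gamma z * psi z).
Proof.
move=> z0; pose r := Re z / 2.
have r0 : 0 < r by rewrite divr_gt0.
have zr : Re z = r + r by rewrite -mulr2n -mulr_natr divfK.
have inr w : cabs (w - z) < r -> r <= Re w <= 3 * r.
  move=> /(le_lt_trans (ler_cabs_Re _)); rewrite cReD cReN ltr_norml zr.
  by move=> /andP[? ?]; apply/andP; split; lra.
have inr0 w : cabs (w - z) < r -> 0 < Re w.
  by move=> /inr/andP[+ _]; exact: lt_le_trans.
have inM w : cabs (w - z) < r -> cabs w <= cabs z + r.
  by move=> /ltW wr; rewrite -(subrK z w) addrC (le_trans (ler_cabsD _ _))// lerD2l.
have [B1 B10 H1] := gauss_Gamma_bound (3 * r) r0.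
have [B2 B20 H2] := psi_seq_bound (cabs z + r) r0.
have [B3 B30 H3] := dpsi_seq_bound r0.
(* The parenthesis bounds the second derivative G psi' + psi (G psi); the 2 comes from the mean
   value estimate. *)
pose K := 2 * (B1 * B3 + B2 * (B1 * B2)).
have K0 : 0 <= K by rewrite mulr_ge0// addr_ge0// !mulr_ge0.
have zz : cabs (z - z) < r by rewrite subrr cabs0.
have [] := @cder_limit R (fun n => gauss_Gamma n.+1)
  (fun n w => gauss_Gamma n.+1 w * psi_seq n.+1 w) (@Gamma R)
  (fun w => Gamma w * psi w) z r K K0.
- by move=> n w wr; apply: cder_gauss_Gamma; exact: inr0.
- move=> n w1 w2 w1r w2r.
  pose dG w := gauss_Gamma n.+1 w * (\sum_(0 <= k < n.+2) (w + k%:R) ^- 2) +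
    psi_seq n.+1 w * (gauss_Gamma n.+1 w * psi_seq n.+1 w).
  have hd w : cabs (w - z) < r ->
      cder (fun w : R[i] => gauss_Gamma n.+1 w * psi_seq n.+1 w) w (dG w).
    move=> wr; have w0 := inr0 _ wr.
    exact: (cderM (cder_gauss_Gamma _ w0) (cder_psi_seq _ w0)).
  have hb w : cabs (w - z) < r -> cabs (dG w - 0) <= B1 * B3 + B2 * (B1 * B2).
    move=> wr; rewrite subr0 (le_trans (ler_cabsD _ _))//.
    rewrite (cabsM (gauss_Gamma _ _)) (cabsM (psi_seq _ _)) (cabsM (gauss_Gamma _ _)).
    have g1 := H1 n _ (inr _ wr); have /andP[wr' _] := inr _ wr.
    have g2 := H2 n _ wr' (inM _ wr); have g3 := H3 n.+1 _ wr'.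
    apply: lerD; first by apply: ler_pM; rewrite ?cabs_ge0.
    apply: ler_pM; rewrite ?mulr_ge0 ?cabs_ge0//.
    by apply: ler_pM; rewrite ?cabs_ge0.
  have := cder_mean_value hd hb w2r w1r.
  by rewrite mul0r subr0.
- by move=> w /inr0; exact: Gamma_cvg.
- move=> w /inr0 w0; exact: (ccvgM (Gamma_cvg w0) (psi_cvg w0)).
by move=> h _; exact: h.
Qed.

(** From |s + k + i y|^2 = (s+k)^2 (1 + y^2/(s+k)^2) and 1 + u <= e^u. The exponents are summable in
    k, so the corrections have a bounded product. *)
Lemma cabs_addn_le (s y : R) k : 0 < s ->
  cabs ((s +i* y) + k%:R) <= (s + k%:R) * expR (y ^+ 2 * ((Num.min s 1) ^- 2 * qterm k)).
Proof.
move=> s0; have sk : 0 < s + k%:R by rewrite ltr_wpDr.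
set E := expR _; have q01 : 0 <= (1 : R) <= 1 by rewrite lexx ler01.
have := @dgterm_le R 1 s s%:C s%:C k q01 s0 (lexx _) (lexx _).
rewrite /dgterm expr1n rmorph1 mul1r cabsV -(rmorph_nat (real_complex R)) -rmorphD -rmorphM.
rewrite cabs_real gtr0_norm ?mulr_gt0// -expr2 => h.
rewrite -(@ler_pXn2r _ 2) ?nnegrE ?cabs_ge0 ?mulr_ge0 ?expR_ge0 ?(ltW sk)//.
rewrite cabs_sqr cReD cImD /= addr0 exprMn.
have E1 : 1 + y ^+ 2 / (s + k%:R) ^+ 2 <= E.
  rewrite (le_trans _ (expR_ge1Dx _))// lerD2l ler_wpM2l ?sqr_ge0//.
have E11 : 1 <= E.
  by rewrite (le_trans _ E1)// lerDl mulr_ge0 ?sqr_ge0// invr_ge0 sqr_ge0.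
have E2 : 1 + y ^+ 2 / (s + k%:R) ^+ 2 <= E ^+ 2.
  by rewrite (le_trans E1)// expr2 ler_peMr// (le_trans ler01).
rewrite (le_trans _ (ler_wpM2l (sqr_ge0 _) E2))//.
by rewrite mulrDr mulr1 mulrCA mulfV ?mulr1// sqrf_eq0 gt_eqF.
Qed.

(** The Gauss products at s + i y and at s are compared: the quotient of their moduli stays above
    [L] > 0 for every n, and Gamma is positive at s by Euler's integral. *)
Lemma Gamma_neq0 z : 0 < Re z -> Gamma z != 0.
Proof.
case: z => s y /= s0; pose c (k : nat) := (Num.min s 1) ^- 2 * qterm k.
have c0 k : 0 <= c k by rewrite mulr_ge0 ?qterm_ge0// invr_ge0 sqr_ge0.
pose L := expR (- (y ^+ 2 * limn (series c))).
have key n : cabs (gauss_Gamma n.+1 s%:C) * L <= cabs (gauss_Gamma n.+1 (s +i* y)).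
  rewrite /gauss_Gamma !cabs_div ![cabs (cpow _ _ * _)]cabsM ![cabs (cpow _ _)]cabs_cexp.
  rewrite [_%:C * _]mulrC [(s +i* y) * _]mulrC !cReMr/= -!mulrA.
  rewrite ler_wpM2l ?expR_ge0// ler_wpM2l ?cabs_ge0//.
  have -> : cabs (\prod_(0 <= k < n.+2) (s%:C + k%:R)) = \prod_(0 <= k < n.+2) (s + k%:R).
    rewrite cabs_prod; apply: eq_bigr => k _.
    by rewrite -(rmorph_nat (real_complex R)) -rmorphD cabs_real gtr0_norm// ltr_wpDr.
  have P0 : 0 < \prod_(0 <= k < n.+2) (s + k%:R).
    by apply: prodr_gt0 => k _; rewrite ltr_wpDr.
  have Q0 : 0 < cabs (\prod_(0 <= k < n.+2) ((s +i* y) + k%:R)).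
    by rewrite cabs_gt0; apply: prod_addn_neq0.
  rewrite /L expRN -invfM lef_pV2 ?posrE ?mulr_gt0 ?expR_gt0//.
  rewrite cabs_prod (le_trans (ler_prod (E2 := fun k => (s + k%:R) * expR (y ^+ 2 * c k)) _ _))//.
    by move=> k _; rewrite cabs_ge0/= cabs_addn_le.
  rewrite big_split/= ler_wpM2l ?(ltW P0)// -expR_sum ler_expR -mulr_sumr.
  rewrite ler_wpM2l ?sqr_ge0//; apply: series_le_lim => //.
  exact: cvg_series_qtermZ.
rewrite -cabs_gt0; apply: (@lt_le_trans _ _ (cabs (Gamma s%:C) * L)).
  rewrite mulr_gt0 ?expR_gt0// cabs_gt0.
  by apply: contraTneq (Re_Gamma_gt0 s0) => ->; rewrite ltxx.
have h1 : cabs (gauss_Gamma n.+1 s%:C) * L @[n --> \oo] --> cabs (Gamma s%:C) * L.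
  by apply: cvgM; [apply: cvg_cabs; exact: Gamma_cvg|exact: cvg_cst].
have h2 : cabs (gauss_Gamma n.+1 (s +i* y)) @[n --> \oo] --> cabs (Gamma (s +i* y)).
  by apply: cvg_cabs; exact: Gamma_cvg.
have c1 : cvgn (fun n => cabs (gauss_Gamma n.+1 s%:C) * L) by apply/cvg_ex; eexists; exact: h1.
have c2 : cvgn (fun n => cabs (gauss_Gamma n.+1 (s +i* y))) by apply/cvg_ex; eexists; exact: h2.
rewrite -(cvg_lim (@Rhausdorff R) h1) -(cvg_lim (@Rhausdorff R) h2).
by apply: ler_lim => //; apply: nearW => n; exact: key.
Qed.

Lemma logderiv_Gamma z : 0 < Re z -> logderiv (@Gamma R) z = psi z.
Proof.
move=> z0; rewrite /logderiv (derive1_cder (cder_Gamma z0)).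
by rewrite mulrC mulKf// Gamma_neq0.
Qed.

End GammaDerivative.

(** * The theta identity *)

Section RealLimits.
Context {R : realType}.
Implicit Types x y : R.

Lemma expR_cvg (u : R^nat) (l : R) : u @ \oo --> l -> (fun n => expR (u n)) @ \oo --> expR l.
Proof. by move=> ul; apply: continuous_cvg => //; exact: continuous_expR. Qed.

Lemma sin_bounds x : 0 <= x <= pi -> x * cos x <= sin x <= x.
Proof.
move=> /andP[x0 xpi].
have h1 (y : R) : (y \in `]0, x[)%R -> is_derive y 1 sin (cos y) by move=> _; exact: is_derive_sin.
have h2 : {within `[0, x], continuous (@sin R)}.
  by apply: continuous_subspaceT => y; exact: continuous_sin.
have [c cx] := MVT_segment x0 h1 h2.
rewrite sin0 !subr0 => ->; move: cx; rewrite in_itv/= => /andP[c0 cx].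
have -> : x * cos x <= cos c * x.
  rewrite [leRHS]mulrC ler_wpM2l//; move: cx; rewrite le_eqVlt => /predU1P[->//|cx].
  by rewrite ltW// ltr_cos ?in_itv/= ?c0 ?x0//= (le_trans (ltW cx)).
by rewrite -[leRHS]mul1r ler_wpM2r// cos_le1.
Qed.

(** With x = y/2, sin x >= x cos x gives x^2 cos^2 x <= 1 - cos^2 x. As cos y >= 0 means 2 cos^2 x
    >= 1, it follows that x^2 <= 2 - 2 cos^2 x = 1 - cos y. *)
Lemma cos_le_quad y : 0 <= y <= pi / 2 -> cos y <= 1 - y ^+ 2 / 4.
Proof.
move=> /andP[y0 ypi]; pose x : R := y / 2.
have yx : y = x *+ 2 by rewrite -mulr_natr divfK.
have x0 : 0 <= x by rewrite divr_ge0.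
have xpi : 0 <= x <= pi by rewrite x0/=; have := pi_gt0 R; rewrite /x; lra.
have /andP[sx _] := sin_bounds xpi.
have c2 : cos y = cos x ^+ 2 *+ 2 - 1 by rewrite yx cos_mulr2n.
have cy0 : 0 <= cos y.
  by apply: cos_ge0_pihalf; rewrite ypi andbT (le_trans _ y0)// oppr_le0 divr_ge0// pi_ge0.
have cx0 : 0 <= cos x.
  by apply: cos_ge0_pihalf; apply/andP; split; have := pi_gt0 R; rewrite /x; lra.
have s2 := cos2Dsin2 x.
have h : x ^+ 2 * cos x ^+ 2 <= sin x ^+ 2.
  rewrite -exprMn ler_pXn2r// ?nnegrE ?mulr_ge0//.
  by apply: le_trans sx; rewrite mulr_ge0.
move: c2; rewrite mulr2n => c2.
have -> : y ^+ 2 = 4 * x ^+ 2 by rewrite yx; ring.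
by have := sqr_ge0 x; nra.
Qed.

Lemma one_sub_ge y : 0 <= y < 1 -> expR (- (y / (1 - y))) <= 1 - y.
Proof.
move=> /andP[y0 y1]; have y1' : 0 < 1 - y by rewrite subr_gt0.
rewrite expRN -[leRHS]invrK lef_pV2 ?posrE ?expR_gt0 ?invr_gt0//.
rewrite (le_trans _ (expR_ge1Dx _))// le_eqVlt; apply/orP; left; apply/eqP.
by field; rewrite gt_eqF.
Qed.

(** Squeezed between the powers of e^(-a/(1-a)) and of e^(-a). *)
Lemma one_sub_pow_cvg (a : R^nat) (m : nat -> nat) (s : R) :
  (forall n, 0 <= a n) -> a @ \oo --> 0 -> (fun n => (m n)%:R * a n) @ \oo --> s ->
  (fun n => (1 - a n) ^+ m n) @ \oo --> expR (- s).
Proof.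
move=> a0 ac mc.
have mc' : (fun n => expR (- ((m n)%:R * a n / (1 - a n)))) @ \oo --> expR (- s).
  apply: expR_cvg; apply: cvgN; rewrite -[X in _ --> X]divr1; apply: cvgM => //.
  apply: cvgV; first exact: oner_neq0.
  by rewrite -[X in _ --> X]subr0; apply: cvgB => //; exact: cvg_cst.
apply: (squeeze_cvgr _ mc'); last by apply: expR_cvg; exact: cvgN mc.
near=> n.
have an : a n < 1 by near: n; apply: (cvgr_lt 0) => //; exact: ltr01.
have p0 : 0 <= 1 - a n by rewrite subr_ge0 ltW.
have -> : expR (- ((m n)%:R * a n / (1 - a n))) = expR (- (a n / (1 - a n))) ^+ m n.
  by rewrite -expRM_natl mulrN mulrA.
rewrite [X in _ <= _ <= X](_ : _ = expR (- a n) ^+ m n); last by rewrite -expRM_natl mulrN.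
apply/andP; split; apply: lerXn2r; rewrite ?nnegrE ?expR_ge0//.
  by rewrite one_sub_ge// a0.
exact: expR_ge1Dx.
Unshelve. all: by end_near. Qed.

(** The even exponent allows cos^2 = 1 - sin^2, which reduces the limit to the preceding one; y cos
    y <= sin y <= y then replaces the sine by y. *)
Lemma cos_pow_cvg (y : R^nat) (m : nat -> nat) (s : R) :
  (forall n, 0 <= y n) -> y @ \oo --> 0 -> (fun n => (m n)%:R * y n ^+ 2) @ \oo --> s ->
  (fun n => cos (y n) ^+ (2 * m n)) @ \oo --> expR (- s).
Proof.
move=> y0 yc mc.
have -> : (fun n => cos (y n) ^+ (2 * m n)) = (fun n => (1 - sin (y n) ^+ 2) ^+ m n).
  by apply/funext => n; rewrite exprM -(cos2Dsin2 (y n)) addrK.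
have c1 : (fun n => cos (y n)) @ \oo --> (1 : R).
  by rewrite -(cos0 R); apply: continuous_cvg => //; exact: continuous_cos.
have s1 : (fun n => sin (y n)) @ \oo --> (0 : R).
  by rewrite -(sin0 R); apply: continuous_cvg => //; exact: continuous_sin.
apply: one_sub_pow_cvg.
- by move=> n; exact: sqr_ge0.
- by rewrite -[X in _ --> X](mulr0 0); exact: (cvgM s1 s1).
have mc' : (fun n => (m n)%:R * y n ^+ 2 * cos (y n) ^+ 2) @ \oo --> s.
  by rewrite -[s]mulr1 -[X in _ * X](mulr1 1); apply: cvgM => //; apply: cvgM.
apply: (squeeze_cvgr _ mc' mc); near=> n.
have yp : y n <= pi / 2.
  by apply/ltW; near: n; apply: (cvgr_lt 0) => //; rewrite divr_gt0// pi_gt0.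
have yp' : 0 <= y n <= pi by rewrite y0/=; have := pi_gt0 R; lra.
have cy : 0 <= cos (y n).
  by apply: cos_ge0_pihalf; rewrite yp andbT (le_trans _ (y0 n))// oppr_le0 divr_ge0// pi_ge0.
have /andP[h1 h2] := sin_bounds yp'.
have h0 : 0 <= sin (y n) by apply: le_trans h1; rewrite mulr_ge0.
rewrite -mulrA -exprMn; apply/andP; split; rewrite ler_wpM2l// ler_pXn2r// nnegrE// mulr_ge0//.
Unshelve. all: by end_near. Qed.

End RealLimits.

(** * Gaussian estimates for binomial coefficients *)

Section CentralBinomial.
Context {R : realType}.

Definition binratio (m k : nat) : R := 'C(2 * m, m + k)%:R / 'C(2 * m, m)%:R.
Definition cbin (m : nat) : R := 'C(2 * m, m)%:R / 4 ^+ m.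

Lemma bin_mid_gt0 m : (0 : R) < 'C(2 * m, m)%:R.
Proof. by rewrite ltr0n bin_gt0 leq_pmull. Qed.

Lemma binratio_ge0 m k : 0 <= binratio m k.
Proof. by rewrite divr_ge0. Qed.

Lemma binratio0 m : binratio m 0 = 1.
Proof. by rewrite /binratio addn0 mulfV// gt_eqF// bin_mid_gt0. Qed.

Lemma binratio_eq0 m k : (m < k)%N -> binratio m k = 0.
Proof. by move=> mk; rewrite /binratio bin_small ?mul0r// mul2n -addnn ltn_add2l. Qed.

Lemma binratioS m k : (k <= m)%N ->
  binratio m k.+1 = binratio m k * ((m%:R - k%:R) / (m + k.+1)%:R).
Proof.
move=> km; rewrite /binratio [RHS]mulrAC; congr (_ / _).
have nz : ((m + k.+1)%:R : R) != 0 by rewrite pnatr_eq0 addnS.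
apply: (mulIf nz); rewrite -[in RHS]mulrA divfK// -natrB// -!natrM; congr (_%:R).
rewrite addnS mulnC mul_bin_left mulnC; congr (_ * _)%N; lia.
Qed.

(** The quotient of successive ratios is 1 - (2k+1)/(m+k+1), at most e^(-(2k+1)/(m+K)); the odd
    numbers add up to the square. *)
Lemma binratio_le m k K : (k <= K)%N -> (K <= m)%N -> (0 < m)%N ->
  binratio m k <= expR (- (k%:R ^+ 2 / (m + K)%:R)).
Proof.
move=> + Km m0; elim: k => [|k IH] kK.
  by rewrite binratio0 expr0n mul0r oppr0 expR0.
have km : (k < m)%N by exact: leq_trans Km.
rewrite binratioS ?(ltnW km)//.
have -> : - (k.+1%:R ^+ 2 / (m + K)%:R) =
    - (k%:R ^+ 2 / (m + K)%:R) + - ((2 * k%:R + 1) / (m + K)%:R) :> R.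
  by rewrite -opprD -mulrDl; congr (- (_ / _)); rewrite -natr1; ring.
have mk0 : (0 : R) < (m + k.+1)%:R by rewrite ltr0n addnS.
rewrite expRD ler_pM ?binratio_ge0 ?IH ?(ltnW kK)//.
  by rewrite divr_ge0 ?subr_ge0 ?ler_nat// (ltnW km).
rewrite [leLHS](_ : _ = 1 - (2 * k%:R + 1) / (m + k.+1)%:R); last first.
  rewrite -[X in _ = X - _](mulfV (x := (m + k.+1)%:R)) ?gt_eqF// -mulrBl.
  by congr (_ / _); rewrite addnS -natr1 natrD; ring.
rewrite (le_trans (expR_ge1Dx _))// ler_expR lerN2 ler_wpM2l ?addr_ge0 ?mulr_ge0//.
by rewrite lef_pV2 ?posrE ?ler_nat ?leq_add2l// ltr0n addn_gt0 m0.
Qed.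

(** Same summation of odd numbers, with the inverse quotient 1 + (2k+1)/(m-k), at most
    e^((2k+1)/(m-K)). *)
Lemma binratio_ge m k K : (k <= K)%N -> (K < m)%N ->
  expR (- (k%:R ^+ 2 / (m - K)%:R)) <= binratio m k.
Proof.
move=> + Km; elim: k => [|k IH] kK.
  by rewrite binratio0 expr0n mul0r oppr0 expR0.
have km : (k < m)%N by lia.
rewrite binratioS ?(ltnW km)//.
have -> : - (k.+1%:R ^+ 2 / (m - K)%:R) =
    - (k%:R ^+ 2 / (m - K)%:R) + - ((2 * k%:R + 1) / (m - K)%:R) :> R.
  by rewrite -opprD -mulrDl; congr (- (_ / _)); rewrite -natr1; ring.
have mk0 : (0 : R) < (m + k.+1)%:R by rewrite ltr0n addnS.
rewrite expRD ler_pM ?expR_ge0 ?IH ?(ltnW kK)//.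
rewrite expRN -[leRHS]invrK invf_div -natrB ?(ltnW km)//.
have d0 : (0 : R) < (m - k)%:R by rewrite ltr0n subn_gt0.
have D0 : (0 : R) < (m - K)%:R by rewrite ltr0n subn_gt0.
rewrite lef_pV2 ?posrE ?expR_gt0 ?divr_gt0//.
rewrite (_ : _ / (m - k)%:R = 1 + (2 * k%:R + 1) / (m - k)%:R :> R); last first.
  rewrite -[X in _ = X + _](mulfV (x := (m - k)%:R)) ?gt_eqF// -mulrDl.
  by congr (_ / _); rewrite addnS -natr1 natrD natrB ?(ltnW km)//; ring.
rewrite (le_trans (expR_ge1Dx _))// ler_expR ler_wpM2l ?addr_ge0 ?mulr_ge0//.
by rewrite lef_pV2 ?posrE// ler_nat leq_sub2l// ltnW.
Qed.

Lemma binratio_gauss m k : (0 < m)%N ->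
  binratio m k <= expR (- (k%:R ^+ 2 / (2 * m%:R))).
Proof.
move=> m0; have [km|mk] := leqP k m; last by rewrite binratio_eq0 ?expR_ge0.
rewrite (le_trans (binratio_le km (leqnn m) m0))//.
by rewrite natrD mulr_natl mulr2n.
Qed.

Lemma cbinS m : cbin m.+1 = cbin m * ((2 * m%:R + 1) / (2 * m%:R + 2)).
Proof.
have h1 : (m.+1 * 'C(2 * m.+1, m.+1) = 2 * m.+1 * 'C(2 * m + 1, m))%N.
  by rewrite -mul_bin_diag; congr (_ * 'C(_, _))%N; lia.
have h2 : (m.+1 * 'C(2 * m + 1, m) = (2 * m + 1) * 'C(2 * m, m))%N.
  rewrite -[in LHS]bin_sub; last by lia.
  rewrite (_ : 2 * m + 1 - m = m.+1)%N; last by lia.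
  by rewrite -mul_bin_diag; congr (_ * 'C(_, _))%N; lia.
have h3 : ('C(2 * m.+1, m.+1) * m.+1 = 2 * (2 * m + 1) * 'C(2 * m, m))%N.
  by rewrite -mulnA -h2 mulnC h1; lia.
rewrite /cbin; have /(congr1 (fun k => k%:R : R)) := h3.
rewrite !natrM natrD -[m.+1%:R]natr1 => h4.
have p1 : (m%:R + 1 : R) != 0 by rewrite natr1 pnatr_eq0.
have p2 : (2 * m%:R + 2 : R) != 0 by rewrite (_ : _ + _ = 2 * (m%:R + 1)) ?mulf_neq0//; ring.
have p3 : (4 ^+ m : R) != 0 by rewrite expf_neq0.
apply: (mulIf p1); rewrite mulrAC h4 exprS natrM.
by field; rewrite p2 p3.
Qed.

(** Wallis's limit, as existence only: m c_m^2 increases, while (m+1) c_m^2 decreases from 1 and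
    bounds it. The value 1/pi comes out of the theta identity itself. *)
Lemma cvg_cbin : cvgn (fun m => m%:R * cbin m ^+ 2).
Proof.
apply: nondecreasing_is_cvgn.
  apply/nondecreasing_seqP => m; rewrite /= cbinS; move: (cbin m) => c.
  have m0 : (0 : R) <= m%:R by [].
  rewrite exprMn [leRHS]mulrCA [leLHS]mulrC ler_wpM2l ?sqr_ge0//.
  have d0 : (0 : R) < (2 * m%:R + 2) ^+ 2 by rewrite exprn_gt0//; lra.
  by rewrite expr_div_n mulrA ler_pdivlMr// -natr1; nra.
exists 1 => _ [m _ <-]; apply: (@le_trans _ _ ((m%:R + 1) * cbin m ^+ 2)).
  by rewrite ler_wpM2r ?sqr_ge0// lerDl.
elim: m => [|m IH]; first by rewrite /cbin muln0 bin0 expr0 divr1 expr1n add0r mulr1.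
apply: le_trans IH; rewrite cbinS; move: (cbin m) => c.
have m0 : (0 : R) <= m%:R by [].
rewrite exprMn [leLHS]mulrCA [leRHS]mulrC ler_wpM2l ?sqr_ge0//.
have d0 : (0 : R) < (2 * m%:R + 2) ^+ 2 by rewrite exprn_gt0//; lra.
by rewrite expr_div_n mulrA ler_pdivrMr// -natr1; nra.
Qed.

End CentralBinomial.

(** * The finite identity behind the theta identity *)

Section PolyaIdentity.
Context {R : realType}.
Implicit Types (l m n p M : nat).

Lemma sum_multiples (V : nmodType) (F : nat -> V) l N : (0 < l)%N ->
  \sum_(0 <= j < l * N | (l %| j)%N) F j = \sum_(0 <= i < N) F (l * i)%N.
Proof.
move=> l0; elim: N => [|N IH]; first by rewrite muln0 !big_geq.
have h : (l * N < l * N.+1)%N by rewrite ltn_pmul2l.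
rewrite big_nat_recr//= -IH (@big_cat_nat _ _ _ (l * N))//=; last exact: ltnW.
congr (_ + _); rewrite big_ltn_cond// dvdn_mulr// big_nat_cond big1 ?addr0//.
move=> j /andP[/andP[h1 h2] /dvdnP[q qE]]; exfalso; move: h1 h2.
by rewrite qE (mulnC q) !ltn_pmul2l// ltnS => Nq qN; rewrite leqNgt Nq in qN.
Qed.

Lemma sum_fold_ends (F : nat -> R) p :
  (forall k, (k < p)%N -> F (2 * p - k)%N = F k.+1) ->
  \sum_(0 <= k < (2 * p).+1) F k = F 0%N + 2 * \sum_(0 <= k < p) F k.+1.
Proof.
move=> Fsym; rewrite big_nat_recl// (@big_cat_nat _ _ _ p)//=; last lia.
rewrite mulr_natl mulr2n; congr (_ + (_ + _)).
rewrite -{1}[p]add0n big_addn (_ : (2 * p - p = p)%N); last lia.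
rewrite big_nat_rev/=; apply: eq_big_nat => k /andP[_ kp].
by rewrite -[RHS]Fsym//; congr (F _); lia.
Qed.

Lemma sum_fold_middle (F : nat -> R) M :
  (forall k, (k < M)%N -> F k = F (2 * M - k)%N) ->
  \sum_(0 <= k < (2 * M).+1) F k = F M + 2 * \sum_(0 <= k < M) F (M + k.+1)%N.
Proof.
move=> Fsym; rewrite (@big_cat_nat _ _ _ M)//=; last lia.
rewrite (@big_ltn _ _ _ M); last lia.
rewrite addrCA mulr_natl mulr2n; congr (_ + (_ + _)).
  rewrite big_nat_rev/=; apply: eq_big_nat => k /andP[_ kp].
  by rewrite Fsym; [congr (F _)|]; lia.
rewrite -{1}[M.+1]add0n big_addn (_ : ((2 * M).+1 - M.+1 = M)%N); last lia.
by apply: eq_big_nat => k _; congr (F _); lia.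
Qed.

Lemma cexp_i (x : R) : cexp ('i%C * x%:C) = cos x +i* sin x.
Proof. by rewrite /cexp; simpc; rewrite expR0; simpc. Qed.

(** If the order d were smaller than l, then y = pi d / l would lie in ]0, pi[ with cos(2y) = 1,
    although sin y > 0. *)
Lemma unity_root_exists l : (0 < l)%N ->
  l.-primitive_root (cexp ('i%C * (2 * pi / l%:R)%:C) : R[i]).
Proof.
move=> l0; set w := cexp _; have lR : (0 : R) < l%:R by rewrite ltr0n.
have wk k : w ^+ k = cos (2 * pi / l%:R * k%:R) +i* sin (2 * pi / l%:R * k%:R).
  rewrite -cexpM_natl mulrCA -cexp_i; congr cexp; congr (_ * _).
  by rewrite -(rmorph_nat (real_complex R)) -rmorphM mulrC.
have wl : w ^+ l = 1.
  by rewrite wk divfK ?gt_eqF// mulr_natl cos2pi sin2pi.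
have [d dw dl] := prim_order_exists l0 wl.
case: (eqVneq d l) dw => [-> //|dnl] dw.
have d0 := prim_order_gt0 dw; have := prim_expr_order dw.
have ltdl : (d < l)%N by rewrite ltn_neqAle dnl dvdn_leq.
rewrite wk => /(congr1 (@complex.Re R))/= c1; exfalso.
pose y : R := pi / l%:R * d%:R.
have s0 : 0 < sin y.
  apply: sin_gt0_pi; rewrite /y; have pi0 := pi_gt0 R; apply/andP; split.
    by rewrite mulr_gt0 ?divr_gt0// ltr0n.
  by rewrite mulrAC ltr_pdivrMr// ltr_pM2l// ltr_nat.
move: c1; rewrite (_ : 2 * pi / _ * _ = y *+ 2); last by rewrite -mulr_natl /y; ring.
rewrite cos_mulr2n mulr2n => c1; have := cos2Dsin2 y.
by nra.
Qed.

Lemma sum_unity_root_pow (w : R[i]) l j : l.-primitive_root w ->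
  \sum_(0 <= k < l) w ^+ (j * k) = if (l %| j)%N then l%:R else 0.
Proof.
move=> wp; have wj : (l %| j)%N = (w ^+ j == 1) := prim_order_dvd wp j.
under eq_bigr do rewrite exprM.
rewrite wj; case: eqVneq => [->|wj1].
  by under eq_bigr do rewrite expr1n; rewrite big_const_nat subn0 iter_addr_0.
have := subrX1 (w ^+ j) l; rewrite -exprM mulnC exprM (prim_expr_order wp) expr1n subrr.
move=> /esym/eqP; rewrite mulf_eq0 subr_eq0 => /orP[/eqP wj2|/eqP]; first by rewrite wj2 eqxx in wj1.
by rewrite -(big_mkord xpredT).
Qed.

(* Both sides are sum_(k < l) (1 + w^k)^(2 l M) / 4^(l M), with w = exp(2 pi i / l):
   the binomial formula keeps the C(2 l M, l i), and each 1 + w^k is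
   2 cos(pi k / l) up to a phase killed by the exponent. *)
Lemma polya_identity p M : let l := (2 * p).+1 in let m := (l * M)%N in
  1 + 2 * \sum_(0 <= k < p) cos (pi * k.+1%:R / l%:R) ^+ (2 * m) =
  l%:R * cbin m * (1 + 2 * \sum_(0 <= k < M) binratio m (l * k.+1)) :> R.
Proof.
move=> l m; have l0 : (0 < l)%N by [].
have lR : (l%:R : R) != 0 by rewrite pnatr_eq0.
have wp := unity_root_exists l0; set w := cexp _ in wp.
have e1 k : (1 + w ^+ k) ^+ (2 * m) = (4 ^+ m * cos (pi * k%:R / l%:R) ^+ (2 * m))%:C.
  pose y : R := pi * k%:R / l%:R; pose e : R[i] := cos y +i* sin y.
  have e2 : e ^+ 2 = w ^+ k.
    rewrite /e -cexp_i -!cexpM_natl; congr cexp; rewrite !(mulrCA _ 'i%C); congr (_ * _).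
    rewrite -!(rmorph_nat (real_complex R)) -!rmorphM; congr (_%:C).
    by rewrite /y; ring.
  (* With w^k = e^2 and |e| = 1: 1 + e^2 = e (e + conj e). *)
  have -> : 1 + w ^+ k = e * (2 * cos y)%:C.
    rewrite -e2 /e; have := cos2Dsin2 y => cs.
    by apply: complex_ext; rewrite /= !(expr2, mulr2n)/=; nra.
  rewrite exprMn exprM e2 -exprM /m mulnCA exprM (prim_expr_order wp) expr1n mul1r.
  rewrite -rmorphXn/= exprMn; congr (_ * _)%:C; rewrite exprM; congr (_ ^+ _); ring.
have e3 : \sum_(0 <= k < l) (1 + w ^+ k) ^+ (2 * m) =
    l%:R * \sum_(0 <= i < (2 * M).+1) 'C(2 * m, l * i)%:R.
  transitivity (\sum_(0 <= k < l) \sum_(0 <= j < (2 * m).+1) w ^+ (j * k) * 'C(2 * m, j)%:R).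
    apply: eq_bigr => k _; rewrite exprDn big_mkord; apply: eq_bigr => j _.
    by rewrite expr1n mul1r -exprM mulnC mulr_natr.
  rewrite exchange_big/=; under eq_bigr do rewrite -mulr_suml (sum_unity_root_pow _ wp).
  rewrite -(sum_multiples (fun j => 'C(2 * m, j)%:R) _ l0) mulr_sumr.
  (* The 2 M + 1 multiples of l occupy a range of length l (2 M + 1), which exceeds 2 m + 1 in
     general; the binomial coefficients beyond 2 m are 0. *)
  rewrite [RHS](@big_cat_nat _ _ _ (2 * m).+1)//=; last by rewrite /m mulnS; lia.
  rewrite [X in _ = _ + X]big_nat_cond [X in _ = _ + X]big1 ?addr0; last first.
    by move=> j /andP[/andP[mj _] _]; rewrite bin_small// mulr0.
  rewrite [RHS]big_mkcond; apply: eq_bigr => j _.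
  by case: ifP; rewrite ?mul0r.
have e4 : \sum_(0 <= k < l) 4 ^+ m * cos (pi * k%:R / l%:R) ^+ (2 * m) =
    l%:R * \sum_(0 <= i < (2 * M).+1) 'C(2 * m, l * i)%:R :> R.
  apply: (@complexI R); rewrite rmorph_sum rmorphM rmorph_sum rmorph_nat.
  under [in RHS]eq_bigr do rewrite rmorph_nat.
  by rewrite -e3; apply: eq_bigr => k _; rewrite e1.
move: e4; rewrite -mulr_sumr sum_fold_ends; last first.
  move=> k kp; rewrite (_ : pi * _ / _ = pi + - (pi * k.+1%:R / l%:R)).
    by rewrite cosD sinpi mul0r subr0 cospi mulN1r cosN !exprM sqrrN.
  have -> : (2 * p - k)%:R = l%:R - k.+1%:R :> R by rewrite -natrB; [congr (_%:R)|]; lia.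
  by field.
rewrite sum_fold_middle; last first.
  move=> k kM; rewrite -[in LHS]bin_sub; last by rewrite /m; nia.
  by congr ('C(_, _)%:R); rewrite /m mulnBr mulnCA.
rewrite mulr0 mul0r cos0 expr1n => e5.
have f0 : (4 ^+ m : R) != 0 by rewrite expf_neq0.
have b0 : ('C(2 * m, m)%:R : R) != 0 by rewrite gt_eqF// bin_mid_gt0.
apply: (mulfI f0); rewrite e5 /cbin -/m.
have -> : \sum_(0 <= k < M) binratio m (l * k.+1) =
   (\sum_(0 <= k < M) 'C(2 * m, l * (M + k.+1))%:R) / 'C(2 * m, m)%:R :> R.
  by rewrite mulr_suml; apply: eq_bigr => k _; rewrite /binratio mulnDr.
by field; rewrite f0 b0.
Qed.

End PolyaIdentity.

(** * Passage to the limit in Polya's identity *)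

Section ThetaIdentity.
Context {R : realType}.
Implicit Types (x t : R) (p : nat).

Definition gaussian (x : R) (n : nat) : R := expR (- (x * n.+1%:R ^+ 2)).
(** The sum of e^(-x n^2) over all integers n is [1 + 2 * gauss_sum x]. *)
Definition gauss_sum (x : R) : R := limn (series (gaussian x)).

Lemma gaussian_le x n : 0 <= x -> gaussian x n <= geometric (expR (- x)) (expR (- x)) n.
Proof.
move=> x0; rewrite /gaussian/= -exprS -expRM_natl ler_expR mulrN lerN2 mulrC ler_wpM2l//.
by rewrite -natrX ler_nat expnS leq_pmulr// expn_gt0.
Qed.

Lemma cvg_gaussian x : 0 < x -> cvgn (series (gaussian x)).
Proof.
move=> x0; have h : cvgn (series (geometric (expR (- x)) (expR (- x)) : R^nat)).
  by apply: is_cvg_geometric_series; rewrite ger0_norm ?expR_ge0// expR_lt1 oppr_lt0.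
apply: series_le_cvg h => n; first exact: expR_ge0.
  by rewrite mulr_ge0 ?exprn_ge0 ?expR_ge0.
exact: gaussian_le (ltW x0).
Qed.

Lemma gauss_sum_ge0 x : 0 < x -> 0 <= gauss_sum x.
Proof.
move=> x0; apply: limr_ge; first exact: cvg_gaussian.
by apply: nearW => n; rewrite sumr_ge0// => k _; exact: expR_ge0.
Qed.

(** Tannery's theorem for finite sums of growing length, extended by 0. The dominating Gaussian may
    have a parameter [y] different from that of the limit. *)
Lemma gauss_sum_cvg (u : nat -> nat -> R) (N : nat -> nat) (x y : R) : 0 < x -> 0 < y ->
  (forall p n, 0 <= u p n <= gaussian y n) ->
  (forall p n, (N p <= n)%N -> u p n = 0) ->
  (forall n, u p n @[p --> \oo] --> gaussian x n) ->
  (fun p => \sum_(0 <= n < N p) u p n) @ \oo --> gauss_sum x.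
Proof.
move=> x0 y0 ub u0 uc.
have cx := cvg_gaussian x0.
have H : \forall p \near \oo, (forall n, cabs (u p n)%:C <= gaussian y n) /\
    series (fun n => (u p n)%:C) @ \oo --> (\sum_(0 <= n < N p) u p n)%:C.
  apply: nearW => p; split=> [n|].
    by rewrite cabs_real; have /andP[a b] := ub p n; rewrite ger0_norm.
  apply: cvg_near_cst; near=> n; rewrite /series/= -rmorph_sum; congr (_%:C).
  rewrite (@big_cat_nat _ _ _ (N p))//=; last by near: n; exact: nbhs_infty_ge.
  rewrite [X in _ + X]big_nat_cond [X in _ + X]big1 ?addr0// => k /andP[/andP[+ _] _].
  exact: u0.
have [_ h] := tannery H (cvg_gaussian y0) (fun n => cvg_real_complex (uc n)).
have hE : limn (series (fun n => (gaussian x n)%:C)) = (gauss_sum x)%:C.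
  apply: ccvg_lim; rewrite (_ : series _ = fun n => (series (gaussian x) n)%:C).
    exact: cvg_real_complex.
  by apply/funext => n; rewrite /series/= rmorph_sum.
by move: h; rewrite hE => /cvg_Re.
Unshelve. all: by end_near. Qed.

Section PolyaLimit.
Context (t : R) (t0 : 0 < t).

(** With M close to l / t and m = l M, the exponents have the right limits: m (pi k / l)^2 tends to
    pi^2 k^2 / t, and (l k)^2 / m to t k^2. The odd l lets the reflection k -> l - k pair the
    nonzero residues; rounding up keeps M positive and at least l / t. *)
Let l p := (2 * p).+1.
Let M p := (Num.truncn ((l p)%:R / t)).+1.
Let m p := (l p * M p)%N.

Let lR p : (0 : R) < (l p)%:R. Proof. by rewrite ltr0n. Qed.
Let MR p : (0 : R) < (M p)%:R. Proof. by rewrite ltr0n. Qed.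
Let m0 p : (0 < m p)%N. Proof. by rewrite muln_gt0. Qed.

Let M_bounds p : (l p)%:R / t <= (M p)%:R <= (l p)%:R / t + 1.
Proof.
have h : 0 <= (l p)%:R / t by rewrite divr_ge0// ltW.
have /andP[a b] := truncn_itv h.
by rewrite (ltW b)/= /M -natr1 lerD2r.
Qed.

Let l_cvg : (fun p => (l p)%:R^-1 : R) @ \oo --> 0.
Proof.
have h : (fun p => p.+1%:R^-1 : R) @ \oo --> 0 by exact: cvg_harmonic.
apply: (squeeze_cvgr _ (cvg_cst 0) h); apply: nearW => p.
rewrite invr_ge0 ltW//= lef_pV2 ?posrE// ler_nat /l; lia.
Qed.

Let M_large k : \forall p \near \oo, (k < M p)%N.
Proof.
near=> p; have /andP[a _] := M_bounds p; rewrite -(ltr_nat R); apply: lt_le_trans a.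
rewrite ltr_pdivlMr//; apply: (@le_lt_trans _ _ p%:R); last by rewrite ltr_nat /l; lia.
by near: p; exact: nbhs_infty_ger.
Unshelve. all: by end_near. Qed.

Let ratio_cvg : (fun p => (M p)%:R / (l p)%:R : R) @ \oo --> t^-1.
Proof.
have h : (fun p => t^-1 + (l p)%:R^-1) @ \oo --> t^-1.
  by rewrite -[X in _ --> X]addr0; apply: cvgD => //; exact: cvg_cst.
apply: (squeeze_cvgr _ (cvg_cst t^-1) h); apply: nearW => p.
have /andP[a b] := M_bounds p; rewrite ler_pdivlMr// ler_pdivrMr// mulrC a/=.
by rewrite mulrDl mulVf ?gt_eqF// [t^-1 * _]mulrC.
Qed.

Let ratio_inv_cvg : (fun p => (l p)%:R / (M p)%:R : R) @ \oo --> t.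
Proof.
rewrite -[X in _ --> X]invrK.
rewrite (_ : (fun p => _) = fun p => ((M p)%:R / (l p)%:R)^-1); last first.
  by apply/funext => p; rewrite invf_div.
by apply: cvgV => //; rewrite gt_eqF// invr_gt0.
Qed.

Let cos_sum_cvg :
  (fun p => \sum_(0 <= k < p) cos (pi * k.+1%:R / (l p)%:R) ^+ (2 * m p)) @ \oo -->
  gauss_sum (pi ^+ 2 / t).
Proof.
have pi0 := pi_gt0 R.
have mE p k : (m p)%:R * (pi * k.+1%:R / (l p)%:R) ^+ 2 =
    pi ^+ 2 * k.+1%:R ^+ 2 * ((M p)%:R / (l p)%:R) :> R.
  by rewrite natrM; field; rewrite gt_eqF.
pose u p k : R := if (k < p)%N then cos (pi * k.+1%:R / (l p)%:R) ^+ (2 * m p) else 0.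
rewrite (_ : (fun p => _) = fun p => \sum_(0 <= k < p) u p k); last first.
  by apply/funext => p; apply: eq_big_nat => k /andP[_ kp]; rewrite /u kp.
(* Domination: cos^2 y <= cos y <= e^(-y^2/4) on [0, pi/2], and M / l >= 1 / t. *)
apply: (@gauss_sum_cvg u id _ (pi ^+ 2 / t / 4)).
- by rewrite divr_gt0// exprn_gt0.
- by rewrite !divr_gt0// exprn_gt0.
- move=> p k; rewrite /u; case: ifPn => kp; last by rewrite lexx expR_ge0.
  set y := pi * _ / _; have y0 : 0 <= y <= pi / 2.
    rewrite /y divr_ge0 ?mulr_ge0 ?(ltW pi0)//=.
    rewrite -mulrA ler_wpM2l ?(ltW pi0)// ler_pdivrMr// ler_pdivlMl// -natrM ler_nat /l; lia.
  have c0 : 0 <= cos y.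
    have /andP[? ?] := y0; apply: cos_ge0_pihalf; apply/andP; split => //.
    by rewrite (le_trans _ (proj1 (andP y0)))// oppr_le0 divr_ge0// ltW.
  rewrite exprM; apply/andP; split; first by rewrite exprn_ge0// sqr_ge0.
  have c1 : cos y ^+ 2 <= expR (- (y ^+ 2 / 4)).
    have := cos_le_quad y0; have := expR_ge1Dx (- (y ^+ 2 / 4)); have := cos_le1 y.
    by nra.
  rewrite (le_trans (lerXn2r _ _ _ c1)) ?nnegrE ?sqr_ge0 ?expR_ge0//.
  rewrite -expRM_natl ler_expR mulrN lerN2 [leRHS]mulrA /y (mE p k).
  rewrite [leLHS](_ : _ = pi ^+ 2 * k.+1%:R ^+ 2 * t^-1 / 4); last by field; rewrite gt_eqF.
  have /andP[a _] := M_bounds p; rewrite ler_wpM2r// ler_wpM2l ?mulr_ge0 ?sqr_ge0 ?(ltW pi0)//.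
  by rewrite ler_pdivlMr// mulrC.
- by move=> p k pk; rewrite /u ltnNge pk.
move=> k.
have h : (fun p => cos (pi * k.+1%:R / (l p)%:R) ^+ (2 * m p)) @ \oo --> gaussian (pi ^+ 2 / t) k.
  apply: cos_pow_cvg => [p||].
  - by rewrite divr_ge0 ?mulr_ge0// ltW.
  - by rewrite -[X in _ --> X](mulr0 (pi * k.+1%:R)); apply: cvgM => //; exact: cvg_cst.
  under eq_fun do rewrite mE.
  by rewrite mulrAC; apply: cvgM => //; exact: cvg_cst.
apply: cvg_trans h; apply: near_eq_cvg; near=> p.
rewrite /u ifT//; near: p; exact: nbhs_infty_gt.
Unshelve. all: by end_near. Qed.

Let bin_sum_cvg :
  (fun p => \sum_(0 <= k < M p) binratio (m p) (l p * k.+1)) @ \oo --> gauss_sum t.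
Proof.
have c0 : 0 < (t^-1 + 1)^-1 / 2 by rewrite divr_gt0// invr_gt0 addr_gt0// invr_gt0.
have kE p k : ((l p * k.+1)%:R ^+ 2 / (m p)%:R) = k.+1%:R ^+ 2 * ((l p)%:R / (M p)%:R) :> R.
  by rewrite !natrM; field; rewrite !gt_eqF.
(* Domination: the exponent k^2 l / (2 M) is bounded below through M <= l / t + 1 <= l (1 / t +
   1). *)
apply: (@gauss_sum_cvg (fun p k => binratio (m p) (l p * k.+1)) M _ ((t^-1 + 1)^-1 / 2)) => //.
- move=> p k; rewrite binratio_ge0/= (le_trans (binratio_gauss _ (m0 p)))// ler_expR lerN2.
  rewrite [leRHS](_ : _ = 2^-1 * (k.+1%:R ^+ 2 * ((l p)%:R / (M p)%:R))); last first.
    by rewrite -kE invfM mulrCA.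
  rewrite [leLHS]mulrC [leRHS]mulrCA ler_wpM2l ?sqr_ge0//.
  rewrite [leLHS]mulrC ler_wpM2l ?invr_ge0//.
  rewrite -[leRHS]invrK lef_pV2 ?posrE ?invr_gt0 ?divr_gt0// ?addr_gt0 ?invr_gt0// invf_div.
  have /andP[_ b] := M_bounds p; rewrite ler_pdivrMr// (le_trans b)// mulrDl mul1r.
  by rewrite [t^-1 * _]mulrC lerD2l ler1n.
- by move=> p k Mk; rewrite binratio_eq0// /m ltn_pmul2l.
move=> k; have e1 : (fun p => expR (- ((l p * k.+1)%:R ^+ 2 / (m p + l p * k.+1)%:R))) @ \oo -->
    gaussian t k.
  rewrite /gaussian mulrC; apply: expR_cvg; apply: cvgN.
  rewrite (_ : (fun p => _) = fun p => k.+1%:R ^+ 2 * (((l p)%:R / (M p)%:R)^-1 + k.+1%:R * (l p)%:R^-1)^-1).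
    apply: cvgM; first exact: cvg_cst.
    rewrite -[X in _ --> X]invrK; apply: cvgV; first by rewrite gt_eqF// invr_gt0.
    rewrite -[X in _ --> X]addr0; apply: cvgD.
      by apply: cvgV => //; rewrite gt_eqF.
    by rewrite -[X in _ --> X](mulr0 (k.+1%:R)); apply: cvgM => //; exact: cvg_cst.
  apply/funext => p; rewrite natrD !natrM; field.
  by rewrite !gt_eqF// ?addr_gt0// ?mulr_gt0// ?ltr0n.
have e2 : (fun p => expR (- ((l p * k.+1)%:R ^+ 2 / (m p - l p * k.+1)%:R))) @ \oo -->
    gaussian t k.
  rewrite /gaussian mulrC; apply: expR_cvg; apply: cvgN.
  have h : (fun p => k.+1%:R ^+ 2 * (((l p)%:R / (M p)%:R)^-1 - k.+1%:R * (l p)%:R^-1)^-1)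
      @ \oo --> k.+1%:R ^+ 2 * t.
    apply: cvgM; first exact: cvg_cst.
    rewrite -[X in _ --> X]invrK; apply: cvgV; first by rewrite gt_eqF// invr_gt0.
    rewrite -[X in _ --> X]subr0; apply: cvgB.
      by apply: cvgV => //; rewrite gt_eqF.
    by rewrite -[X in _ --> X](mulr0 (k.+1%:R)); apply: cvgM => //; exact: cvg_cst.
  apply: cvg_trans h; apply: near_eq_cvg; near=> p.
  have kM : (k.+1 < M p)%N by near: p; exact: M_large.
  have kM' : (0 : R) < (M p)%:R - k.+1%:R by rewrite subr_gt0 ltr_nat.
  rewrite natrB ?leq_mul// ?(ltnW kM)// !natrM; move: (k.+1%:R : R) kM' => c kM'; field.
  by rewrite -mulrBr mulf_neq0 !gt_eqF.
apply: (squeeze_cvgr _ e2 e1); near=> p.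
have kM : (k.+1 < M p)%N by near: p; exact: M_large.
by rewrite binratio_ge ?binratio_le// /m ?ltn_pmul2l// leq_pmul2l// ltnW.
Unshelve. all: by end_near. Qed.

(** The identity is squared to bring in the limit known to exist: (l c_m)^2 = (l / M) (m c_m^2), and
    l / M tends to t. *)
Lemma polya_limit (L : R) : (fun n => n%:R * cbin n ^+ 2) @ \oo --> L ->
  (1 + 2 * gauss_sum (pi ^+ 2 / t)) ^+ 2 = t * L * (1 + 2 * gauss_sum t) ^+ 2.
Proof.
move=> hL.
have h1 : (fun p => (1 + 2 * \sum_(0 <= k < p) cos (pi * k.+1%:R / (l p)%:R) ^+ (2 * m p)) ^+ 2)
    @ \oo --> (1 + 2 * gauss_sum (pi ^+ 2 / t)) ^+ 2.
  have h : (fun p => 1 + 2 * \sum_(0 <= k < p) cos (pi * k.+1%:R / (l p)%:R) ^+ (2 * m p))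
    @ \oo --> 1 + 2 * gauss_sum (pi ^+ 2 / t).
    exact: (cvgD (cvg_cst _) (cvgM (cvg_cst _) cos_sum_cvg)).
  exact: (cvgM h h).
have hm : (fun p => (m p)%:R * cbin (m p) ^+ 2) @ \oo --> L.
  apply: (cvg_comp (m : nat -> nat) (fun n => n%:R * cbin n ^+ 2) _ hL).
  apply/cvgnyPge => A; near=> p; apply: (@leq_trans p); first by near: p; exact: nbhs_infty_ge.
  by rewrite /m (leq_trans (_ : _ <= l p))%N ?leq_pmulr// /l; lia.
have h2 : (fun p => (l p)%:R / (M p)%:R * ((m p)%:R * cbin (m p) ^+ 2) *
    (1 + 2 * \sum_(0 <= k < M p) binratio (m p) (l p * k.+1)) ^+ 2)
    @ \oo --> t * L * (1 + 2 * gauss_sum t) ^+ 2.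
  have h : (fun p => 1 + 2 * \sum_(0 <= k < M p) binratio (m p) (l p * k.+1))
    @ \oo --> 1 + 2 * gauss_sum t.
    exact: (cvgD (cvg_cst _) (cvgM (cvg_cst _) bin_sum_cvg)).
  apply: cvgM (cvgM h h); exact: (cvgM ratio_inv_cvg hm).
have e : (fun p => (1 + 2 * \sum_(0 <= k < p) cos (pi * k.+1%:R / (l p)%:R) ^+ (2 * m p)) ^+ 2) =
   (fun p => (l p)%:R / (M p)%:R * ((m p)%:R * cbin (m p) ^+ 2) *
    (1 + 2 * \sum_(0 <= k < M p) binratio (m p) (l p * k.+1)) ^+ 2) :> (nat -> R).
  apply/funext => p; rewrite (polya_identity p (M p)) -/(m p) -/(l p).
  move: (cbin (m p)) (1 + 2 * _) => c d; rewrite /m natrM; field.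
  by rewrite gt_eqF.
rewrite e in h1; exact: (cvg_unique _ h1 h2).
Unshelve. all: by end_near. Qed.

End PolyaLimit.

(* The constant in the limit of Polya's identity is determined by x = 1, where both
   theta values agree. *)
Lemma theta_identity x : 0 < x ->
  1 + 2 * gauss_sum (pi / x) = Num.sqrt x * (1 + 2 * gauss_sum (pi * x)).
Proof.
move=> x0; have pi0 := pi_gt0 R.
have /cvg_ex[L hL] := @cvg_cbin R.
have pos y : 0 < y -> 0 < 1 + 2 * gauss_sum y.
  by move=> y0; rewrite ltr_wpDr// mulr_ge0// gauss_sum_ge0.
have piL : pi * L = 1.
  have := polya_limit pi0 hL; rewrite expr2 mulfK ?gt_eqF//.
  have P := pos _ pi0; rewrite -[X in X = _]mul1r => /mulIf -> //.
  by rewrite mulf_neq0// gt_eqF.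
have := polya_limit (mulr_gt0 pi0 x0) hL.
rewrite (_ : pi ^+ 2 / (pi * x) = pi / x); last first.
  by rewrite expr2 invfM mulrA mulfK// gt_eqF.
rewrite (mulrAC pi) piL mul1r => h.
apply/eqP; rewrite -(eqrXn2 (n := 2))//.
- by rewrite h exprMn sqr_sqrtr// ltW.
- by rewrite ltW// pos// divr_gt0.
- by rewrite mulr_ge0// ?sqrtr_ge0// ltW// pos// mulr_gt0.
Qed.

End ThetaIdentity.

(** * The completed zeta function *)

Section AnalyticClosure.
Context {R : realType}.
Implicit Types (f g : R[i] -> R[i]) (z w : R[i]) (u v : nat -> R[i]).

(** Mertens's theorem. The partial sums are the sums over i < N of u_i V_(N-i), with V the partial
    sums of v; V is bounded and converges, so Tannery's theorem applies. *)
Lemma cauchy_product u v (U : R^nat) (x y : R[i]) : (forall n, cabs (u n) <= U n) ->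
  cvgn (series U) -> series u @ \oo --> x -> series v @ \oo --> y ->
  series (fun n => \sum_(0 <= i < n.+1) u i * v (n - i)%N) @ \oo --> x * y.
Proof.
move=> uU cU ux vy.
have reindex N : series (fun n => \sum_(0 <= i < n.+1) u i * v (n - i)%N) N =
    \sum_(0 <= i < N) u i * series v (N - i)%N.
  elim: N => [|N IH]; first by rewrite /series/= !big_geq.
  rewrite /series/= big_nat_recr//=; move: IH; rewrite /series/= => ->.
  transitivity (\sum_(0 <= i < N.+1) u i * \sum_(0 <= k < (N - i)%N) v k +
      \sum_(0 <= i < N.+1) u i * v (N - i)%N).
    congr (_ + _); rewrite [RHS]big_nat_recr//= subnn.
    by rewrite [X in u N * X]big_geq// mulr0 addr0.
  rewrite -big_split/=; apply: eq_big_nat => i /andP[_ iN].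
  by rewrite -mulrDr subSn// big_nat_recr.
have [B vB] : exists B : R, forall n, cabs (series v n) <= B.
  have /cvg_seq_bounded : cvgn (fun n => cabs (series v n)).
    by apply/cvg_ex; exists (cabs y); exact: cvg_cabs.
  move=> [M [_ /(_ (`|M| + 1))]]; rewrite (le_lt_trans (ler_norm _)) ?ltrDl// => /(_ isT) H.
  exists (`|M| + 1) => n; have := H n I; rewrite /=.
  by apply: le_trans; rewrite ler_norm.
have U0 n : 0 <= U n by exact: le_trans (cabs_ge0 _) (uU n).
have H : \forall N \near \oo,
    (forall i, cabs (if (i < N)%N then u i * series v (N - i)%N else 0) <= B * U i) /\
    series (fun i => if (i < N)%N then u i * series v (N - i)%N else 0) @ \oo -->
      series (fun n => \sum_(0 <= i < n.+1) u i * v (n - i)%N) N.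
  apply: nearW => N; split=> [i|].
    case: ifP => _; last by rewrite cabs0 mulr_ge0// (le_trans (cabs_ge0 _) (vB 0%N)).
    by rewrite cabsM mulrC ler_pM ?cabs_ge0.
  apply: cvg_near_cst; near=> K; rewrite reindex /series/=.
  rewrite (@big_cat_nat _ _ _ N)//=; last by near: K; exact: nbhs_infty_ge.
  rewrite [X in _ + X]big_nat_cond [X in _ + X]big1 ?addr0; last first.
    by move=> i /andP[/andP[Ni _] _]; rewrite ltnNge Ni.
  by apply: eq_big_nat => i /andP[_ ->].
have cBU : cvgn (series (fun i => B * U i)).
  have /cvg_ex[l hl] := cU; apply/cvg_ex; exists (B * l).
  rewrite (_ : series _ = fun N => B * series U N).
    by apply: cvgM => //; exact: cvg_cst.
  by apply/funext => N; rewrite /series/= mulr_sumr.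
have pt i : (if (i < N)%N then u i * series v (N - i)%N else 0) @[N --> \oo] --> u i * y.
  have h : u i * series v (N - i)%N @[N --> \oo] --> u i * y.
    by apply: ccvgM; [exact: ccvg_cst|rewrite -(cvg_shiftn i) ; under eq_fun do rewrite addnK].
  apply: cvg_trans h; apply: near_eq_cvg; near=> N.
  by rewrite ifT//; near: N; exact: nbhs_infty_gt.
have [_ T] := tannery H cBU pt.
rewrite (_ : x * y = limn (series (fun i => u i * y)))//.
apply/esym/ccvg_lim; rewrite (_ : series _ = fun N => series u N * y).
  by apply: ccvgM; [exact: ux|exact: ccvg_cst].
by apply/funext => N; rewrite /series/= mulr_suml.
Unshelve. all: by end_near. Qed.

Lemma analytic_affine (b c : R[i]) z : analytic_at (fun w => b + c * w) z.
Proof.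
exists (fun n => if n is k.+1 then (if k is _.+1 then 0 else c) else b + c * z).
near=> w; apply: cvg_near_cst; near=> n.
have [m ->] : exists m, n = m.+2.
  by exists n.-2; rewrite -subn2 -addn2 subnK//; near: n; exact: nbhs_infty_ge.
rewrite /series/= !big_nat_recl//= big1_seq ?addr0; last first.
  by move=> i _; rewrite mul0r.
by rewrite expr0 mulr1 expr1; ring.
Unshelve. all: by end_near. Qed.

Lemma analytic_cst (b : R[i]) z : analytic_at (fun _ => b) z.
Proof.
have := analytic_affine b 0 z; congr (analytic_at _ z).
by apply/funext => w; rewrite mul0r addr0.
Qed.

Lemma analyticD f g z : analytic_at f z -> analytic_at g z ->
  analytic_at (fun w => f w + g w) z.
Proof.
move=> [a fa] [b gb]; exists (fun n => a n + b n).
have fa' : \forall w \near z, series (fun n => a n * (w - z) ^+ n) @ \oo --> f w by [].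
apply: filterS2 fa' gb => w fw gw.
rewrite (_ : series _ = fun N => series (fun n => a n * (w - z) ^+ n) N +
    series (fun n => b n * (w - z) ^+ n) N); first exact: (ccvgD fw gw).
apply/funext => N; rewrite /series/= -big_split/=; apply: eq_bigr => n _.
by rewrite mulrDl.
Qed.

Lemma analyticM f g z : analytic_at f z -> analytic_at g z ->
  analytic_at (fun w => f w * g w) z.
Proof.
move=> /analytic_bounds[a [C [rho rho0 [aC fa]]]] [b gb].
exists (fun n => \sum_(0 <= i < n.+1) a i * b (n - i)%N).
have hr : \forall w \near z, cabs (w - z) < rho / 2.
  by apply/nbhs_cabsP; exists (rho / 2) => //; rewrite divr_gt0.
have gb' : \forall w \near z, series (fun n => b n * (w - z) ^+ n) @ \oo --> g w by [].
apply: filterS2 hr gb' => w wr gw.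
have q0 : 0 <= cabs (w - z) / rho by rewrite divr_ge0 ?cabs_ge0// ltW.
have q1 : cabs (w - z) / rho < 1.
  rewrite ltr_pdivrMr// mul1r (lt_trans wr)// ltr_pdivrMr// mulr_natr mulr2n ltrDl//.
have wr' : cabs (w - z) < rho.
  by rewrite ltr_pdivrMr// mul1r in q1.
have cU : cvgn (series (geometric C (cabs (w - z) / rho))).
  by apply: is_cvg_geometric_series; rewrite ger0_norm.
have uU n : cabs (a n * (w - z) ^+ n) <= geometric C (cabs (w - z) / rho) n.
  rewrite [leRHS](_ : _ = C / rho ^+ n * cabs (w - z) ^+ n); last first.
    by rewrite [RHS]mulrAC -[RHS]mulrA -expr_div_n.
  rewrite cabsM cabsX ler_wpM2r ?exprn_ge0 ?cabs_ge0//.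
  by rewrite ler_pdivlMr ?exprn_gt0.
have := cauchy_product uU cU (fa _ wr') gw.
rewrite (_ : (fun n => _) = (fun n => (\sum_(0 <= i < n.+1) a i * b (n - i)%N) * (w - z) ^+ n))//.
apply/funext => n; rewrite mulr_suml; apply: eq_big_nat => i /andP[_ ni].
by rewrite mulrACA -exprD subnKC.
Qed.

Lemma analytic_comp_affine f (b c : R[i]) z : analytic_at f (b + c * z) ->
  analytic_at (fun w => f (b + c * w)) z.
Proof.
move=> [a /nbhs_cabsP[d d0 fa]]; exists (fun n => a n * c ^+ n).
apply/nbhs_cabsP; exists (d / (cabs c + 1)); first by rewrite divr_gt0// ltr_wpDl// cabs_ge0.
move=> w; rewrite ltr_pdivlMr ?ltr_wpDl ?cabs_ge0// => wd.
have E : b + c * w - (b + c * z) = c * (w - z) by ring.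
have := fa (b + c * w); rewrite E cabsM.
rewrite (_ : (fun n => a n * (c * (w - z)) ^+ n) = (fun n => a n * c ^+ n * (w - z) ^+ n)).
  by apply; rewrite mulrC (le_lt_trans _ wd)// ler_wpM2l ?cabs_ge0// lerDl.
by apply/funext => n; rewrite exprMn mulrA.
Qed.

End AnalyticClosure.

Section ExponentialSeries.
Context {R : realType}.
Implicit Types (x z w : R[i]).

(** The product of e^(-w) and the Taylor polynomial of degree N has derivative - e^(-w) w^N / N!,
    which tends to 0 uniformly on a disc, while its value at 0 is 1. The mean value estimate
    concludes. *)
Lemma cexp_series x : series (fun n => x ^+ n / n`!%:R) @ \oo --> cexp x.
Proof.
pose r := cabs x + 1; have r0 : 0 < r by rewrite ltr_wpDl// cabs_ge0.
pose E (N : nat) (w : R[i]) := \sum_(0 <= n < N) w ^+ n / n`!%:R.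
have fne0 n : (n`!%:R : R[i]) != 0 by rewrite pnatr_eq0 -lt0n fact_gt0.
have dE N w : cder (E N.+1) w (E N w).
  elim: N => [|N IH].
    rewrite /E big_geq// (_ : (fun w => _) = fun _ => 1); first exact: cder_cst.
    by apply/funext => w'; rewrite big_nat1 expr0 divr1.
  rewrite (_ : E N.+2 = fun w => E N.+1 w + (N.+1`!%:R)^-1 * w ^+ N.+1); last first.
    by apply/funext => w'; rewrite /E big_nat_recr//= [_ / _]mulrC.
  rewrite (_ : E N.+1 w = E N w + (N.+1`!%:R)^-1 * (N.+1%:R * w ^+ N)); last first.
    rewrite /E big_nat_recr//= factS natrM invfM; congr (_ + _).
    by rewrite [RHS]mulrACA mulVf ?pnatr_eq0// mul1r mulrC.
  apply: cderD => //; apply: cderZ; apply: cder_eq; first exact: (cderX N.+1 (cder_id w)).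
  by rewrite ?mulr1.
pose g N w := cexp (- w) * E N.+1 w.
have dexp w : cder (fun w : R[i] => cexp (- w)) w (- cexp (- w)).
  have := cder_affine (a := 0) (b := -1) (z := w) (cder_cexp _).
  rewrite add0r mulN1r mulrN1 => h; apply: cder_near h.
  by near=> v; rewrite add0r mulN1r.
have dg N w : cder (g N) w (- (cexp (- w) * (w ^+ N / N`!%:R))).
  apply: cder_eq (cderM (dexp w) (dE N w)) _.
  by rewrite /E big_nat_recr//=; ring.
have bnd N w : cabs (w - 0) < r ->
    cabs (- (cexp (- w) * (w ^+ N / N`!%:R)) - 0) <= expR r * exp_coeff r N.
  rewrite !subr0 cabsN cabsM cabs_cexp cabs_div cabs_nat cabsX => wr.
  apply: ler_pM; rewrite ?expR_ge0 ?divr_ge0 ?exprn_ge0 ?cabs_ge0//.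
    rewrite ler_expR cReN (le_trans (ler_norm _))// normrN.
    by rewrite (le_trans (ler_cabs_Re _))// ltW.
  rewrite ler_wpM2r// lerXn2r// ?nnegrE ?cabs_ge0 ?ltW//.
have x0r : cabs (x - 0) < r by rewrite subr0 /r ltrDl.
have z0r : cabs (0 - 0 : R[i]) < r by rewrite subr0 cabs0.
rewrite -(cvg_shiftS (series _)).
apply: (@cvg_cabs_le _ _ _ _ _ _
  (fun N => expR (Re x) * (2 * (expR r * exp_coeff r N) * cabs x))).
  apply: nearW => N.
  have := cder_mean_value (fun w _ => dg N w) (bnd N) z0r x0r.
  rewrite subr0 mul0r subr0 /g oppr0 cexp0 mul1r.
  rewrite [E N.+1 0]/E big_nat_recl//= expr0 divr1 big1 ?addr0; last first.
    by move=> i _; rewrite expr0n mul0r.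
  move=> h; rewrite cabsC /series/= -/(E N.+1 x).
  rewrite -[E _ x](mulKf (cexp_neq0 (- x))) -cexpN opprK.
  rewrite -[X in _ - X]mulr1 -mulrBr cabsM cabs_cexp ler_wpM2l ?expR_ge0//.
have e0 : (fun N => expR (Re x) * (2 * (expR r * exp_coeff r N) * cabs x)) @ \oo -->
   expR (Re x) * (2 * (expR r * 0) * cabs x).
  apply: cvgM; first exact: cvg_cst.
  apply: cvgM; last exact: cvg_cst.
  apply: cvgM; first exact: cvg_cst.
  by apply: cvgM; [exact: cvg_cst|exact: cvg_exp_coeff].
by move: e0; rewrite mulr0 mulr0 mul0r mulr0.
Unshelve. all: by end_near. Qed.

Lemma exp_term_le (x : R) n : 0 <= x -> x ^+ n / n`!%:R <= expR x.
Proof.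
move=> x0; case: n => [|n]; first by rewrite expr0 divr1 -[leLHS]expR0 ler_expR.
by rewrite (le_trans _ (expR_ge1Dxn n x0))// lerDr.
Qed.

Lemma exp_sum_le (x : R[i]) N : cabs (\sum_(0 <= n < N) x ^+ n / n`!%:R) <= expR (cabs x).
Proof.
rewrite (le_trans (ler_cabs_sum _ _ _))//.
rewrite (eq_bigr (exp_coeff (cabs x))); last first.
  by move=> n _; rewrite cabs_div cabsX cabs_nat.
apply: (nondecreasing_cvgn_le (u_ := series (exp_coeff (cabs x)))).
  by apply: nondecreasing_series => n _ _; rewrite exp_coeff_ge0// cabs_ge0.
exact: is_cvg_series_exp_coeff.
Qed.

End ExponentialSeries.
Arguments cexp_series {R} x.

(** * Analyticity of Mellin transforms *)

Section MellinAnalytic.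
Context {R : realType}.
Context (k : R -> R).
Context (mk : measurable_fun [set: R] k).

(** The Mellin transform in the variable x = e^u, where x^(z-1) dx becomes e^(zu) du. *)
Definition mellin (z : R[i]) : R[i] := cint (fun u => cexp (z * u%:C) * (k u)%:C).

Lemma mellin_measurable z : cmeasurable (fun u => cexp (z * u%:C) * (k u)%:C).
Proof. by apply: cmeasurableM; [exact: cmeasurable_cexp|exact: cmeasurable_real]. Qed.

Lemma cabs_mellin z u : cabs (cexp (z * u%:C) * (k u)%:C) = expR (Re z * u) * `|k u|.
Proof. by rewrite cabsM cabs_cexp cabs_real [z * _]mulrC cReMr [u * _]mulrC. Qed.

Lemma mellin_integrable z (C c : R) : 0 < c ->
  (forall u, expR (Re z * u) * `|k u| <= C * expR (- c * `|u|)) ->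
  cintegrable (fun u => cexp (z * u%:C) * (k u)%:C).
Proof.
move=> c0 kC; apply: (@cintegrable_le R _ (fun u => C * expR (- c * `|u|)) (mellin_measurable z)).
  by move=> u; rewrite cabs_mellin.
exact: rintegrableZ (rintegrable_expR_norm c0).
Qed.

(** Expand e^((w-z)u) and integrate term by term: for |w - z| < c/2 the partial sums cost at most
    e^(c|u|/2), half of the available decay, and the other half dominates. *)
Lemma mellin_analytic z (C c : R) : 0 < c ->
  (forall u, expR (Re z * u) * `|k u| <= C * expR (- c * `|u|)) ->
  analytic_at mellin z.
Proof.
move=> c0 kC; have c2 : 0 < c / 2 by rewrite divr_gt0.
have C0 : 0 <= C.
  have := kC 0; rewrite normr0 !mulr0 expR0 mul1r mulr1; exact: le_trans.
pose F n u := u%:C ^+ n / n`!%:R * (cexp (z * u%:C) * (k u)%:C).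
have mF n : cmeasurable (F n).
  apply: cmeasurableM; last exact: mellin_measurable.
  apply: cmeasurable_continuous => x.
  apply: ccvgM; last exact: ccvg_cst.
  by apply: ccvgX; apply: cvg_real_complex; exact: cvg_id.
have IF n : cintegrable (F n).
  apply: (@cintegrable_le R _ (fun u => ((c / 2) ^- n * C) * expR (- (c / 2) * `|u|))) => //.
    move=> u; rewrite cabsM cabs_mellin.
    rewrite (le_trans (ler_wpM2l (cabs_ge0 _) (kC u)))//.
    have := exp_term_le n (mulr_ge0 (ltW c2) (normr_ge0 u)).
    rewrite cabs_div cabsX cabs_real cabs_nat exprMn.
    have -> : expR (- c * `|u|) = expR (- (c / 2) * `|u|) * expR (- (c / 2) * `|u|).
      by rewrite -expRD; congr expR; field.
    have cn : 0 < (c / 2) ^+ n by rewrite exprn_gt0.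
    move=> h; rewrite [leLHS]mulrCA [leRHS]mulrAC [leRHS]mulrC ler_wpM2l//.
    by rewrite mulrA ler_wpM2r ?expR_ge0// mulNr expRN ler_pdivrMr ?expR_gt0// ler_pdivlMl// mulrA.
  exact: rintegrableZ (rintegrable_expR_norm c2).
exists (fun n => cint (F n)); apply/nbhs_cabsP; exists (c / 2) => // w wz.
have [||||I D] := @cint_dominated R (fun N u => \sum_(0 <= n < N) (w - z) ^+ n * F n u)
  (fun u => cexp (w * u%:C) * (k u)%:C) (fun u => C * expR (- (c / 2) * `|u|)).
- move=> N; apply: cintegrable_measurable.
  by apply: (cint_sum _ _).1 => n; exact: cintegrableZ.
- move=> N u; rewrite (_ : \sum_(_ <= _ < _) _ =
    (\sum_(0 <= n < N) ((w - z) * u%:C) ^+ n / n`!%:R) * (cexp (z * u%:C) * (k u)%:C)).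
    rewrite cabsM cabs_mellin (le_trans (ler_pM _ _ (exp_sum_le _ N) (kC u))) ?cabs_ge0//.
    rewrite mulrCA ler_wpM2l// -expRD ler_expR cabsM cabs_real.
    have := normr_ge0 u; nra.
  by rewrite mulr_suml; apply: eq_bigr => n _; rewrite /F exprMn !mulrA.
- exact: rintegrableZ (rintegrable_expR_norm c2).
- move=> u; have h : (fun N => series (fun n => ((w - z) * u%:C) ^+ n / n`!%:R) N *
      (cexp (z * u%:C) * (k u)%:C)) @ \oo --> cexp ((w - z) * u%:C) * (cexp (z * u%:C) * (k u)%:C).
    exact: (ccvgM (cexp_series _) (ccvg_cst _)).
  rewrite mulrA -cexpD -mulrDl subrK in h.
  rewrite (_ : (fun N => _) = (fun N => series (fun n => ((w - z) * u%:C) ^+ n / n`!%:R) N *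
      (cexp (z * u%:C) * (k u)%:C)))//.
  apply/funext => N.
  by rewrite /series/= mulr_suml; apply: eq_bigr => n _; rewrite /F exprMn !mulrA.
rewrite (_ : series _ = (fun N => cint (fun u => \sum_(0 <= n < N) (w - z) ^+ n * F n u)))//.
apply/funext => N.
have IG n : cintegrable (fun u => (w - z) ^+ n * F n u) by exact: cintegrableZ.
rewrite (cint_sum _ IG).2 /series/=; apply: eq_bigr => n _.
by rewrite cintZ// mulrC.
Qed.

End MellinAnalytic.

(** * The theta function in the logarithmic variable *)

Section ThetaKernel.
Context {R : realType}.
Implicit Types (u s : R) (z w : R[i]).

(** Riemann's series of e^(-pi n^2 x) over n >= 1, at x = e^u. *)
Definition theta_half u : R := gauss_sum (pi * expR u).

Lemma pi_expR_gt0 u : 0 < pi * expR u :> R.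
Proof. by rewrite mulr_gt0 ?pi_gt0 ?expR_gt0. Qed.

Lemma theta_half_ge0 u : 0 <= theta_half u.
Proof. exact: gauss_sum_ge0 (pi_expR_gt0 u). Qed.

Lemma theta_half_measurable : measurable_fun [set: R] theta_half.
Proof.
apply: (measurable_fun_cvg (h := fun m u => series (gaussian (pi * expR u)) m)) => [m|u _].
  apply: measurable_sum => n; apply: continuous_measurable_fun => u.
  apply: continuous_cvg; first exact: continuous_expR.
  apply: cvgN; apply: cvgM; last exact: cvg_cst.
  by apply: cvgM; [exact: cvg_cst|exact: continuous_expR].
exact: cvg_gaussian (pi_expR_gt0 u).
Qed.

Lemma gauss_sum_le (x : R) : 1 <= x -> gauss_sum x <= 2 * expR (- x).
Proof.
move=> x1; have x0 : 0 < x by exact: lt_le_trans x1.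
apply: limr_le; first exact: cvg_gaussian.
apply: nearW => N; set q := expR (- x).
have q01 : 0 <= q <= 2^-1.
  rewrite expR_ge0/= /q expRN lef_pV2 ?posrE ?expR_gt0//.
  by rewrite (le_trans _ (expR_ge1Dx x))// -[2]/(1 + 1) lerD2l.
have := geometric_sum_le 0 N q01; rewrite add0n expr0 mulr1 => h.
have h' : \sum_(0 <= n < N) q ^+ n <= 2.
  by rewrite (le_trans h)// gerBl mulr_ge0// exprn_ge0// expR_ge0.
rewrite mulrC (le_trans _ (ler_wpM2l (expR_ge0 _) h'))// mulr_sumr.
by apply: ler_sum => n _; exact: gaussian_le (ltW x0).
Qed.

Lemma theta_half_le u : 0 <= u -> theta_half u <= 2 * expR (- expR u).
Proof.
move=> u0; have e1 : 1 <= expR u by rewrite -[leLHS]expR0 ler_expR.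
have p1 : expR u <= pi * expR u.
  by rewrite ler_peMl ?expR_ge0// (le_trans _ (pi_ge2 R))// ler1n.
rewrite (le_trans (gauss_sum_le (le_trans e1 p1)))// ler_wpM2l// ler_expR lerN2//.
Qed.

(** The decay e^(-e^u) beats every power of e^u; the power s + 1 leaves a factor e^(-u) to
    integrate. *)
Lemma theta_half_decay s : exists2 C : R, 0 <= C &
  forall u, 0 <= u -> expR (s * u) * theta_half u <= C * expR (- `|u|).
Proof.
pose K := Num.truncn `|s + 1|.
have sK : s + 1 <= K.+1%:R.
  by rewrite (le_trans (ler_norm _))// ltW// truncnS_gt.
exists (2 * K.+1`!%:R); first by rewrite mulr_ge0.
move=> u u0; rewrite (le_trans (ler_wpM2l (expR_ge0 _) (theta_half_le u0)))//.
rewrite mulrCA -mulrA ler_wpM2l//.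
rewrite (le_trans (ler_wpM2l (expR_ge0 _) (expRN_le_pow K (expR_gt0 u))))//.
rewrite mulrCA ler_wpM2l// -expRM_natl -expRN -expRD ler_expR ger0_norm//.
by nra.
Qed.

Lemma theta_half_opp u : 1 + 2 * theta_half u = expR (- (u / 2)) * (1 + 2 * theta_half (- u)).
Proof.
have h := theta_identity (expR_gt0 (- u)).
have e1 : pi / expR (- u) = pi * expR u by rewrite expRN invrK.
have e2 : Num.sqrt (expR (- u)) = expR (- (u / 2)).
  rewrite (_ : expR (- u) = expR (- (u / 2)) ^+ 2) ?sqrtr_sqr ?ger0_norm ?expR_ge0//.
  by rewrite -expRM_natl; congr expR; field.
by rewrite e1 e2 in h.
Qed.

(** Towards minus infinity the theta identity gives a growth of order e^(-u/2), which e^(su)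
    outweighs for s > 1/2; at argument 2 z this is the half-plane of convergence of the Dirichlet
    series. *)
Lemma theta_half_bound s : 2^-1 < s -> exists2 c : R, 0 < c & exists C : R,
  forall u, expR (s * u) * `|theta_half u| <= C * expR (- c * `|u|).
Proof.
move=> s2; pose c := Num.min 1 (s - 2^-1).
have c0 : 0 < c by rewrite lt_min ltr01 subr_gt0.
have [C C0 H] := theta_half_decay s.
(* The 3 is for u < 0: from theta_half (- u) <= 2 one gets 1 + 2 theta_half u <= 5 e^(-u/2). *)
exists c => //; exists (Num.max C 3) => u; rewrite ger0_norm ?theta_half_ge0//.
have [u0|u0] := leP 0 u.
  rewrite (le_trans (H u u0))// ler_pM ?expR_ge0//; first by rewrite le_max lexx.
  by rewrite ler_expR mulNr lerN2 ler_piMl// ge_min lexx.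
have h1 : theta_half (- u) <= 2.
  by rewrite (le_trans (theta_half_le _)) ?oppr_ge0 ?(ltW u0)// ler_piMr//.
have h2 : theta_half u <= 3 * expR (- (u / 2)).
  move: h1 (theta_half_opp u) (expR_gt0 (- (u / 2))) (theta_half_ge0 (- u)).
  move: (theta_half u) (theta_half (- u)) (expR _) => a b d h1 h2 h3 h4; nra.
rewrite (le_trans (ler_wpM2l (expR_ge0 _) h2))// mulrCA ler_pM ?expR_ge0//.
  by rewrite le_max lexx orbT.
rewrite -expRD ler_expR ltr0_norm// mulrNN.
have cs : c <= s - 2^-1 by rewrite ge_min lexx orbT.
by have := ler_wnM2r (ltW u0) cs; rewrite mulrBl [2^-1 * u]mulrC.
Qed.

End ThetaKernel.

(** * Riemann's integral formula for zeta *)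

Section MellinTheta.
Context {R : realType}.
Context (zeta : R[i] -> R[i]).
Context (zetaP : is_riemann_zeta zeta).
Implicit Types (u s : R) (z w : R[i]).

(** Arguments are halved here: z stands for s/2, zeta is taken at 2 z, the symmetry is z -> 1/2 - z,
    and the critical line is Re z = 1/4. *)
Definition gamma_factor z : R[i] := cpow pi (- z) * Gamma z.

(** Translating u by l = ln(pi (n+1)^2) turns the Gaussian into the kernel of Gamma, at the price of
    the factor e^(-z l). *)
Lemma mellin_gaussian n z : 0 < Re z ->
  let f u := cexp (z * u%:C) * (gaussian (pi * expR u) n)%:C in
  cintegrable f /\ cint f = cpow n.+1%:R (- (2 * z)) * gamma_factor z.
Proof.
move=> z0 f; pose l : R := ln (pi * n.+1%:R ^+ 2).
have n0 : (0 : R) < n.+1%:R by rewrite ltr0n.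
have p0 : 0 < pi * n.+1%:R ^+ 2 :> R by rewrite mulr_gt0 ?pi_gt0// exprn_gt0.
have el : expR l = pi * n.+1%:R ^+ 2 by rewrite /l lnK.
have ll : l = ln pi + 2 * ln n.+1%:R.
  by rewrite /l lnM ?posrE ?pi_gt0 ?exprn_gt0// lnXn// mulr_natl.
have [I E] := Gamma_integral z0.
have [E' I'] := cint_shift l I.
have fE : f = fun u => cexp (- z * l%:C) * Gamma_kernel z (u + l).
  apply/funext => u; rewrite /f /Gamma_kernel mulrA -cexpD rmorphD/= mulrDr mulNr addrCA addNr addr0.
  rewrite expRD el /gaussian.
  by congr (_ * (expR (- _))%:C); rewrite mulrA [_ * pi]mulrC.
rewrite fE; split; first exact: cintegrableZ.
rewrite (cintZ _ I') E' -E /gamma_factor.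
suff -> : cexp (- z * l%:C) = cpow n.+1%:R (- (2 * z)) * cpow pi (- z) by rewrite mulrA.
rewrite /cpow -cexpD; congr cexp.
rewrite ll rmorphD rmorphM rmorph_nat; ring.
Qed.

(** Sum and integral are exchanged by dominated convergence, the partial theta sums being at most
    [theta_half]. *)
Lemma zeta_mellin z : 2^-1 < Re z ->
  zeta (2 * z) * gamma_factor z = mellin theta_half z.
Proof.
move=> z2; have z0 : 0 < Re z by apply: lt_trans z2; rewrite invr_gt0.
have [c c0 [C HC]] := theta_half_bound z2.
have rez : 1 < Re (2 * z).
  by rewrite -(rmorph_nat (real_complex R)) cReMr -ltr_pdivrMl// mulr1.
pose f N u := \sum_(0 <= n < N) cexp (z * u%:C) * (gaussian (pi * expR u) n)%:C.
have If n := (mellin_gaussian n z0).1.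
have fE N u : f N u = cexp (z * u%:C) * (series (gaussian (pi * expR u)) N)%:C.
  by rewrite /f -mulr_sumr /series/= rmorph_sum.
have [||||I D] := @cint_dominated R f (fun u => cexp (z * u%:C) * (theta_half u)%:C)
  (fun u => C * expR (- c * `|u|)).
- by move=> N; apply: cintegrable_measurable; exact: (cint_sum _ If).1.
- move=> N u; rewrite (le_trans _ (HC u))// fE
    (cabs_mellin (fun u => series (gaussian (pi * expR u)) N)) ler_wpM2l ?expR_ge0//.
  rewrite !ger0_norm ?theta_half_ge0//; last by rewrite sumr_ge0// => k _; exact: expR_ge0.
  apply: series_le_lim; first by move=> k; exact: expR_ge0.
  exact: cvg_gaussian (pi_expR_gt0 u).
- exact: rintegrableZ (rintegrable_expR_norm c0).
- move=> u; under eq_fun do rewrite fE.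
  apply: ccvgM; first exact: ccvg_cst.
  by apply: cvg_real_complex; exact: cvg_gaussian (pi_expR_gt0 u).
have E N : cint (f N) = series (fun n => cpow n.+1%:R (- (2 * z))) N * gamma_factor z.
  rewrite (cint_sum _ If).2 /series/= mulr_suml; apply: eq_bigr => n _.
  exact: (mellin_gaussian n z0).2.
have D' : (fun N => series (fun n => cpow n.+1%:R (- (2 * z))) N * gamma_factor z) @ \oo -->
    zeta (2 * z) * gamma_factor z.
  exact: (ccvgM (zetaP.1 _ rez) (ccvg_cst _)).
by apply: ccvg_unique D' _; under eq_fun do rewrite -E.
Qed.

(* Value 1/2 at 0, so that [theta_half_split] holds at every point. *)
Definition half_step u : R := (if 0 < u then 2^-1 else 0) + (if 0 <= u then 2^-1 else 0).
Definition theta_kernel u : R := theta_half u * half_step u.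

Lemma theta_kernel_measurable : measurable_fun [set: R] theta_kernel.
Proof.
apply: measurable_funM; first exact: theta_half_measurable.
apply: measurable_funD; apply: measurable_fun_ifT; try exact: measurable_cst.
  by apply: measurable_fun_ltr => //; exact: measurable_cst.
by apply: measurable_fun_ler => //; exact: measurable_cst.
Qed.

Lemma theta_kernel_bound s : exists C : R,
  forall u, expR (s * u) * `|theta_kernel u| <= C * expR (- 1 * `|u|).
Proof.
have [C C0 H] := theta_half_decay s; exists C => u.
rewrite mulN1r /theta_kernel normrM (ger0_norm (theta_half_ge0 u)) /half_step.
case: (ltgtP 0 u) => u0; last 2 first.
- by rewrite addr0 normr0 !mulr0 mulr_ge0 ?expR_ge0.
- rewrite add0r ger0_norm ?invr_ge0// mulrA (le_trans _ (H u _)) -?u0//.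
  by rewrite ler_piMr ?mulr_ge0 ?expR_ge0 ?theta_half_ge0// invf_le1// ler1n.
have -> : 2^-1 + 2^-1 = 1 :> R by field.
by rewrite normr1 mulr1 H// ltW.
Qed.

(** For u < 0 the theta identity replaces theta_half u by theta_half (- u); its elementary remainder
    is the last term, the source of the polar part. *)
Lemma theta_half_split u : theta_half u =
  theta_kernel u + expR (- (u / 2)) * theta_kernel (- u) +
  (if u <= 0 then (expR (- (u / 2)) - 1) / 2 else 0).
Proof.
rewrite /theta_kernel /half_step oppr_gt0 oppr_ge0; have := theta_half_opp u.
have d1 : u = 0 -> expR (- (u / 2)) = 1 by move=> ->; rewrite mul0r oppr0 expR0.
move: (theta_half u) (theta_half (- u)) (expR _) d1 => a b d d1.
case: (ltgtP u 0) => u0.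
- by rewrite ?u0 ?(ltW u0) => h; nra.
- by rewrite ?(ltNge u 0) ?(leNgt u 0) ?(ltW u0) ?u0/= => h; nra.
- by rewrite ?u0 ?ltxx ?lexx (d1 u0) => h; lra.
Qed.

(** The reflection u -> - u changes e^(zu) e^(-u/2) into e^((1/2-z)u), hence the symmetric pair. The
    remainder integrates to (1/(z - 1/2) - 1/z) / 2. *)
Lemma mellin_split z : 2^-1 < Re z ->
  mellin theta_half z = mellin theta_kernel z + mellin theta_kernel (2^-1 - z)
    + (4 * z * (z - 2^-1))^-1.
Proof.
move=> z2; have z0 : 0 < Re z by apply: lt_trans z2; rewrite invr_gt0.
have re2 : Re (2^-1 : R[i]) = 2^-1.
  by rewrite -(rmorph_nat (real_complex R)) -fmorphV.
have z2' : 0 < Re (z - 2^-1) by rewrite cReD cReN re2 subr_gt0.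
have W w : cintegrable (fun u => cexp (w * u%:C) * (theta_kernel u)%:C).
  have [C H] := theta_kernel_bound (Re w).
  exact: (mellin_integrable theta_kernel_measurable ltr01 H).
have [E1 I1] := cint_opp (W (2^-1 - z)).
have [I2 E2] := cint_cexp_half z2'; have [I3 E3] := cint_cexp_half z0.
have nz : z != 0 by apply: contraTneq z0 => ->; rewrite /= ltxx.
have nz2 : z - 2^-1 != 0 by apply: contraTneq z2' => ->; rewrite /= ltxx.
have -> : (4 * z * (z - 2^-1))^-1 = 2^-1 * (z - 2^-1)^-1 + - 2^-1 * z^-1.
  have : z - (z - 2^-1) = 2^-1 by ring.
  move: nz nz2; move: (z - 2^-1) => w nz nw zw.
  have -> : 2^-1 / w + - 2^-1 / z = 2^-1 * (z - w) / (z * w) by field; rewrite nz nw.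
  by rewrite zw; field; rewrite nz nw.
rewrite -E2 -E3 -!cintZ// addrA /mellin -E1.
rewrite -!cintD//; try do ?[exact: cintegrableZ|apply: cintegrableD => //].
congr cint; apply/funext => u.
have -> : (theta_half u)%:C = (theta_kernel u)%:C + (expR (- (u / 2)))%:C * (theta_kernel (- u))%:C +
    (if u <= 0 then ((expR (- (u / 2)))%:C - 1) / 2 else 0).
  have rs (a b d e : R) : (a + b * d + e)%:C = a%:C + b%:C * d%:C + e%:C.
    by rewrite !rmorphD rmorphM.
  rewrite (theta_half_split u) rs; congr (_ + _).
  by case: ifP => _; [rewrite rmorphM fmorphV rmorph_nat rmorphB rmorph1|].
have e : cexp ((2^-1 - z) * (- u)%:C) = cexp (z * u%:C) * (expR (- (u / 2)))%:C.
  rewrite -cexp_real -cexpD; congr cexp.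
  by rewrite !rmorphN !rmorphM fmorphV rmorph_nat; ring.
have e' : cexp ((z - 2^-1) * u%:C) = cexp (z * u%:C) * (expR (- (u / 2)))%:C.
  by rewrite -e; congr cexp; rewrite rmorphN; ring.
rewrite e e'; move: (cexp (z * u%:C)) (theta_kernel u)%:C (theta_kernel (- u))%:C => A B B'.
by move: (expR (- (u / 2)))%:C => D; case: ifP => _; field.
Qed.

End MellinTheta.

(** * Continuation to the critical line and zeros of zeta *)

Section CompletedZeta.
Context {R : realType}.
Context (zeta : R[i] -> R[i]).
Context (zetaP : is_riemann_zeta zeta).
Implicit Types (u s : R) (z w : R[i]).

(** The identity theorem asks for power series, whereas [cder_Gamma] gives only a complex
    derivative; as the Mellin transform of the first Gaussian, the factor is covered by
    [mellin_analytic]. *)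
Lemma gamma_factor_mellin z : 0 < Re z ->
  gamma_factor z = mellin (fun u => gaussian (pi * expR u) 0) z.
Proof.
move=> z0; rewrite /mellin (mellin_gaussian 0 z0).2.
by rewrite /cpow ln1 mulr0 cexp0 mul1r.
Qed.

Lemma mellin_gauss_analytic z : 0 < Re z ->
  analytic_at (mellin (fun u : R => gaussian (pi * expR u) 0)) z.
Proof.
move=> z0; have [C H] := gamma_kernel_le z0.
apply: (mellin_analytic _ z0 (C := C)) => [|u].
  apply: continuous_measurable_fun => u; apply: continuous_cvg; first exact: continuous_expR.
  apply: cvgN; apply: cvgM; last exact: cvg_cst.
  by apply: cvgM; [exact: cvg_cst|exact: continuous_expR].
apply: le_trans (H u); rewrite ler_wpM2l ?expR_ge0// ger0_norm ?expR_ge0//.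
rewrite ler_expR lerN2 expr1n mulr1 ler_peMl ?expR_ge0//.
by rewrite (le_trans _ (pi_ge2 R))// ler1n.
Qed.

Lemma theta_kernel_analytic z : analytic_at (mellin (@theta_kernel R)) z.
Proof.
have [C H] := @theta_kernel_bound R (Re z).
exact: (mellin_analytic (@theta_kernel_measurable R) ltr01 H).
Qed.

Lemma theta_kernel_mellin_conj z :
  mellin (@theta_kernel R) z^* = (mellin (@theta_kernel R) z)^*.
Proof.
have [C H] := @theta_kernel_bound R (Re z).
have I := mellin_integrable (@theta_kernel_measurable R) ltr01 H.
rewrite /mellin -(cint_conj I); congr cint; apply/funext => u.
have cm (a b : R[i]) : (a * b)^* = a^* * b^* by exact: rmorphM.
have cr (a : R) : a%:C^* = a%:C.
  by apply: complex_ext; rewrite ?cRe_conj ?cIm_conj/= ?oppr0.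
by rewrite cm -cexp_conj cm !cr.
Qed.

(** Riemann's formula multiplied by z (z - 1/2), so that only sums and products of analytic
    functions occur when it is continued from Re z > 1/2. *)
Lemma completed_zeta z : 0 < Re z -> Im z != 0 ->
  z * (z - 2^-1) * (zeta (2 * z) * gamma_factor z - mellin (@theta_kernel R) z
    - mellin (@theta_kernel R) (2^-1 - z)) = 4^-1.
Proof.
move=> z0 zi; pose W := mellin (@theta_kernel R).
pose G := mellin (fun u : R => gaussian (pi * expR u) 0).
pose H w := w * (w - 2^-1) * (zeta (2 * w) * G w - W w - W (2^-1 - w)) - 4^-1.
(* The segment runs from z + 1 leftwards to z. For t < 1/2 its real part exceeds 1/2, where the
   formula is known; the real part stays positive and the imaginary part is constant and nonzero,
   which keeps 2 w away from 1. *)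
pose f (t : R) := H (z + 1 + t%:C * (-1)).
have ReE t : Re (z + 1 + t%:C * (-1)) = Re z + 1 - t.
  by rewrite !cReD mulrN1 cReN.
have ImE t : Im (z + 1 + t%:C * (-1)) = Im z.
  by rewrite !cImD mulrN1 cImN /= oppr0 !addr0.
have aH w : 0 < Re w -> Im w != 0 -> analytic_at H w.
  move=> w0 wi.
  have a0 b c w' : analytic_at (fun w : R[i] => b + c * w) w' by exact: analytic_affine.
  have az : analytic_at (fun w => zeta (0 + 2 * w)) w.
    apply: analytic_comp_affine; apply: zetaP.2; rewrite add0r.
    apply: contra_neq wi => /(congr1 (@complex.Im R)).
    rewrite -(rmorph_nat (real_complex R)) cImMr/= => /eqP.
    by rewrite mulf_eq0 pnatr_eq0/= => /eqP.
  have aG := mellin_gauss_analytic w0.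
  have aW := theta_kernel_analytic w.
  have aW' : analytic_at (fun w => W (2^-1 + -1 * w)) w.
    by apply: analytic_comp_affine; exact: theta_kernel_analytic.
  have a1 := analyticD (analyticD (analyticM az aG)
    (analyticM (analytic_cst (-1) w) aW)) (analyticM (analytic_cst (-1) w) aW').
  have a2 := analyticM (a0 0 1 w) (a0 (- 2^-1) 1 w).
  have := analyticD (analyticM a2 a1) (analytic_cst (- 4^-1) w).
  congr (analytic_at _ w); apply/funext => w'.
  by rewrite /H /W !(add0r, mul1r, mulN1r) [- 2^-1 + _]addrC.
have f1 : f 1 = 0.
  apply: (@real_analytic_identity R f 2^-1); first by rewrite invr_gt0.
    move=> t /andP[t0 t1]; apply: analytic_real_analytic; apply: aH.
      by rewrite ReE; lra.
    by rewrite ImE.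
  move=> t /andP[t0 t2]; rewrite /f; set w := _ + _.
  have w2 : 2^-1 < Re w by rewrite /w ReE; lra.
  have w0 : 0 < Re w by apply: lt_trans w2; rewrite invr_gt0.
  have wi : Im w != 0 by rewrite /w ImE.
  have nw : w != 0 by apply: contraNneq wi => ->.
  have nw2 : w - 2^-1 != 0.
    rewrite subr_eq0; apply: contraNneq wi => ->.
    by rewrite -(rmorph_nat (real_complex R)) -fmorphV.
  rewrite /H /G -gamma_factor_mellin// zeta_mellin// mellin_split// -/W.
  move: nw nw2; move: (W w) (W (2^-1 - w)) (w - 2^-1) => a b v nw nv.
  by field; rewrite nw nv.
have e : z + 1 + (1 : R)%:C * (-1) = z by rewrite mul1r addrK.
move: f1; rewrite /f e /H /G -gamma_factor_mellin// => /eqP.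
by rewrite subr_eq0 => /eqP.
Qed.

Lemma completed_zeta_real z : Re z = 4^-1 -> Im z != 0 ->
  Im (zeta (2 * z) * gamma_factor z) = 0.
Proof.
move=> zr zi; have z0 : 0 < Re z by rewrite zr invr_gt0.
have h := completed_zeta z0 zi.
have zc : 2^-1 - z = z^*.
  have h2 : (2^-1 : R[i]) = (2^-1 : R)%:C by rewrite fmorphV rmorph_nat.
  apply: complex_ext.
    by rewrite cReD cReN cRe_conj zr h2/=; field.
  by rewrite cImD cImN cIm_conj h2/= add0r.
have nz : z != 0 by apply: contraNneq zi => ->.
have nzc : z^* != 0 by rewrite conjc_eq0.
have zz : z - 2^-1 = - z^* by rewrite -zc opprB.
have zzr : z * z^* = (cabs z ^+ 2)%:C.
  by apply: complex_ext; rewrite cabs_sqr ?cReM ?cImM ?cRe_conj ?cIm_conj/=; ring.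
have -> : zeta (2 * z) * gamma_factor z =
    mellin (@theta_kernel R) z + (mellin (@theta_kernel R) z)^* - (4 * cabs z ^+ 2)^-1%:C.
  move: h; rewrite zc theta_kernel_mellin_conj zz mulrN zzr => h.
  have c0 : (cabs z ^+ 2)%:C != 0 :> R[i] by rewrite -zzr mulf_neq0.
  have e4 (x : R) : (4 * x)^-1%:C = (4 * x%:C)^-1 by rewrite fmorphV rmorphM rmorph_nat.
  rewrite e4; move: h c0; move: (cabs z ^+ 2)%:C (mellin _ z) (mellin _ z)^* => c a b h c0.
  have -> : zeta (2 * z) * gamma_factor z = a + b + (zeta (2 * z) * gamma_factor z - a - b) by ring.
  congr (_ + _); apply: (mulfI c0); rewrite -[LHS]opprK -mulNr h.
  by field.
by rewrite cImD cImN cImD cIm_conj subrr/= subr0.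
Qed.

(** The terms after the first add up to at most 1/4, by comparing n^(-3) with 1 / ((n-1) n (n+1)),
    half of a telescoping difference. *)
Lemma zeta_neq0_right (s : R[i]) : 3 <= Re s -> zeta s != 0.
Proof.
move=> s3; have s1 : 1 < Re s by apply: lt_le_trans s3; rewrite ltr1n.
rewrite -cabs_gt0; apply: (@lt_le_trans _ _ (1 - 4^-1)).
  by rewrite subr_gt0 invf_lt1// ltr1n.
suff h : cabs (zeta s - 1) <= 4^-1.
  by have := ler_cabs_dist 1 (1 - zeta s); rewrite subKr cabs1 [cabs (1 - _)]cabsC; lra.
have c : (fun N => series (fun n => cpow n.+1%:R (- s)) N - 1) @ \oo --> zeta s - 1.
  exact: (ccvgB (zetaP.1 _ s1) (ccvg_cst _)).
apply: (cabs_lim_le c); near=> N.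
have [M ->] : exists M, N = M.+1.
  by exists N.-1; rewrite prednK//; near: N; exact: nbhs_infty_gt.
rewrite /series/= big_nat_recl//= {1}/cpow ln1 mulr0 cexp0 addrAC subrr add0r.
rewrite (le_trans (ler_cabs_sum _ _ _))//.
have key n : cabs (cpow n.+2%:R (- s)) <= 2^-1 * ((n.+1%:R * n.+2%:R)^-1 - (n.+2%:R * n.+3%:R)^-1).
  have n0 : (0 : R) <= n%:R by [].
  have l0 : 0 <= ln (n.+2%:R : R) by rewrite ln_ge0// ler1n.
  rewrite cabs_cexp [_ * _]mulrC cReMr cReN.
  apply: (@le_trans _ _ (n.+2%:R ^- 3)).
    rewrite -[n.+2%:R in leRHS]lnK ?posrE// -expRM_natl -expRN ler_expR mulrN lerN2 mulrC.
    by rewrite ler_wpM2l.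
  rewrite (_ : 2^-1 * _ = (n.+1%:R * n.+2%:R * n.+3%:R)^-1); last first.
    rewrite -!natr1; field; rewrite ?natr1 ?pnatr_eq0//.
  rewrite lef_pV2 ?posrE ?exprn_gt0 ?mulr_gt0//.
  rewrite -!natr1; nra.
rewrite (le_trans (ler_sum _ (fun n _ => key n)))// -mulr_sumr.
rewrite (_ : \sum_(0 <= n < M) _ = 2^-1 - (M.+1%:R * M.+2%:R)^-1).
  have : 0 <= (M.+1%:R * M.+2%:R : R)^-1 by rewrite invr_ge0 mulr_ge0.
  by move: (_ * _)^-1 => x x0; lra.
elim: M => [|M IH]; first by rewrite big_geq// mul1r subrr.
by rewrite big_nat_recr//= IH; ring.
Unshelve. all: by end_near. Qed.

(** Otherwise zeta vanishes on a disc about s, hence along the horizontal segment to the right, up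
    to a point of real part at least 3, where it does not vanish. *)
Lemma zeta_zeros_isolated (s : R[i]) : Im s != 0 ->
  exists2 e : R, 0 < e & forall w, w != s -> cabs (w - s) < e -> zeta w != 0.
Proof.
move=> si; have ns t : Im t != 0 -> analytic_at zeta t.
  by move=> ti; apply: zetaP.2; apply: contraNneq ti => ->.
apply: contrapT => H.
have [e e0 He] : exists2 e : R, 0 < e & forall w, cabs (w - s) < e -> zeta w = 0.
  apply: (analytic_zero (ns _ si)) => e e0; apply: contrapT => H'.
  apply: H; exists e => // w ws we; apply/negP => /eqP w0.
  by apply: H'; exists w.
pose d : R := 3 + `|Re s|.
have d0 : 0 < d by rewrite ltr_wpDr.
have : zeta (s + (1 : R)%:C * d%:C) = 0.
  apply: (@real_analytic_identity R (fun t => zeta (s + t%:C * d%:C)) (e / d)).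
  - by rewrite divr_gt0.
  - move=> t _; apply: analytic_real_analytic; apply: ns.
    by rewrite cImD -rmorphM/= addr0.
  - move=> t /andP[t0 te]; apply: He; rewrite addrAC subrr add0r -rmorphM cabs_real.
    by rewrite ger0_norm ?mulr_ge0 ?(ltW d0)// -ltr_pdivlMr.
apply/eqP; apply: zeta_neq0_right; rewrite mul1r cReD/= /d.
have := ler_norm (- Re s); rewrite normrN; lra.
Qed.

End CompletedZeta.

(** * Growth on the critical line *)

Section SquareIntegrability.
Context {R : realType}.
Implicit Types (x y : R).

(** (1 + x)^(-3/2), the square of the pointwise bound (1 + x)^(-3/4); its primitive -2 (1 +
    x)^(-1/2) has a finite limit. *)
Definition decay x : R := ((1 + x) * Num.sqrt (1 + x))^-1.

Lemma decay_ge0 x : 0 <= x -> 0 <= decay x.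
Proof. by move=> x0; rewrite invr_ge0 mulr_ge0 ?sqrtr_ge0// addr_ge0. Qed.

Lemma decay_continuous x : -1 < x -> decay y @[y --> x] --> decay x.
Proof.
move=> x1; have x0 : 0 < 1 + x by rewrite -ltrBlDl sub0r.
have h : 1 + y @[y --> x] --> 1 + x by apply: cvgD; [exact: cvg_cst|exact: cvg_id].
apply: cvgV; first by rewrite mulf_neq0// gt_eqF// sqrtr_gt0.
exact: (cvgM h (cvg_comp _ _ h (@sqrt_continuous R (1 + x)))).
Qed.

Lemma decay_primitive x : 0 <= x -> is_derive x 1 (fun y => - (2 / Num.sqrt (1 + y))) (decay x).
Proof.
move=> x0; have x1 : 0 < 1 + x by rewrite ltr_pwDl.
have h1 : is_derive x 1 (fun y : R => 1 + y) 1.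
  by have := is_deriveD (is_derive_cst (1 : R) x 1) (is_derive_id x 1); rewrite add0r.
have h2 := is_derive1_comp (is_derive1_sqrt x1) h1.
have s0 : Num.sqrt (1 + x) != 0 by rewrite gt_eqF// sqrtr_gt0.
have h3 := is_deriveV (f := fun y => Num.sqrt (1 + y)) s0 h2.
have h4 : is_derive x 1 (fun y => (-2) *: (Num.sqrt (1 + y))^-1) (decay x).
  apply: is_derive_eq; rewrite /= /decay /GRing.scale/=.
  have S2 : 1 + x = Num.sqrt (1 + x) ^+ 2 by rewrite sqr_sqrtr// ltW.
  rewrite [X in _ = (X * _)^-1]S2; move: (Num.sqrt (1 + x)) s0 => S S0.
  by field.
rewrite (_ : (fun y => _) = (fun y => (-2) *: (Num.sqrt (1 + y))^-1))//.
by apply/funext => y; rewrite /GRing.scale/= mulNr.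
Qed.

Lemma rintegrable_decay : rintegrable (fun x => decay `|x|).
Proof.
have F2 : (\int[@lebesgue_measure R]_(x in `[(0%R : R), +oo[) (decay x)%:E =
    0%:E - (- (2 / Num.sqrt (1 + 0)))%:E)%E.
  apply: (@ge0_continuous_FTC2y R decay (fun y => - (2 / Num.sqrt (1 + y))) 0 0).
  - exact: decay_ge0.
  - apply: continuous_in_subspaceT => x; rewrite inE/= in_itv/= andbT => x0.
    by apply: decay_continuous; apply: lt_le_trans x0; rewrite ltrN10.
  - rewrite -[X in _ --> X]oppr0; apply: cvgN; apply/cvgrPdist_lt => e e0.
    near=> x; have x0 : 0 < x by near: x; exact: nbhs_pinfty_gt.
    have s0 : 0 < Num.sqrt (1 + x) by rewrite sqrtr_gt0 addr_gt0.
    rewrite sub0r normrN ger0_norm ?divr_ge0 ?ltW// ltr_pdivrMr// -ltr_pdivrMl//.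
    rewrite -[ltLHS]ger0_norm ?mulr_ge0 ?invr_ge0 ?ltW// -sqrtr_sqr ltr_sqrt ?addr_gt0//.
    by rewrite (@lt_trans _ _ x) ?ltrDr//; near: x; apply: nbhs_pinfty_gt; rewrite num_real.
  - by move=> x x0; have [] := decay_primitive (ltW x0).
  - apply: cvg_at_right_filter.
    by have [+ _] := decay_primitive (lexx 0) => /derivable1_diffP /differentiable_continuous.
  move=> x; rewrite in_itv/= andbT => x0; rewrite derive1E.
  by have H := decay_primitive (ltW x0); exact: derive_val.
have mI : measurable `[(0 : R), +oo[ by exact: measurable_itv.
have I1 : (@lebesgue_measure R).-integrable `[0, +oo[ (EFin \o decay).
  apply/integrableP; split.
    apply/measurable_EFinP; apply: subspace_continuous_measurable_fun => //.
    apply: continuous_in_subspaceT => x; rewrite inE/= in_itv/= andbT => x0.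
    by apply: decay_continuous; apply: lt_le_trans x0; rewrite ltrN10.
  rewrite [ltLHS](_ : _ = (\int[@lebesgue_measure R]_(x in `[(0%R : R), +oo[) (decay x)%:E)%E).
    by rewrite F2 ltry.
  apply: eq_integral => x; rewrite inE/= in_itv/= andbT => x0.
  by rewrite ger0_norm// decay_ge0.
have Ip : rintegrable (fun x => if 0 <= x then decay x else 0).
  have := (@integrable_mkcond _ _ R (@lebesgue_measure R) `[(0 : R), +oo[ (EFin \o decay) mI).1 I1.
  rewrite /rintegrable.
  congr (_.-integrable _ _); apply/funext => x; rewrite patchE/=.
  case: ifPn; first by rewrite inE/= in_itv/= andbT => ->.
  by rewrite notin_setE/= in_itv/= andbT => /negP/negPf ->.
have [_ Im] := rint_opp Ip.
apply: rintegrable_le (rintegrableD Ip Im).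
  apply: continuous_measurable_fun => x.
  have h : `|y| @[y --> x] --> `|x| by exact: norm_continuous.
  apply: (cvg_comp (fun y : R => `|y|) decay h); apply: decay_continuous.
  by rewrite (lt_le_trans _ (normr_ge0 x))// ltrN10.
move=> x; rewrite ger0_norm ?decay_ge0//; have [x0|x0] := leP 0 x.
  by rewrite ger0_norm// lerDl; case: ifP => // h; exact: decay_ge0.
by rewrite ltr0_norm// oppr_ge0 (ltW x0) add0r.
Unshelve. all: by end_near. Qed.

Lemma qrootX6 x : 0 <= x -> qroot (1 + x) ^+ 6 = (1 + x) * Num.sqrt (1 + x).
Proof.
move=> x0; have x1 : 0 <= 1 + x by rewrite addr_ge0.
by rewrite (exprD _ 4 2) qrootX4// /qroot sqr_sqrtr// sqrtr_ge0.
Qed.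

Lemma measurable_fun_countable (D : set R) (f : R -> R) : countable D ->
  measurable_fun D f.
Proof.
move=> cD mD Y mY; apply: countable_measurable; first by move=> u; exact: measurable_set1.
by apply: sub_countable cD; apply: subset_card_le; exact: subIsetl.
Qed.

(** A countable D is null and every function is measurable on it, so the values of f on D are
    immaterial; continuity on the open complement gives measurability there. *)
Lemma L2_of_bound (f : R -> R[i]) (D : set R) (C : R) : countable D -> open (~` D) ->
  (forall x, ~ D x -> f y @[y --> x] --> f x) ->
  (forall x, ~ D x -> cabs (f x) <= C * qroot (1 + `|x|) ^- 3) -> L2 f.
Proof.
move=> cD oD cf bf.
have mD : measurable D.
  by apply: countable_measurable => // u; exact: measurable_set1.
have mf (h : R[i] -> R) : (forall x, ~ D x -> h (f y) @[y --> x] --> h (f x)) ->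
    measurable_fun [set: R] (fun x => h (f x)).
  move=> ch; rewrite -(setvU D); apply/measurable_funU => //; first exact: measurableC.
  split; last exact: measurable_fun_countable.
  by apply: open_continuous_measurable_fun => // x /set_mem /ch.
have mr : measurable_fun [set: R] (fun x => Re (f x)).
  by apply: mf => x Dx; exact: cvg_Re (cf x Dx).
have mi : measurable_fun [set: R] (fun x => Im (f x)).
  by apply: mf => x Dx; exact: cvg_Im (cf x Dx).
split=> //.
have /integrableP[mg Ig] := rintegrableZ (C ^+ 2) rintegrable_decay.
apply: le_lt_trans Ig; apply: ae_ge0_le_integral => //.
- by move=> x _; rewrite lee_fin sqr_ge0.
- apply/measurable_EFinP.
  rewrite (_ : (fun x => _) = fun x => Re (f x) * Re (f x) +
    Im (f x) * Im (f x)).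
    by apply: measurable_funD; exact: measurable_funM.
  by apply/funext => x; rewrite -!expr2 -cabs_sqr.
- by apply: measurableT_comp => //; exact: measurable_normr.
exists D; split=> //; first exact: countable_lebesgue_measure0.
move=> x /=; apply: contra_notP => Dx _; rewrite lee_fin.
have x1 : 0 < qroot (1 + `|x|) by rewrite qroot_gt0// ltr_pwDl.
rewrite (le_trans _ (ler_norm _))// -/(cabs (f x)).
have -> : C ^+ 2 * decay `|x| = (C / qroot (1 + `|x|) ^+ 3) ^+ 2.
  by rewrite /decay -qrootX6// exprMn exprVn -exprM.
by rewrite lerXn2r ?nnegrE ?cabs_ge0 ?(le_trans (cabs_ge0 (f x)))// bf.
Qed.

Lemma countable_discrete (D : set R) :
  (forall x, D x -> exists2 e : R, 0 < e & forall y, D y -> `|y - x| < e -> y = x) ->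
  countable D.
Proof.
move=> iD; apply: sub_countable (countable_isolated D); apply: subset_card_le => x Dx.
have [e e0 He] := iD x Dx; split; first exact: mem_set.
exists (ball x e); first exact: nbhsx_ballx.
apply/seteqP; split=> [y [/= xy Dy]|y ->]; last by split => //; exact: ballxx.
by apply: He => //; rewrite distrC.
Qed.

End SquareIntegrability.

Lemma ccvg_near_eq {R : realType} {T : Type} {F : set_system T} {FF : Filter F}
    (f g : T -> R[i]) (l : R[i]) :
  (\forall x \near F, f x = g x) -> g @ F --> l -> f @ F --> l.
Proof.
move=> fg gl; apply: cvg_trans gl; apply: near_eq_cvg.
by apply: filterS fg => x ->.
Qed.

(** * The xi-function near the critical line *)

Section XiFunction.
Context {R : realType}.
Context (zeta : R[i] -> R[i]).
Context (zetaP : is_riemann_zeta zeta).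
Implicit Types (s z w : R[i]) (x : R).

Lemma dnbhs_proper z : ProperFilter (z^').
Proof. exact: (@Proper_dnbhs_numFieldType _ z). Qed.

Lemma fill_eq (f : R[i] -> R[i]) z : f w @[w --> z] --> f z -> fill f z = f z.
Proof.
move=> fz; apply: (@ccvg_lim R _ _ (dnbhs_proper z)).
by apply: cvg_trans fz; apply: cvg_app; exact: cvg_within.
Qed.

Definition xi_factor s : R[i] := 2^-1 * s * (s - 1) * cpow pi (- (s / 2)) * Gamma (s / 2).
(** The logarithmic derivative of [xi_factor], to be subtracted from xi'/xi to obtain zeta'/zeta. *)
Definition xi_logder s : R[i] := s^-1 + (s - 1)^-1 - (ln pi / 2)%:C + 2^-1 * psi (s / 2).

Lemma half_Re s : Re (s / 2) = Re s / 2.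
Proof.
by rewrite mulrC -(rmorph_nat (real_complex R)) -fmorphV cReMr mulrC.
Qed.

Lemma half_Im s : Im (s / 2) = Im s / 2.
Proof.
by rewrite mulrC -(rmorph_nat (real_complex R)) -fmorphV cImMr mulrC.
Qed.

Lemma cder_xi_factor s : 0 < Re s -> s - 1 != 0 ->
  cder xi_factor s (xi_factor s * xi_logder s).
Proof.
move=> s0 s1; have sn0 : s != 0 by apply: contraTneq s0 => ->; rewrite /= ltxx.
have h1 : cder (fun w : R[i] => 2^-1 * w) s (2^-1 * 1) := cderZ 2^-1 (cder_id s).
have h2 : cder (fun w : R[i] => w - 1) s (1 + 0) := cderD (cder_id s) (cder_cst (-1) s).
have h3 : cder (fun w : R[i] => cpow pi (- (w / 2))) s
    (cpow pi (- (s / 2)) * (ln pi)%:C * (- 2^-1)).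
  have h := cder_affine (a := 0) (b := - 2^-1) (z := s) (cder_cpow (pi : R) _).
  have E w : 0 + - 2^-1 * w = - (w / 2) by rewrite add0r mulNr mulrC.
  by move: h; rewrite E; apply: cder_near; near=> w; rewrite E.
have h4 : cder (fun w : R[i] => Gamma (w / 2)) s (Gamma (s / 2) * psi (s / 2) * 2^-1).
  have s2 : 0 < Re (0 + 2^-1 * s) by rewrite add0r mulrC half_Re divr_gt0.
  have h := cder_affine (a := 0) (b := 2^-1) (z := s) (cder_Gamma s2).
  have E w : 0 + 2^-1 * w = w / 2 by rewrite add0r mulrC.
  by move: h; rewrite E; apply: cder_near; near=> w; rewrite E.
have H := cderM (cderM (cderM h1 h2) h3) h4.
apply: cder_eq H _.
have l2 : (ln pi / 2)%:C = (ln pi)%:C / 2 :> R[i] by rewrite rmorphM fmorphV rmorph_nat.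
rewrite /xi_factor /xi_logder l2; move: (cpow _ _) (Gamma _) (psi _) (ln pi)%:C => c g p l.
by field; rewrite sn0 s1.
Unshelve. all: by end_near. Qed.

Lemma zeta_derivable s : Im s != 0 -> cder zeta s (derive1 zeta s).
Proof.
move=> si; have az : analytic_at zeta s.
  by apply: zetaP.2; apply: contraNneq si => ->.
have [g [r r0 [K K0 [hg _]]]] := analytic_cder az.
have h : cder zeta s (g s) by apply: hg; rewrite subrr cabs0.
by rewrite (derive1_cder h).
Qed.

Lemma derive1_zeta_continuous s : Im s != 0 ->
  derive1 zeta w @[w --> s] --> derive1 zeta s.
Proof.
move=> si; have az : analytic_at zeta s.
  by apply: zetaP.2; apply: contraNneq si => ->.
have [g [r r0 [K K0 [hg hK]]]] := analytic_cder az.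
have ss : cabs (s - s) < r by rewrite subrr cabs0.
apply/(cabs_cvgP (F := nbhs s)) => e e0.
apply/nbhs_cabsP; exists (Num.min r (e / (K + 1))).
  by rewrite lt_min r0/= divr_gt0// ltr_wpDl.
move=> w; rewrite lt_min => /andP[wr we].
rewrite (derive1_cder (hg _ ss)) (derive1_cder (hg _ wr)).
rewrite (le_lt_trans (hK _ _ ss wr))// cabsC.
rewrite ltr_pdivlMr ?ltr_wpDl// in we; apply: le_lt_trans we.
by rewrite mulrC ler_wpM2l ?cabs_ge0// lerDl.
Qed.

Lemma near_Im_neq0 s : Im s != 0 -> \forall w \near s, Im w != 0.
Proof.
move=> si; apply/nbhs_cabsP; exists `|Im s|; first by rewrite normr_gt0.
move=> w; apply: contraTneq => wi; rewrite -leNgt.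
by rewrite (le_trans _ (ler_cabs_Im _))// cImD cImN wi sub0r normrN.
Qed.

Lemma subr1_neq0 s : Im s != 0 -> s - 1 != 0.
Proof. by move=> si; rewrite subr_eq0; apply: contraNneq si => ->. Qed.

Lemma near_regular s : 0 < Re s -> Im s != 0 ->
  \forall w \near s, 0 < Re w /\ Im w != 0.
Proof. by move=> /near_Re_gt s0 /near_Im_neq0; apply: filterS2 s0. Qed.

Lemma cder_xi_prod s : 0 < Re s -> Im s != 0 ->
  cder (fun w => xi_factor w * zeta w) s
    (xi_factor s * (xi_logder s * zeta s + derive1 zeta s)).
Proof.
move=> s0 si.
have H := cderM (cder_xi_factor s0 (subr1_neq0 si)) (zeta_derivable si).
by apply: cder_eq H _; ring.
Qed.

Lemma xiE s : 0 < Re s -> Im s != 0 -> xi zeta s = xi_factor s * zeta s.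
Proof. by move=> s0 si; apply: fill_eq; exact: cder_continuous (cder_xi_prod s0 si). Qed.

Lemma cder_xi s : 0 < Re s -> Im s != 0 ->
  cder (xi zeta) s (xi_factor s * (xi_logder s * zeta s + derive1 zeta s)).
Proof.
move=> s0 si; apply: cder_near (cder_xi_prod s0 si).
by apply: filterS (near_regular s0 si) => w [w0 wi]; exact: xiE.
Qed.

Lemma xi_logder_continuous s : 0 < Re s -> Im s != 0 ->
  xi_logder w @[w --> s] --> xi_logder s.
Proof.
move=> s0 si; have sn0 : s != 0 by apply: contraTneq s0 => ->; rewrite /= ltxx.
have s1 := subr1_neq0 si; have id := ccvg_id s.
have c1 : (fun w : R[i] => w^-1) @ s --> s^-1 by exact: (ccvgV sn0 id).
have c2 : (fun w : R[i] => w - 1) @ s --> s - 1 by exact: (ccvgB id (ccvg_cst 1)).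
have c2' : (fun w : R[i] => (w - 1)^-1) @ s --> (s - 1)^-1 by exact: (ccvgV s1 c2).
have c3 : (fun w : R[i] => w / 2) @ s --> s / 2 by exact: (ccvgM id (ccvg_cst 2^-1)).
have s2 : 0 < Re (s / 2) by rewrite half_Re divr_gt0.
have c4 : (fun w : R[i] => psi (w / 2)) @ s --> psi (s / 2) by exact: (cvg_comp _ _ c3 (psi_continuous s2)).
exact: (ccvgD (ccvgB (ccvgD c1 c2') (ccvg_cst (ln pi / 2)%:C)) (ccvgM (ccvg_cst 2^-1) c4)).
Qed.

Definition critical z : R[i] := 2^-1 - 'i%C * z.

Lemma critical_continuous z : critical w @[w --> z] --> critical z.
Proof. exact: (ccvgB (ccvg_cst 2^-1) (ccvgM (ccvg_cst 'i%C) (ccvg_id z))). Qed.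

Lemma E_xi_continuous z : 0 < Re (critical z) -> Im (critical z) != 0 ->
  E_xi zeta w @[w --> z] --> E_xi zeta z.
Proof.
move=> z0 zi; have cz : critical w @[w --> z] --> critical z by exact: critical_continuous.
have h1 : xi zeta s @[s --> critical z] --> xi zeta (critical z).
  exact: cder_continuous (cder_xi z0 zi).
pose d s := xi_factor s * (xi_logder s * zeta s + derive1 zeta s).
have cA : xi_factor s @[s --> critical z] --> xi_factor (critical z).
  exact: cder_continuous (cder_xi_factor z0 (subr1_neq0 zi)).
have cZ : zeta s @[s --> critical z] --> zeta (critical z).
  exact: cder_continuous (zeta_derivable zi).
have cd : d s @[s --> critical z] --> d (critical z).
  exact: (ccvgM cA (ccvgD (ccvgM (xi_logder_continuous z0 zi) cZ) (derive1_zeta_continuous zi))).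
have h2 : derive1 (xi zeta) s @[s --> critical z] --> derive1 (xi zeta) (critical z).
  have e : \forall s \near critical z, derive1 (xi zeta) s = d s.
    by apply: filterS (near_regular z0 zi) => w [w0 wi]; exact: derive1_cder (cder_xi w0 wi).
  rewrite (derive1_cder (cder_xi z0 zi)); exact: (ccvg_near_eq e cd).
exact: (ccvgD (cvg_comp _ _ cz h1) (cvg_comp _ _ cz h2)).
Qed.

Lemma critical_real x : critical x%:C = 2^-1 +i* (- x).
Proof.
have h2 : (2^-1 : R[i]) = (2^-1 : R)%:C by rewrite fmorphV rmorph_nat.
by rewrite /critical h2; simpc.
Qed.

Lemma Re_critical x : Re (critical x%:C) = 2^-1.
Proof. by rewrite critical_real. Qed.

Lemma Re_critical_gt0 x : 0 < Re (critical x%:C).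
Proof. by rewrite Re_critical invr_gt0. Qed.

Lemma Im_critical x : x != 0 -> Im (critical x%:C) != 0.
Proof. by rewrite critical_real/= oppr_eq0. Qed.

Lemma xi_factor_neq0 x : x != 0 -> xi_factor (critical x%:C) != 0.
Proof.
move=> x0; have s0 := Re_critical_gt0 x; have si := Im_critical x0.
have sn0 : critical x%:C != 0 by apply: contraTneq s0 => ->; rewrite /= ltxx.
apply: mulf_neq0; last by rewrite Gamma_neq0// half_Re divr_gt0.
apply: mulf_neq0; last exact: cexp_neq0.
by apply: mulf_neq0; [apply: mulf_neq0; rewrite // invr_eq0 pnatr_eq0|exact: subr1_neq0].
Qed.

(** The polynomial factor is real too: s (s - 1) = - (1/4 + x^2) on the line. *)
Lemma xi_real x : x != 0 -> Im (xi zeta (critical x%:C)) = 0.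
Proof.
move=> x0; have s0 := Re_critical_gt0 x; have si := Im_critical x0.
rewrite xiE//; set s := critical _ in s0 si *.
have zr : Re (s / 2) = 4^-1 by rewrite half_Re Re_critical; field.
have zi : Im (s / 2) != 0 by rewrite half_Im mulf_neq0// invr_eq0 pnatr_eq0.
have h := completed_zeta_real zetaP zr zi.
have e2 : 2 * (s / 2) = s by rewrite mulrC divfK// pnatr_eq0.
rewrite e2 in h.
have -> : xi_factor s * zeta s = (2^-1 * (- (4^-1 + x ^+ 2)))%:C * (zeta s * gamma_factor (s / 2)).
  rewrite /xi_factor /gamma_factor.
  have -> : (2^-1 * (- (4^-1 + x ^+ 2)))%:C = 2^-1 * s * (s - 1).
    rewrite /s critical_real rmorphM fmorphV rmorph_nat -mulrA; congr (_ * _).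
    by apply: complex_ext; rewrite ?cReM ?cImM /=; field.
  move: (cpow _ _) (Gamma _) => c g; ring.
by rewrite cImMr h mulr0.
Qed.

(** Im xi vanishes along the line, and its derivative in x there is Im (- i xi') = - Re xi'. *)
Lemma derive1_xi_imaginary x : x != 0 ->
  Re (derive1 (xi zeta) (critical x%:C)) = 0.
Proof.
move=> x0; have s0 := Re_critical_gt0 x; have si := Im_critical x0.
have E u : 2^-1 + u%:C * - 'i%C = critical u%:C by rewrite /critical mulrN mulrC.
have H := cder_xi s0 si; rewrite (derive1_cder H); set d := _ * _ in H *.
rewrite -E in H; have [_ [Dh dh]] := cder_path H.
have h0 : \forall u \near x, Im (xi zeta (2^-1 + u%:C * - 'i%C)) = (cst 0 : R -> R) u.
  near=> u; rewrite E /= xi_real//.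
  by near: u; apply: open_nbhs_nbhs; split => //; exact: open_neq.
have : 'D_1 (fun u : R => Im (xi zeta (2^-1 + u%:C * - 'i%C))) x = 'D_1 (cst 0 : R -> R) x.
  by apply: near_eq_derive.
have hi (e : R[i]) : Im (e * - 'i%C) = - Re e.
  by rewrite cImM /= oppr0 mulr0 addr0 mulrN mulr1.
by rewrite dh derive_cst hi => /eqP; rewrite oppr_eq0 => /eqP.
Unshelve. all: by end_near. Qed.

Lemma sharp_ThetaE z : sharp (Theta_xi zeta) z = E_xi zeta z / (E_xi zeta z^*)^*.
Proof.
have cm (a b : R[i]) : (a * b)^* = a^* * b^* by exact: rmorphM.
have ck (a : R[i]) : a^*^* = a by exact: conjCK.
have cv (a : R[i]) : (a^-1)^* = (a^*)^-1 by exact: fmorphV.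
by rewrite /sharp /Theta_xi /sharp cm !ck cv.
Qed.

End XiFunction.

(** * Decay of the elementary, digamma and Lerch terms *)

Section Growth.
Context {R : realType}.
Implicit Types (x y : R) (f g : R -> R[i]) (z w : R[i]).

Definition weight x : R := qroot (1 + `|x|).

Lemma weight_ge1 x : 1 <= weight x.
Proof. by rewrite -[leLHS]qroot1 ler_qroot// lerDl. Qed.

Lemma weight_gt0 x : 0 < weight x.
Proof. exact: lt_le_trans (weight_ge1 x). Qed.

Lemma weightX4 x : weight x ^+ 4 = 1 + `|x|.
Proof. by rewrite qrootX4// addr_ge0. Qed.

(** The order O((1 + |x|)^(-k/4)), counted in quarters. The point 0 is left out because the formulas
    divide by x. *)
Definition decays (k : nat) f := exists2 C : R, 0 <= C &
  forall x, x != 0 -> cabs (f x) <= C * weight x ^- k.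

Lemma decaysD k f g : decays k f -> decays k g -> decays k (fun x => f x + g x).
Proof.
move=> [C C0 fC] [B B0 gB]; exists (C + B); first exact: addr_ge0.
by move=> x x0; rewrite mulrDl (le_trans (ler_cabsD _ _))// lerD ?fC ?gB.
Qed.

Lemma decaysZ k (c : R[i]) f : decays k f -> decays k (fun x => c * f x).
Proof.
move=> [C C0 fC]; exists (cabs c * C); first by rewrite mulr_ge0 ?cabs_ge0.
by move=> x x0; rewrite cabsM -mulrA ler_wpM2l ?cabs_ge0 ?fC.
Qed.

Lemma decays_le j k f : (j <= k)%N -> decays k f -> decays j f.
Proof.
move=> jk [C C0 fC]; exists C => // x x0; rewrite (le_trans (fC x x0))// ler_wpM2l//.
by rewrite lef_pV2 ?posrE ?exprn_gt0 ?weight_gt0// ler_weXn2l ?weight_ge1.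
Qed.

Lemma decays_sum k (I : Type) (r : seq I) (F : I -> R -> R[i]) :
  (forall i, decays k (F i)) -> decays k (fun x => \sum_(i <- r) F i x).
Proof.
move=> dF; elim: r => [|i r IH].
  by exists 0 => // x _; rewrite big_nil cabs0 mul0r.
have [C C0 h] := decaysD (dF i) IH; exists C => // x x0.
by rewrite big_cons; exact: h.
Qed.

Lemma decays_affine_inv (c : R) : c != 0 -> decays 4 (fun x => (1 + (c%:C * 'i%C) * x%:C)^-1).
Proof.
move=> c0; exists (1 + `|c|^-1) => [|x _]; first by rewrite addr_ge0// invr_ge0.
have cp : 0 < `|c| by rewrite normr_gt0.
set z := 1 + _; have zE : z = 1 +i* (c * x) by rewrite /z; simpc.
have z1 : 1 <= cabs z by have := ler_cabs_Re z; rewrite zE/= normr1.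
have z2 : `|c| * `|x| <= cabs z by have := ler_cabs_Im z; rewrite zE/= normrM.
have z0 : 0 < cabs z by exact: lt_le_trans z1.
have x1 : 0 < 1 + `|x| by rewrite ltr_pwDl.
rewrite weightX4 cabsV ler_pdivlMr// mulrC ler_pdivrMr// mulrDl mul1r lerD//.
by rewrite ler_pdivlMl.
Qed.

Definition diffquot (tau : R) z : R[i] := (cexp (- ('i%C * z * tau%:C)) - 1) / ('i%C * z).

(** The numerator is at most 2, because the exponential has modulus 1, and at most L |x|, by the
    Lipschitz bound near 0; together they give (L + 2) |x| / (1 + |x|). *)
Lemma decays_diffquot (tau : R) : decays 4 (fun x => diffquot tau x%:C).
Proof.
pose L : R := 2 * expR 1 * `|tau|.
have L0 : 0 <= L by rewrite !mulr_ge0// expR_ge0.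
exists (L + 2) => [|x x0]; first by rewrite addr_ge0.
have xp : 0 < `|x| by rewrite normr_gt0.
have x1 : 0 < 1 + `|x| by rewrite ltr_pwDl.
rewrite /diffquot cabs_div [cabs ('i%C * _)]cabsM cabsi mul1r cabs_real weightX4.
rewrite ler_pdivrMr// [leRHS]mulrAC ler_pdivlMr//.
set w := - _; have cw : cabs w = `|x| * `|tau|.
  by rewrite /w cabsN !cabsM cabsi mul1r !cabs_real.
have n2 : cabs (cexp w - 1) <= 2.
  rewrite (le_trans (ler_cabsB _ _))// cabs1 cabs_cexp -[X in _ <= X]/(1 + 1) lerD2r.
  rewrite (_ : Re w = 0) ?expR0// /w cReN -mulrA mulrC -rmorphM cReMr/= mulr0 oppr0//.
have nL : cabs (cexp w - 1) <= L * `|x|.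
  have [w1|w1] := ltP (cabs w) 1.
    rewrite -cexp0 (le_trans (@cexp_dist_le R 1 0 w _ w1)) ?cabs0// subr0 cw.
    by rewrite /L -!mulrA [`|tau| * _]mulrC.
  rewrite (le_trans n2)// /L -!mulrA [`|tau| * _]mulrC -cw ler_peMr//.
  by rewrite -[1]mulr1 ler_pM// -[leLHS]expR0 ler_expR.
by rewrite mulrDr mulr1 mulrDl lerD// ler_wpM2r.
Qed.

Definition quarter z : R[i] := 4^-1 - 'i%C * z / 2.

Lemma quarter_real x : quarter x%:C = 4^-1 +i* (- (x / 2)).
Proof.
have h2 : (2^-1 : R[i]) = (2^-1 : R)%:C by rewrite fmorphV rmorph_nat.
have h4 : (4^-1 : R[i]) = (4^-1 : R)%:C by rewrite fmorphV rmorph_nat.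
by rewrite /quarter h2 h4; simpc.
Qed.

Lemma Re_quarter_gt0 x : 0 < Re (quarter x%:C).
Proof. by rewrite quarter_real/= invr_gt0. Qed.

Lemma Re_quarter0_gt0 : 0 < Re (4^-1 : R[i]).
Proof.
have -> : (4^-1 : R[i]) = (4^-1 : R)%:C by rewrite fmorphV rmorph_nat.
by rewrite /= invr_gt0.
Qed.

(* k + 1 + |x| >= (k + 1)^(1/4) (1 + |x|)^(3/4): the first factor makes the series
   over k converge, the second one is the decay in x. *)
Lemma cabs_quarter_addn x k :
  qroot k.+1%:R * weight x ^+ 3 <= 8 * cabs (quarter x%:C + k%:R).
Proof.
pose u : R := k.+1%:R + `|x|.
have k0 : (0 : R) <= k%:R by [].
have k1 : (1 : R) <= k.+1%:R by rewrite ler1n.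
have u0 : 0 <= u by rewrite addr_ge0.
apply: (@le_trans _ _ u).
  rewrite -[leRHS](qrootX4 u0) (exprS (qroot u) 3) ler_pM ?qroot_ge0 ?exprn_ge0 ?(ltW (weight_gt0 x))//.
    by rewrite ler_qroot// lerDl.
  by rewrite lerXn2r ?nnegrE ?qroot_ge0 ?(ltW (weight_gt0 x))// ler_qroot// lerD2r.
have r1 := ler_cabs_Re (quarter x%:C + k%:R); have r2 := ler_cabs_Im (quarter x%:C + k%:R).
move: r1 r2; rewrite cReD cImD quarter_real -(rmorph_nat (real_complex R))/= addr0 normrN.
have -> : `|x / 2| = `|x| / 2 by rewrite normrM (ger0_norm (x := 2^-1)) ?invr_ge0.
have := ler_norm (4^-1 + k%:R : R); move: (`|4^-1 + _|) (cabs _) => d c h0 h1 h2.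
by rewrite /u -natr1; lra.
Qed.

Lemma decays_dgsum (q : R) : 0 <= q <= 1 -> decays 3 (fun x => dgsum q (quarter x%:C) 4^-1).
Proof.
(* 32 = 8 * 4: the 8 comes from [cabs_quarter_addn], the 4 from k + 1 <= 4 |1/4 + k|. *)
move=> q01; have /andP[q0 q1] := q01; pose S : R := limn (series (fun k => 32 * qterm k)).
have t0 k : 0 <= 32 * qterm k :> R by rewrite mulr_ge0 ?qterm_ge0.
have S0 : 0 <= S.
  by apply: limr_ge; [exact: cvg_series_qtermZ|apply: nearW => n; rewrite sumr_ge0].
exists S => // x _; have w3 : 0 < weight x ^+ 3 by rewrite exprn_gt0 ?weight_gt0.
have h := dgsum_cvg q01 (Re_quarter_gt0 x) Re_quarter0_gt0.
apply: (cabs_lim_le h); apply: nearW => N.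
have bd k : cabs (dgterm q (quarter x%:C) 4^-1 k) <= (32 * qterm k) * weight x ^- 3.
  have kq : 0 < qroot (k.+1%:R : R) by rewrite qroot_gt0.
  have c1 := cabs_quarter_addn x k.
  have c1p : 0 < cabs (quarter x%:C + k%:R).
    by rewrite -(pmulr_rgt0 _ (ltr0n R 8)); apply: lt_le_trans c1; rewrite mulr_gt0.
  have c2 : k.+1%:R <= 4 * cabs ((4^-1 : R[i]) + k%:R).
    have := ler_cabs_Re ((4^-1 : R[i]) + k%:R).
    have -> : (4^-1 : R[i]) = (4^-1 : R)%:C by rewrite fmorphV rmorph_nat.
    have k0 : (0 : R) <= k%:R by [].
    rewrite -(rmorph_nat (real_complex R)) -rmorphD/= ger0_norm ?addr_ge0 ?invr_ge0// => h1.
    by rewrite -natr1; lra.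
  have c2p : 0 < cabs ((4^-1 : R[i]) + k%:R).
    by rewrite -(pmulr_rgt0 _ (ltr0n R 4)); apply: lt_le_trans c2; rewrite ltr0n.
  rewrite /dgterm cabs_div cabsM cabs_real ger0_norm ?exprn_ge0//.
  rewrite ler_pdivrMr ?mulr_gt0//; apply: (@le_trans _ _ 1).
    by rewrite exprn_ile1.
  have gen (a b c d e : R) : 0 < c -> 0 < d -> 0 < e -> d * c * e <= 8 * a * (4 * b) ->
      1 <= 32 * (e * d)^-1 / c * (a * b).
    move=> c0 d0 e0 abcd; have -> : 32 / (e * d) / c * (a * b) = (8 * a * (4 * b)) / (d * c * e).
      by field; rewrite !gt_eqF.
    by rewrite ler_pdivlMr ?mulr_gt0// mul1r.
  apply: gen => //; exact: (ler_pM (mulr_ge0 (ltW kq) (ltW w3)) (ler0n R k.+1) c1 c2).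
rewrite (le_trans (ler_cabs_sum _ _ _))// (le_trans (ler_sum _ (fun k _ => bd k)))//.
rewrite -mulr_suml ler_wpM2r ?invr_ge0 ?(ltW w3)//.
exact: (series_le_lim N t0 (cvg_series_qtermZ _)).
Qed.

(** The factor i x / 2 cancels the prefactor 1 / (2 i x) of the digamma bracket, leaving a multiple
    of the decaying [dgsum]. *)
Lemma psi_quarterB x : psi (quarter x%:C) - psi 4^-1 =
  - ('i%C * x%:C / 2) * dgsum 1 (quarter x%:C) 4^-1.
Proof.
rewrite psiB ?Re_quarter_gt0 ?Re_quarter0_gt0//; congr (_ * _).
by rewrite /quarter addrAC subrr add0r.
Qed.

(** A factor |x| times the decay (1 + |x|)^(-3/4) of [dgsum]. *)
Lemma psi_growth : exists2 C : R, 0 <= C & forall x, x != 0 -> cabs (psi (quarter x%:C)) <= C * weight x.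
Proof.
have q01 : 0 <= (1 : R) <= 1 by rewrite lexx ler01.
have [S S0 HS] := decays_dgsum q01.
exists (cabs (psi (4^-1 : R[i])) + S) => [|x x0]; first by rewrite addr_ge0 ?cabs_ge0.
have w0 := weight_gt0 x; have w1 := weight_ge1 x.
rewrite -(subrK (psi 4^-1) (psi (quarter x%:C))) psi_quarterB addrC.
rewrite (le_trans (ler_cabsD _ _))// mulrDl lerD//.
  by rewrite ler_peMr// cabs_ge0.
rewrite cabsM cabsN cabs_div cabsM cabsi mul1r cabs_real cabs_nat.
rewrite (le_trans (ler_wpM2l _ (HS x x0))) ?divr_ge0// mulrCA ler_wpM2l//.
rewrite ler_pdivrMr ?exprn_gt0// -exprS weightX4.
have := normr_ge0 x; lra.
Qed.

Lemma xi_logder_growth : exists2 C : R, 0 <= C &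
  forall x, x != 0 -> cabs (xi_logder (critical x%:C)) <= C * weight x.
Proof.
have [C C0 HC] := psi_growth.
exists (4 + cabs ((ln pi / 2)%:C : R[i]) + C) => [|x x0]; first by rewrite !addr_ge0 ?cabs_ge0.
have w1 := weight_ge1 x; rewrite /xi_logder.
have E : critical x%:C / 2 = quarter x%:C.
  by rewrite /critical /quarter; field.
have a1 : cabs (critical x%:C)^-1 <= 2.
  rewrite cabsV -[leRHS]invrK lef_pV2 ?posrE ?invr_gt0//.
    by rewrite (le_trans _ (ler_cabs_Re _))// Re_critical ger0_norm// invr_ge0.
  by rewrite cabs_gt0; apply: contraNneq (Im_critical x0) => ->.
have a2 : cabs (critical x%:C - 1)^-1 <= 2.
  rewrite cabsV -[leRHS]invrK lef_pV2 ?posrE ?invr_gt0//.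
    rewrite (le_trans _ (ler_cabs_Re _))// cReD Re_critical/= ler0_norm; lra.
  by rewrite cabs_gt0 subr1_neq0// Im_critical.
have a3 : cabs (2^-1 * psi (critical x%:C / 2)) <= C * weight x.
  rewrite E cabsM (le_trans _ (HC x x0))// ler_piMl ?cabs_ge0//.
  by rewrite cabsV cabs_nat invf_le1// ler1n.
have := ler_cabsD ((critical x%:C)^-1 + (critical x%:C - 1)^-1 - (ln pi / 2)%:C)
  (2^-1 * psi (critical x%:C / 2)).
have := ler_cabsB ((critical x%:C)^-1 + (critical x%:C - 1)^-1) (ln pi / 2)%:C.
have := ler_cabsD (critical x%:C)^-1 (critical x%:C - 1)^-1.
have := cabs_ge0 ((ln pi / 2)%:C : R[i]).
move: a1 a2 a3; move: (cabs _^-1) (cabs _^-1) (cabs (_ * _)) (cabs _%:C) => a b c d a1 a2 a3 d0.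
by move: (cabs _) (cabs _) (cabs _) => e f g; nra.
Qed.

End Growth.

(** * Estimate and continuity of the function of the statement *)

Section Screw.
Context {R : realType}.
Context (zeta : R[i] -> R[i]).
Context (zetaP : is_riemann_zeta zeta).
Implicit Types (s z w : R[i]) (x t : R).

(** The case t = 0 is included: the bracket is then the limit of differences with q < 1, and [dgsum]
    is continuous from the left at q = 1 along q = e^(-2u). *)
Lemma lerch_bracketE t z : 0 <= t -> 0 < Re (quarter z) ->
  lerch_bracket t z = ('i%C * z / 2) * dgsum (expR (- (2 * t))) (quarter z) 4^-1.
Proof.
move=> t0 z0; rewrite /lerch_bracket.
have qE : 2^-1 * (2^-1 - 'i%C * z) = quarter z by rewrite /quarter; field.
have bE u : 0 < u -> lerch (expR (- (2 * u)))%:C 1 (2^-1 * (2^-1 - 'i%C * z)) -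
    lerch (expR (- (2 * u)))%:C 1 4^-1 =
    ('i%C * z / 2) * dgsum (expR (- (2 * u))) (quarter z) 4^-1.
  move=> u0; rewrite qE lerchE ?Re_quarter0_gt0//; last first.
    by rewrite expR_ge0/= expR_lt1 oppr_lt0 mulr_gt0.
  by rewrite /quarter opprB addrC subrK.
case: eqVneq => [->|tn0]; last by apply: bE; rewrite lt_neqAle eq_sym tn0.
have c : ('i%C * z / 2) * dgsum (expR (- (2 * u))) (quarter z) 4^-1 @[u --> 0^'+] -->
    ('i%C * z / 2) * dgsum 1 (quarter z) 4^-1.
  exact: (ccvgM (ccvg_cst _) (dgsum_cvg_right z0 Re_quarter0_gt0)).
rewrite mulr0 oppr0 expR0; apply: ccvg_lim; apply: ccvg_near_eq c.
by near=> u; apply: bE; near: u; exact: nbhs_right_gt.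
Unshelve. all: by end_near. Qed.

(** Separates the one term that is singular at the zeros of zeta from a remainder that already has
    the required decay. *)
Lemma frakP_decomposition t : 0 <= t -> exists2 r : R -> R[i], decays 3 r &
  forall x, x != 0 -> frakP zeta t x%:C =
    r x + diffquot t x%:C * logderiv zeta (critical x%:C).
Proof.
move=> t0; pose q := expR (- (2 * t)).
have q01 : 0 <= q <= 1 by rewrite expR_ge0/= -[leRHS]expR0 ler_expR oppr_le0 mulr_ge0.
have one01 : 0 <= (1 : R) <= 1 by rewrite lexx ler01.
pose r x : R[i] := 4 * ((expR (t / 2))%:C - 1) * (1 + (2%:C * 'i%C) * x%:C)^-1 +
  4 * ((expR (- (t / 2)))%:C - 1) * (1 + ((-2)%:C * 'i%C) * x%:C)^-1 +
  \sum_(1 <= n < (Num.truncn (expR t)).+1)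
    (vonMangoldt R n / Num.sqrt n%:R)%:C * diffquot (t - ln n%:R) x%:C +
  (* 1/4 = (i x / 2) / (2 i x); the sign is positive here because the digamma difference carries the
     opposite sign to the Lerch one. *)
  4^-1 * dgsum 1 (quarter x%:C) 4^-1 +
  - 4^-1 * (expR (- (t / 2)))%:C * dgsum q (quarter x%:C) 4^-1.
exists r.
  have le34 f : decays 4 f -> decays 3 f := @decays_le R 3 4 f isT.
  have n2 : (2 : R) != 0 by [].
  have n2' : (-2 : R) != 0 by rewrite oppr_eq0.
  apply: decaysD; last exact: decaysZ (decays_dgsum q01).
  apply: decaysD; last exact: decaysZ (decays_dgsum one01).
  apply: decaysD; last first.
    by apply: decays_sum => n; apply: decaysZ; apply: le34; exact: decays_diffquot.
  by apply: decaysD; apply: decaysZ; apply: le34; exact: decays_affine_inv.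
move=> x x0; rewrite /frakP -/(diffquot t x%:C) -/(critical x%:C) -/(quarter x%:C).
rewrite !logderiv_Gamma ?Re_quarter_gt0 ?Re_quarter0_gt0// psi_quarterB.
rewrite lerch_bracketE ?Re_quarter_gt0// -/q /r.
have xn : x%:C != 0 :> R[i] by rewrite -cabs_gt0 cabs_real normr_gt0.
have i0 : 'i%C != 0 :> R[i] by rewrite -cabs_gt0 cabsi.
have e1 : (2 : R)%:C = 2 :> R[i] by rewrite rmorph_nat.
have e2 : 1 + ((-2)%:C * 'i%C) * x%:C = 1 - 2 * 'i%C * x%:C :> R[i].
  by rewrite rmorphN rmorph_nat !mulNr.
rewrite e1 e2.
move: (dgsum 1 _ _) (dgsum q _ _) (\sum_(_ <= _ < _) _) (diffquot t _ * _) => a b S d.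
move: ((1 + 2 * 'i%C * x%:C)^-1) ((1 - 2 * 'i%C * x%:C)^-1) => c1 c2.
move: (x%:C) xn ('i%C) i0 => y yn I In.
by field; rewrite yn In.
Qed.

(* The poles of zeta'/zeta = i q / p - l are cancelled by the factor p. *)
Lemma cabs_frakS_factor x (p q : R) r d l : p != 0 ->
  cabs ('i%C * (p%:C / (p -i* q)) * (r + d * ('i%C * q%:C / p%:C - l))) <=
  cabs r + cabs d * (1 + cabs l).
Proof.
move=> p0; set e := p -i* q.
have e0 : e != 0 by apply: contra_neq p0 => /(congr1 (@complex.Re R)).
have pn : p%:C != 0 :> R[i] by rewrite -cabs_gt0 cabs_real normr_gt0.
have ec : 0 < cabs e by rewrite cabs_gt0.
(* p and - q are the coordinates of [e], so both quotients are bounded without a lower bound on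
   xi. *)
have pe : cabs (p%:C / e) <= 1.
  by rewrite cabs_div cabs_real ler_pdivrMr// mul1r; exact: (ler_cabs_Re e).
have qe : cabs ('i%C * q%:C / e) <= 1.
  rewrite cabs_div cabsM cabsi mul1r cabs_real ler_pdivrMr// mul1r.
  by have := ler_cabs_Im e; rewrite /= normrN.
have -> : 'i%C * (p%:C / e) * (r + d * ('i%C * q%:C / p%:C - l)) =
    'i%C * ((p%:C / e) * r + d * ('i%C * q%:C / e - (p%:C / e) * l)).
  move: (p%:C) pn e e0 {ec pe qe} => P Pn e e0; move: ('i%C) (q%:C) => I Q.
  by field; rewrite Pn e0.
rewrite cabsM cabsi mul1r (le_trans (ler_cabsD _ _))//.
move: (p%:C / e) ('i%C * q%:C / e) pe qe => a b a1 b1.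
rewrite !cabsM; apply: lerD; first by rewrite ler_piMl ?cabs_ge0.
rewrite ler_wpM2l ?cabs_ge0// (le_trans (ler_cabsB _ _))// lerD//.
by rewrite cabsM ler_piMl ?cabs_ge0.
Qed.

Definition frakS_raw t z : R[i] :=
  'i%C * (1 + sharp (Theta_xi zeta) z) / 2 * frakP zeta t z.

Lemma E_xi_real x : x != 0 -> zeta (critical x%:C) != 0 -> exists p q : R,
  [/\ p != 0, E_xi zeta x%:C = p +i* q, xi zeta (critical x%:C) = p%:C &
      derive1 (xi zeta) (critical x%:C) = 'i%C * q%:C].
Proof.
move=> x0 z0; have s0 := Re_critical_gt0 x; have si := Im_critical x0.
pose p := Re (xi zeta (critical x%:C)).
pose q := Im (derive1 (xi zeta) (critical x%:C)).
have pE : xi zeta (critical x%:C) = p%:C.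
  by apply: complex_ext => //=; rewrite xi_real.
have qE : derive1 (xi zeta) (critical x%:C) = 'i%C * q%:C.
  apply: complex_ext; rewrite ?cReM ?cImM /= ?mul0r ?mul1r ?add0r ?subrr//.
  by rewrite derive1_xi_imaginary// oppr0.
exists p, q; split => //.
  have : xi zeta (critical x%:C) != 0 by rewrite xiE// mulf_neq0// xi_factor_neq0.
  by rewrite pE -cabs_gt0 cabs_real normr_gt0.
by rewrite /E_xi -/(critical x%:C) pE qE; simpc.
Qed.

Lemma conj_real x : (x%:C)^* = x%:C :> R[i].
Proof. by apply: complex_ext; rewrite ?cRe_conj ?cIm_conj/= ?oppr0. Qed.

(** In quarters of exponents: the remainder has order -3, and the difference quotient, of order -4,
    meets A'/A, of order 1. *)
Lemma frakS_raw_bound t : 0 <= t -> exists C : R, forall x,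
  x != 0 -> zeta (critical x%:C) != 0 ->
  cabs (frakS_raw t x%:C) <= C * weight x ^- 3.
Proof.
move=> t0; have [r [C1 C10 H1] rE] := frakP_decomposition t0.
have [C2 C20 H2] := decays_diffquot t.
have [C3 C30 H3] := @xi_logder_growth R.
exists (C1 + C2 * (1 + C3)) => x x0 z0; have s0 := Re_critical_gt0 x; have si := Im_critical x0.
have [p [q [p0 EE pE qE]]] := E_xi_real x0 z0.
have A0 := xi_factor_neq0 x0.
have lE : logderiv zeta (critical x%:C) = 'i%C * q%:C / p%:C - xi_logder (critical x%:C).
  rewrite -qE -pE xiE// (derive1_cder (cder_xi zetaP s0 si)) /logderiv.
  move: (xi_factor _) A0 (zeta _) z0 (xi_logder _) (derive1 zeta _) => A A0 Z Z0 l d.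
  by field; rewrite A0 Z0.
have pq0 : p -i* q != 0 by apply: contra_neq p0 => /(congr1 (@complex.Re R)).
have gE : frakS_raw t x%:C = 'i%C * (p%:C / (p -i* q)) *
    (r x + diffquot t x%:C * ('i%C * q%:C / p%:C - xi_logder (critical x%:C))).
  rewrite /frakS_raw rE// lE sharp_ThetaE conj_real EE.
  congr (_ * _); rewrite -mulrA; congr (_ * _).
  have -> : (p +i* q)^* = p -i* q by [].
  have -> : p +i* q = 2 * p%:C - (p -i* q).
    by rewrite mulr_natl mulr2n; apply: complex_ext; rewrite /=; ring.
  move: (p -i* q) pq0 => e e0; by field.
rewrite gE (le_trans (cabs_frakS_factor x _ _ _ _ p0))//.
have w0 := weight_gt0 x; have w1 := weight_ge1 x.
rewrite mulrDl lerD ?H1//.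
have h : 1 + cabs (xi_logder (critical x%:C)) <= (1 + C3) * weight x.
  by rewrite mulrDl mul1r lerD// H3.
have h0 : 0 <= 1 + cabs (xi_logder (critical x%:C)) by rewrite addr_ge0 ?cabs_ge0.
rewrite (le_trans (ler_pM (cabs_ge0 _) h0 (H2 x x0) h))//.
rewrite mulrACA (_ : weight x ^- 4 * weight x = weight x ^- 3)//.
by rewrite (exprS (weight x) 3) invfM mulrAC mulVf ?mul1r ?gt_eqF.
Qed.

Lemma diffquot_continuous (tau : R) z : z != 0 -> diffquot tau w @[w --> z] --> diffquot tau z.
Proof.
move=> z0; have i0 : 'i%C != 0 :> R[i] by rewrite -cabs_gt0 cabsi.
have h1 : (fun w : R[i] => 'i%C * w) @ z --> 'i%C * z.
  by exact: (ccvgM (ccvg_cst 'i%C) (ccvg_id z)).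
have h2 : (fun w : R[i] => - ('i%C * w * tau%:C)) @ z --> - ('i%C * z * tau%:C).
  by exact: (ccvgN (ccvgM h1 (ccvg_cst tau%:C))).
have h3 : (fun w : R[i] => cexp (- ('i%C * w * tau%:C))) @ z --> cexp (- ('i%C * z * tau%:C)).
  by exact: (ccvg_cexp h2).
have h4 : (fun w : R[i] => ('i%C * w)^-1) @ z --> ('i%C * z)^-1.
  by exact: (ccvgV (mulf_neq0 i0 z0) h1).
exact: (ccvgM (ccvgB h3 (ccvg_cst 1)) h4).
Qed.

(** Continuity is needed in the complex variable and not only along the line, because [fill] takes
    its limit over a punctured complex neighbourhood. *)
Lemma frakP_continuous t x : 0 <= t -> x != 0 -> zeta (critical x%:C) != 0 ->
  frakP zeta t z @[z --> x%:C] --> frakP zeta t x%:C.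
Proof.
move=> t0 x0 z0; have si := Im_critical x0.
have xn : x%:C != 0 :> R[i] by rewrite -cabs_gt0 cabs_real normr_gt0.
have i0 : 'i%C != 0 :> R[i] by rewrite -cabs_gt0 cabsi.
have id := ccvg_id (x%:C : R[i]).
have d1 : 1 + 2 * 'i%C * x%:C != 0 :> R[i].
  by apply/eqP => /(congr1 (@complex.Re R)); rewrite -(rmorph_nat (real_complex R)) -mulrA cReD cReMr/=; lra.
have d2 : 1 - 2 * 'i%C * x%:C != 0 :> R[i].
  by apply/eqP => /(congr1 (@complex.Re R)); rewrite -(rmorph_nat (real_complex R)) -mulrA cReD cReN cReMr/=; lra.
have l1 : (fun z : R[i] => 2 * 'i%C * z) @ x%:C --> 2 * 'i%C * x%:C.
  by exact: (ccvgM (ccvg_cst (2 * 'i%C)) id).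
have t1 : (fun z : R[i] => 4 * ((expR (t / 2))%:C - 1) / (1 + 2 * 'i%C * z)) @ x%:C -->
    4 * ((expR (t / 2))%:C - 1) / (1 + 2 * 'i%C * x%:C).
  by exact: (ccvgM (ccvg_cst _) (ccvgV d1 (ccvgD (ccvg_cst 1) l1))).
have t2 : (fun z : R[i] => 4 * ((expR (- (t / 2)))%:C - 1) / (1 - 2 * 'i%C * z)) @ x%:C -->
    4 * ((expR (- (t / 2)))%:C - 1) / (1 - 2 * 'i%C * x%:C).
  by exact: (ccvgM (ccvg_cst _) (ccvgV d2 (ccvgB (ccvg_cst 1) l1))).
have cz : critical z @[z --> x%:C] --> critical x%:C by exact: critical_continuous.
have zc : zeta s @[s --> critical x%:C] --> zeta (critical x%:C).
  exact: cder_continuous (zeta_derivable zetaP si).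
have zc' : derive1 zeta s @[s --> critical x%:C] --> derive1 zeta (critical x%:C).
  exact: derive1_zeta_continuous zetaP _ si.
have t3' : (fun s : R[i] => logderiv zeta s) @ critical x%:C --> logderiv zeta (critical x%:C).
  by exact: (ccvgM zc' (ccvgV z0 zc)).
have t3 : (fun z : R[i] => diffquot t z * logderiv zeta (critical z)) @ x%:C -->
    diffquot t x%:C * logderiv zeta (critical x%:C).
  by exact: (ccvgM (diffquot_continuous (tau := t) xn) (cvg_comp _ _ cz t3')).
have t4 : (fun z : R[i] => \sum_(1 <= n < (Num.truncn (expR t)).+1)
      (vonMangoldt R n / Num.sqrt n%:R)%:C * diffquot (t - ln n%:R) z) @ x%:C -->
    \sum_(1 <= n < (Num.truncn (expR t)).+1)
      (vonMangoldt R n / Num.sqrt n%:R)%:C * diffquot (t - ln n%:R) x%:C.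
  apply: (ccvg_sum (F := nbhs (x%:C : R[i]))) => n _.
  by exact: (ccvgM (ccvg_cst _) (diffquot_continuous (tau := t - ln n%:R) xn)).
have qc : quarter z @[z --> x%:C] --> quarter x%:C.
  by exact: (ccvgB (ccvg_cst 4^-1) (ccvgM (ccvgM (ccvg_cst 'i%C) id) (ccvg_cst 2^-1))).
have q0 := Re_quarter_gt0 x.
(* The digamma and Lerch formulas hold only where this real part is positive, so they are used on a
   neighbourhood. *)
have qnear : \forall z \near x%:C, 0 < Re (quarter z).
  by have := qc _ (near_Re_gt q0).
have t5' : (fun z : R[i] => logderiv (@Gamma R) (quarter z)) @ x%:C -->
    logderiv (@Gamma R) (quarter x%:C).
  have e : \forall z \near x%:C, logderiv (@Gamma R) (quarter z) = psi (quarter z).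
    by apply: filterS qnear => z zq; exact: logderiv_Gamma.
  have c : psi (quarter z) @[z --> x%:C] --> psi (quarter x%:C).
    by exact: (cvg_comp _ _ qc (psi_continuous q0)).
  by rewrite (logderiv_Gamma q0); exact: (ccvg_near_eq e c).
have l2 : (fun z : R[i] => (2 * 'i%C * z)^-1) @ x%:C --> (2 * 'i%C * x%:C)^-1.
  have n0 : 2 * 'i%C * x%:C != 0 :> R[i].
    by apply: mulf_neq0; [apply: mulf_neq0; [rewrite pnatr_eq0|]|].
  by exact: (ccvgV n0 l1).
have t6' : (fun z : R[i] => lerch_bracket t z) @ x%:C --> lerch_bracket t x%:C.
  pose q := expR (- (2 * t)).
  have q01 : 0 <= q <= 1 by rewrite expR_ge0/= -[leRHS]expR0 ler_expR oppr_le0 mulr_ge0.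
  have e : \forall z \near x%:C, lerch_bracket t z = ('i%C * z / 2) * dgsum q (quarter z) 4^-1.
    by apply: filterS qnear => z zq; exact: lerch_bracketE.
  rewrite (lerch_bracketE t0 q0).
  apply: (ccvg_near_eq (F := nbhs (x%:C : R[i])) e).
  by exact: (ccvgM (ccvgM (ccvgM (ccvg_cst 'i%C) id) (ccvg_cst 2^-1))
    (cvg_comp _ _ qc (dgsum_continuous q01 q0 Re_quarter0_gt0))).
exact: (ccvgB (ccvgB (ccvgD (ccvgD (ccvgD t1 t2) t3) t4)
  (ccvgM l2 (ccvgB t5' (ccvg_cst _)))) (ccvgM (ccvgM l2 (ccvg_cst _)) t6')).
Qed.

Lemma frakS_raw_continuous t x : 0 <= t -> x != 0 -> zeta (critical x%:C) != 0 ->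
  frakS_raw t z @[z --> x%:C] --> frakS_raw t x%:C.
Proof.
move=> t0 x0 z0; have s0 := Re_critical_gt0 x; have si := Im_critical x0.
have [p [q [p0 EE _ _]]] := E_xi_real x0 z0.
have cE : E_xi zeta z @[z --> x%:C] --> E_xi zeta x%:C by exact: E_xi_continuous.
have cc : (fun z : R[i] => z^*) @ x%:C --> x%:C.
  by rewrite -[X in _ --> X]conj_real; exact: (cvg_conj (ccvg_id (x%:C : R[i]))).
have cE' : (fun z : R[i] => (E_xi zeta z^*)^*) @ x%:C --> (E_xi zeta x%:C)^*.
  by exact: (cvg_conj (cvg_comp _ _ cc cE)).
have E0 : (E_xi zeta x%:C)^* != 0.
  by rewrite EE; apply: contra_neq p0 => /(congr1 (@complex.Re R)).
have cT : sharp (Theta_xi zeta) z @[z --> x%:C] --> sharp (Theta_xi zeta) x%:C.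
  rewrite sharp_ThetaE conj_real.
  have e : \forall z \near x%:C, sharp (Theta_xi zeta) z = E_xi zeta z / (E_xi zeta z^*)^*.
    by near=> z; exact: sharp_ThetaE.
  have c : E_xi zeta z / (E_xi zeta z^*)^* @[z --> x%:C] --> E_xi zeta x%:C / (E_xi zeta x%:C)^*.
    by exact: (ccvgM cE (ccvgV E0 cE')).
  by exact: (ccvg_near_eq e c).
exact: (ccvgM (ccvgM (ccvgM (ccvg_cst 'i%C) (ccvgD (ccvg_cst 1) cT)) (ccvg_cst 2^-1))
  (frakP_continuous t0 x0 z0)).
Unshelve. all: by end_near. Qed.

Definition bad_points : set R := [set x | x = 0 \/ zeta (critical x%:C) = 0].

(** The zeros off x = 0 form a discrete set; the point 0 is treated apart because
    [zeta_zeros_isolated] works off the real axis. *)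
Lemma bad_points_countable : countable bad_points.
Proof.
pose Z : set R := [set x | x != 0 /\ zeta (critical x%:C) = 0].
suff cZ : countable Z.
  pose F (b : bool) := if b then [set 0 : R] else Z.
  apply: (@sub_countable _ _ _ (\bigcup_(b in [set: bool]) F b)).
    apply: subset_card_le => x [->|zx]; first by exists true.
    by have [->|x0] := eqVneq x 0; [exists true|exists false].
  by apply: bigcup_countable => [|[] _]; [exact: countableP|exact: countable1|exact: cZ].
apply: countable_discrete => x [x0 zx].
have [e e0 He] := zeta_zeros_isolated zetaP (Im_critical x0).
exists e => // y [y0 zy] yx; apply/eqP/negPn/negP => nyx.
have d : critical y%:C - critical x%:C = - 'i%C * (y - x)%:C.
  by rewrite /critical rmorphB; ring.
have nz : zeta (critical y%:C) != 0.
  apply: He; last by rewrite d cabsM cabsN cabsi mul1r cabs_real.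
  by rewrite -subr_eq0 -cabs_eq0 d cabsM cabsN cabsi mul1r cabs_real normr_eq0 subr_eq0.
by rewrite zy eqxx in nz.
Qed.

Lemma critical_line_continuous x : critical y%:C @[y --> x] --> critical x%:C.
Proof.
have h : y%:C @[y --> x] --> (x%:C : R[i]) by apply: cvg_real_complex; exact: cvg_id.
by exact: (cvg_comp _ _ h (critical_continuous (z := x%:C))).
Qed.

Lemma good_pointP x : ~ bad_points x -> x != 0 /\ zeta (critical x%:C) != 0.
Proof.
by move=> H; split; apply/eqP => h; apply: H; [left|right].
Qed.

Lemma near_good x : ~ bad_points x -> \forall y \near x, ~ bad_points y.
Proof.
move=> /good_pointP[x0 z0].
have zc : zeta s @[s --> critical x%:C] --> zeta (critical x%:C).
  exact: cder_continuous (zeta_derivable zetaP (Im_critical x0)).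
have c : (fun y => cabs (zeta (critical y%:C))) @ x --> cabs (zeta (critical x%:C)).
  exact: cvg_cabs (cvg_comp _ _ (critical_line_continuous (x := x)) zc).
near=> y => -[y0|zy].
  have : y != 0 by near: y; apply: open_nbhs_nbhs; split => //; exact: open_neq.
  by rewrite y0 eqxx.
have : 0 < cabs (zeta (critical y%:C)).
  by near: y; apply: (cvgr_gt _ c); rewrite cabs_gt0.
by rewrite zy cabs0 ltxx.
Unshelve. all: by end_near. Qed.

(** At a good point the raw formula is continuous, so filling leaves its value unchanged; bad points
    are absorbed in the null set of [L2_of_bound]. *)
Lemma frakSE t x : ~ bad_points x -> frakS zeta t x%:C = frakS_raw `|t| x%:C.
Proof. by move=> /good_pointP[x0 z0]; apply: fill_eq; exact: frakS_raw_continuous. Qed.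

Lemma frakS_L2 t : L2 (fun x : R => frakS zeta t x%:C).
Proof.
have [C HC] := frakS_raw_bound (normr_ge0 t).
apply: (L2_of_bound (D := bad_points) (C := C)).
- exact: bad_points_countable.
- by rewrite openE => x /near_good.
- move=> x Dx; rewrite frakSE//; have [x0 z0] := good_pointP Dx.
  have e : \forall y \near x, frakS zeta t y%:C = frakS_raw `|t| y%:C.
    by apply: filterS (near_good Dx) => y; exact: frakSE.
  have h : y%:C @[y --> x] --> (x%:C : R[i]) by apply: cvg_real_complex; exact: cvg_id.
  have c : frakS_raw `|t| y%:C @[y --> x] --> frakS_raw `|t| x%:C.
    by exact: (cvg_comp _ _ h (frakS_raw_continuous (normr_ge0 t) x0 z0)).
  by exact: (ccvg_near_eq e c).
- by move=> x Dx; rewrite frakSE//; have [x0 z0] := good_pointP Dx; exact: HC.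
Qed.

End Screw.

Theorem proposition1p2 (R : realType) (zeta : complex R -> complex R)
    (zetaP : is_riemann_zeta zeta) (t : R) :
  L2 (fun x : R => frakS zeta t (real_complex R x)).
Proof. exact: frakS_L2. Qed.
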